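(* Let $n\ge 2$ and $\boldsymbol d=(d_1,\dots,d_n)\in\mathbb Z_{\ge 2}^n$ with $d_n-1>\sum_{i=1}^{n-1}(d_i-1)$. Then the Nash resultant variety $\mathcal R(\boldsymbol d)\subseteq\mathbb P(V^{\oplus n})$ is irreducible, of codimension $c:=d_n-1-\sum_{i=1}^{n-1}(d_i-1)$, and of degree $$\deg\mathcal R(\boldsymbol d)=\frac{(d_n-1)!}{(d_1-1)!\cdots(d_{n-1}-1)!\,c!}.$$
   Context: For $i\in[n]$ let $V_i=\mathbb C^{d_i}$ with coordinates $\pi^{(i)}=(\pi^{(i)}_1,\dots,\pi^{(i)}_{d_i})$, $V=V_1\otimes\cdots\otimes V_n$, $I=\prod_i[d_i]$, $\mathbb P^{\boldsymbol d}=\prod_i\mathbb P^{d_i-1}$. A game is $X=(X^{(1)},\dots,X^{(n)})\in V^{\oplus n}$ with $X^{(i)}=(x^{(i)}_{\boldsymbol j})_{\boldsymbol j\in I}$. For $i\in[n]$, $k\in[d_i]$, let $f^{(i)}_k=\sum x^{(i)}_{(j_1,\dots,j_{i-1},k,j_{i+1},\dots,j_n)}\prod_{l\ne i}\pi^{(l)}_{j_l}$, summed over all $(j_l)_{l\ne i}$. The Nash equilibrium scheme $\mathcal Z_X\subseteq\mathbb P^{\boldsymbol d}$ is defined by the multihomogeneous ideal generated by all $f^{(i)}_1-f^{(i)}_k$, $i\in[n]$, $k\in\{2,\dots,d_i\}$. The Nash resultant variety is $\mathcal R(\boldsymbol d)=\{[X]\in\mathbb P(V^{\oplus n}) : \mathcal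 Z_X\ne\emptyset\}$. *)

(* Defs.v *)
From HB Require Import structures.
From mathcomp Require Import all_boot all_order all_algebra.
From mathcomp Require Import reals complex.
Set Implicit Arguments. Unset Strict Implicit. Unset Printing Implicit Defensive.
Import Order.TTheory GRing.Theory Num.Theory.
Local Open Scope ring_scope.

(* Points of the projective space P(K^C) (C a finite index set of       *)
(* coordinates) are represented by nonzero vectors x : C -> K; subsets  *)
(* of P(K^C) are represented by scaling-invariant sets of such vectors. *)

Section ProjGeom.
Variables (K : fieldType) (C : finType).

Definition pt := C -> K.
Definition pset := pt -> Prop.

Definition nonzero (x : pt) : Prop := exists c, x c != 0.

Definition expo := {ffun C -> nat}.
Definition cpoly := seq (K * expo).
Definition peval (p : cpoly) (x : pt) : K :=
  \sum_(q <- p) q.1 * \prod_(c : C) x c ^+ q.2 c.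
Definition homog_of (t : nat) (p : cpoly) : Prop :=
  forall q, q \in p -> (\sum_(c : C) q.2 c)%N = t.
Definition homog (p : cpoly) : Prop := exists t, homog_of t p.

Definition pclosed (A : pset) : Prop :=
  exists F : cpoly -> Prop, (forall p, F p -> homog p) /\
    forall x, A x <-> (nonzero x /\ forall p, F p -> peval p x = 0).

Definition psubset (A B : pset) : Prop := forall x, A x -> B x.

Definition pirreducible (Y : pset) : Prop :=
  (exists x, Y x) /\
  forall A B : pset, pclosed A -> pclosed B ->
    psubset Y (fun x => A x \/ B x) -> psubset Y A \/ psubset Y B.

Definition pchain (Y : pset) (r : nat) (Z : nat -> pset) : Prop :=
  (forall j, (j <= r)%N ->
     (exists A, pclosed A /\ forall x, Z j x <-> (Y x /\ A x))
     /\ pirreducible (Z j)) /\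
  (forall j, (j < r)%N ->
     psubset (Z j) (Z j.+1) /\ exists x, Z j.+1 x /\ ~ Z j x).

Definition pdim (Y : pset) (r : nat) : Prop :=
  (exists Z, pchain Y r Z) /\ forall r' Z, pchain Y r' Z -> (r' <= r)%N.

(* Hilbert function: h_Y(t) = m, the dimension of the space of degree-t *)
(* forms modulo those vanishing on Y, i.e. the maximal number of        *)
(* degree-t forms that are linearly independent as functions on Y.      *)
Definition indep_on (Y : pset) (m : nat) (p : 'I_m -> cpoly) : Prop :=
  forall a : 'I_m -> K,
    (forall x, Y x -> \sum_(j < m) a j * peval (p j) x = 0) ->
    forall j, a j = 0.
Definition hilb (Y : pset) (t m : nat) : Prop :=
  (exists p : 'I_m -> cpoly, (forall j, homog_of t (p j)) /\ indep_on Y p) /\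
  forall m' (p : 'I_m' -> cpoly),
    (forall j, homog_of t (p j)) -> indep_on Y p -> (m' <= m)%N.

Definition pdegree (Y : pset) (e : nat) : Prop :=
  exists r, pdim Y r /\
  exists (P : {poly rat}) (t0 : nat),
    size P = r.+1 /\ lead_coef P * (r`!)%:R = e%:R /\
    forall t, (t0 <= t)%N -> exists m, hilb Y t m /\ P.[t%:R] = m%:R.

End ProjGeom.

Notation profile n d := {dffun forall i : 'I_n, 'I_(d i)}.

Notation gcoord n d := ('I_n * profile n d)%type.

Definition nash_f (K : fieldType) (n : nat) (d : nat -> nat)
  (X : gcoord n d -> K) (pi : forall i : 'I_n, 'I_(d i) -> K)
  (i : 'I_n) (k : 'I_(d i)) : K :=
  \sum_(s : profile n d | s i == k)
     X (i, s) * \prod_(l : 'I_n | l != i) pi l (s l).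

Arguments nash_f {K n d} X pi i k.

(* Z_X is nonempty: it has a (closed) point in prod_i P^{d_i - 1}       *)
Definition nash_nonempty (K : fieldType) (n : nat) (d : nat -> nat)
  (X : gcoord n d -> K) : Prop :=
  exists pi : forall i : 'I_n, 'I_(d i) -> K,
    (forall i, exists k, pi i k != 0) /\
    forall (i : 'I_n) (k : 'I_(d i)), (0 < k)%N ->
      nash_f X pi i (Ordinal (leq_ltn_trans (leq0n k) (ltn_ord k)))
      = nash_f X pi i k.

Definition nash_resultant (K : fieldType) (n : nat) (d : nat -> nat)
  : pset K (gcoord n d) :=
  fun X => nonzero X /\ nash_nonempty X.

(* Main.v *)
(* Only the payoffs of the last player matter: the equations of the other
   players are linear in the mixed strategy of the last one, and there are fewer
   of them than unknowns.  After replacing the last player's payoffs by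
   differences, X lies in the resultant variety iff m = d_n - 1 row vectors
   w_1, ..., w_m of X are all orthogonal to some decomposable tensor
   s = y^(1) x ... x y^(n-1), i.e. iff the incidence variety of pairs (X, y) has
   a point over X.  This incidence variety is irreducible because any two of its
   points are joined by a polynomial curve.

   On it, monomials of degree t in X and of a fixed large degree a in y have a
   basis of standard monomials, obtained by imposing the equations one row at a
   time; counting them gives a recursion whose leading term is the multinomial
   coefficient m! / (prod_i (d_i - 1)! c!).  Their number bounds the Hilbert
   function of the resultant variety from above.  Conversely let R be a form of
   least degree vanishing on the variety; its gradient along one row is
   proportional to s, so that y is a rational function of X, and clearing
   denominators shows that the same number bounds a shift of the Hilbert function
   from below.  As Hilbert functions are eventually polynomial (Dickson's lemma
   applied to standard monomials for the lexicographic order), this gives the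
   degree and the leading coefficient of the Hilbert polynomial.

   A strict inclusion of irreducible sets lowers the degree of the Hilbert
   polynomial, which bounds the length of chains.  A chain of maximal length is
   made of coordinate subspaces followed by the loci where s is restricted to
   ever larger coordinate subspaces of the Segre variety.  *)
Require Import Defs.
From HB Require Import structures.
From mathcomp Require Import all_boot all_order all_algebra.
From mathcomp Require Import reals complex.
From mathcomp Require Import boolp ring lra zify.
Set Implicit Arguments. Unset Strict Implicit. Unset Printing Implicit Defensive.
Import Order.TTheory GRing.Theory Num.Theory.
Local Open Scope ring_scope.

(** * Exponents and eventually polynomial functions *)

(** The variety is only a projection of the incidence variety, so its ideal is not given by the row
    equations; this is why its Hilbert function is squeezed rather than computed. A polynomial
    caught between another one and a translate of it has the same leading term, so the shift in the
    lower bound is harmless. The degree [a] in [y] exceeds the number of rows because eliminating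
    one row may cost each player one unit of [y]-degree. Loci where fewer coordinates of [y] may be
    nonzero, encoded by [kap], are forced by the elimination itself: the coefficient by which a row
    is solved can vanish, and its vanishing locus splits according to the player whose last
    coordinate vanishes. The same loci then serve in the chain. The strict inequality [c > 0] says
    that there are more rows than dimensions in the product of projective spaces, which makes the
    locus proper and provides the form whose gradient recovers [y]. All generic choices amount to
    evaluating a nonzero univariate polynomial at a natural number, which characteristic zero
    permits; hence the polynomial curves. *)

Lemma count_bij (T1 T2 : eqType) (f : T1 -> T2) (g : T2 -> T1)
    (P1 : pred T1) (P2 : pred T2) (s1 : seq T1) (s2 : seq T2) :
  uniq s1 -> uniq s2 ->
  (forall x, x \in s1 -> P1 x -> [/\ f x \in s2, P2 (f x) & g (f x) = x]) ->
  (forall y, y \in s2 -> P2 y -> [/\ g y \in s1, P1 (g y) & f (g y) = y]) ->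
  count P1 s1 = count P2 s2.
Proof.
move=> u1 u2 Hf Hg; rewrite -!size_filter -(size_map f).
apply: perm_size; apply: uniq_perm; rewrite ?filter_uniq //.
  rewrite map_inj_in_uniq ?filter_uniq // => x y.
  rewrite !mem_filter => /andP[px sx] /andP[py sy] e.
  by have [_ _ <-] := Hf _ sx px; have [_ _ <-] := Hf _ sy py; rewrite e.
move=> y; apply/mapP/idP => [[x]|].
  by rewrite !mem_filter => /andP[px sx] ->; have [-> -> _] := Hf _ sx px.
rewrite mem_filter => /andP[py sy]; have [gs gp fg] := Hg _ sy py.
by exists (g y); rewrite // mem_filter gs gp.
Qed.

Lemma count_split (T : Type) (P a : pred T) (s : seq T) :
  count P s = (count (fun x => P x && a x) s + count (fun x => P x && ~~ a x) s)%N.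
Proof. by elim: s => //= x s ->; case: (P x) (a x) => [] []; lia. Qed.

Section Exponents.
Variable V : finType.
Implicit Types u v : expo V.

Definition edeg u : nat := \sum_c u c.
Definition e0 : expo V := [ffun=> 0%N].
Definition eX (c : V) : expo V := [ffun c' => (c' == c) : nat].
Definition eadd u v : expo V := [ffun c => u c + v c]%N.
Definition esub u v : expo V := [ffun c => u c - v c]%N.

Definition mons (t : nat) : seq (expo V) :=
  [seq u <- [seq [ffun c => (f c : nat)] | f : {ffun V -> 'I_t.+1}] | edeg u == t].

Lemma mons_uniq t : uniq (mons t).
Proof.
rewrite filter_uniq // map_inj_uniq ?enum_uniq // => f g /ffunP e.
by apply/ffunP => c; apply: val_inj; have := e c; rewrite !ffunE.
Qed.

Lemma leq_edeg u c : (u c <= edeg u)%N.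
Proof. by rewrite /edeg (bigD1 c) //= leq_addr. Qed.

Lemma mem_mons t u : (u \in mons t) = (edeg u == t).
Proof.
rewrite mem_filter; case: eqP => //= <-.
apply/mapP; exists [ffun c => inord (u c)]; first by rewrite mem_enum.
by apply/ffunP => c; rewrite !ffunE inordK // ltnS leq_edeg.
Qed.

Lemma edegD u v : edeg (eadd u v) = (edeg u + edeg v)%N.
Proof. by rewrite /edeg -big_split; apply: eq_bigr => c _; rewrite ffunE. Qed.

Lemma edegX c : edeg (eX c) = 1%N.
Proof.
rewrite /edeg (bigD1 c) //= big1 ?ffunE ?eqxx // => c' /negbTE h.
by rewrite ffunE h.
Qed.

Lemma edeg0 : edeg e0 = 0%N.
Proof. by rewrite /edeg big1 // => c _; rewrite ffunE. Qed.

Lemma eaddC u v : eadd u v = eadd v u.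
Proof. by apply/ffunP => c; rewrite !ffunE addnC. Qed.

Lemma eaddA u v w : eadd u (eadd v w) = eadd (eadd u v) w.
Proof. by apply/ffunP => c; rewrite !ffunE addnA. Qed.

Lemma eaddAC u v w : eadd (eadd u v) w = eadd (eadd u w) v.
Proof. by rewrite -!eaddA [eadd v w]eaddC. Qed.

Lemma eaddK u v : esub (eadd u v) v = u.
Proof. by apply/ffunP => c; rewrite !ffunE addnK. Qed.

Lemma esubK u v : (forall c, (v c <= u c)%N) -> eadd (esub u v) v = u.
Proof. by move=> h; apply/ffunP => c; rewrite !ffunE subnK. Qed.

Lemma esubXK u c : (0 < u c)%N -> eadd (esub u (eX c)) (eX c) = u.
Proof. by move=> h; apply: esubK => c'; rewrite ffunE; case: eqP => // ->. Qed.

Lemma edeg_subX u c : (0 < u c)%N -> (edeg (esub u (eX c))).+1 = edeg u.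
Proof. by move=> h; rewrite -{2}(esubXK h) edegD edegX addn1. Qed.

Lemma count_mons_shift (c : V) (P : pred (expo V)) t :
  count (fun u => P u && (0 < u c)%N) (mons t.+1) =
  count (fun u => P (eadd u (eX c))) (mons t).
Proof.
apply: (@count_bij _ _ (fun u => esub u (eX c)) (fun u => eadd u (eX c)));
  rewrite ?mons_uniq // => u; rewrite !mem_mons => /eqP hu.
  move=> /andP[Pu uc]; split; rewrite ?mem_mons ?esubXK //.
  by rewrite -eqSS edeg_subX // hu.
move=> Pu; split; rewrite ?mem_mons ?eaddK //.
  by rewrite edegD edegX hu addn1.
by rewrite Pu !ffunE eqxx addn1.
Qed.

End Exponents.

Definition evpoly (f : nat -> nat) : Prop :=
  exists (P : {poly rat}) t0, forall t, (t0 <= t)%N -> (f t)%:R = P.[t%:R].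

Lemma horner_comp_XsubC (R : comNzRingType) (P : {poly R}) a x :
  (P \Po ('X - a%:P)).[x] = P.[x - a].
Proof. by rewrite horner_comp !hornerE. Qed.

Lemma comp_XsubC_coef (F : numFieldType) (P : {poly F}) (a : F) n :
  (size P <= n.+1)%N ->
  (P \Po ('X - a%:P))`_n = P`_n /\ (size (P \Po ('X - a%:P)) <= n.+1)%N.
Proof.
move=> sP; have s2 : size ('X - a%:P : {poly F}) = 2%N by rewrite size_XsubC.
have -> : size (P \Po ('X - a%:P)) = size P by rewrite size_comp_poly2.
split => //; move: sP; rewrite leq_eqVlt => /orP[/eqP sP|sP]; last first.
  by rewrite !nth_default // size_comp_poly2.
have := lead_coef_comp P (q := 'X - a%:P); rewrite s2 => /(_ isT).
rewrite /lead_coef size_comp_poly2 // sP /= => ->.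
by rewrite -[_`_(size _).-1]/(lead_coef _) lead_coefXsubC expr1n mulr1.
Qed.

Lemma diff_coef (F : numFieldType) (P : {poly F}) (n : nat) :
  (size P <= n.+2)%N ->
  (size (P - (P \Po ('X - 1%:P)))%R <= n.+1)%N /\
  (P - (P \Po ('X - 1%:P)))`_n = n.+1%:R * P`_(n.+1).
Proof.
elim/poly_ind: P n => [n|p c IH n].
  by rewrite comp_poly0 subr0 size_poly0 !coef0 mulr0.
move=> sP.
have sp : (size p <= n.+1)%N.
  move: sP; rewrite size_MXaddC; case: ifP => [/andP[/eqP-> _]|_] //.
  by rewrite size_poly0.
have [e1 e2] := comp_XsubC_coef 1 sp.
have -> : p * 'X + c%:P - ((p * 'X + c%:P) \Po ('X - 1%:P))
   = (p - (p \Po ('X - 1%:P))) * 'X + (p \Po ('X - 1%:P)).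
  by rewrite comp_polyD comp_polyM comp_polyX comp_polyC; ring.
case: n sP sp e1 e2 => [|n] sP sp e1 e2.
  have [k ->] : exists k, p = k%:P by exists p`_0; rewrite -size1_polyC.
  by rewrite comp_polyC subrr mul0r add0r coefD coefMX !coefC /= addr0 mul1r; split; rewrite // size_polyC; case: (k != 0).
have [i1 i2] := IH n sp; split.
  apply: leq_trans (size_polyD _ _) _; rewrite geq_max e2 andbT.
  by apply: leq_trans (size_polyMleq _ _) _; rewrite size_polyX addn2 /= ltnS.
rewrite coefD coefMX /= i2 e1 coefD coefMX !coefC /= addr0.
by rewrite -[in RHS]natr1; ring.
Qed.

(** The backward difference sends a polynomial of degree [n + 1] to one of degree [n] and multiplies
    the top coefficient by the invertible [n + 1], so [Q] is matched from its top coefficient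
    downwards. *)
Lemma antidiff (F : numFieldType) (n : nat) (Q : {poly F}) : (size Q <= n)%N ->
  exists P : {poly F}, P - (P \Po ('X - 1%:P)) = Q.
Proof.
elim: n Q => [|n IH] Q sQ.
  exists 0; rewrite comp_poly0 subr0.
  by move: sQ; rewrite leqn0 size_poly_eq0 => /eqP ->.
pose M : {poly F} := (Q`_n / n.+1%:R) *: 'X^(n.+1).
have sM : (size M <= n.+2)%N.
  by rewrite (leq_trans (size_scale_leq _ _)) // size_polyXn.
have [d1 d2] := diff_coef sM.
have : (size (Q - (M - (M \Po ('X - 1%:P))))%R <= n)%N.
  apply/leq_sizeP => j; rewrite leq_eqVlt => /orP[/eqP <-|nj].
    rewrite coefB d2 coefZ coefXn eqxx mulr1 mulrC divfK ?subrr //.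
    by rewrite pnatr_eq0.
  by rewrite coefB !nth_default ?subrr //; apply: leq_trans nj.
move=> /IH[P hP]; exists (P + M); rewrite comp_polyD opprD addrACA hP.
by rewrite subrK.
Qed.

Lemma evpoly_diff (f g : nat -> nat) (t0 : nat) : evpoly g ->
  (forall t, (t0 <= t)%N -> f t.+1 = g t.+1 + f t)%N -> evpoly f.
Proof.
move=> [Q [t1 hQ]] hf; have [P hP] := antidiff (leqnn (size Q)).
pose T := maxn t0 t1; exists (P + ((f T)%:R - P.[T%:R])%:P), T => t.
elim: t => [|t IH].
  by rewrite leqn0 => /eqP ->; rewrite hornerD hornerC; ring.
rewrite leq_eqVlt => /orP[/eqP ->|]; first by rewrite hornerD hornerC; ring.
rewrite ltnS => Tt; rewrite hf ?(leq_trans _ Tt) ?leq_maxl // natrD IH //.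
rewrite hQ; last by rewrite (leq_trans _ (leqW Tt)) // leq_maxr.
rewrite -hP !(hornerD, hornerN) horner_comp_XsubC !hornerC.
by rewrite (_ : t.+1%:R - 1 = t%:R) -?natr1; ring.
Qed.

Lemma evpoly_add_shift (f g h : nat -> nat) : evpoly g -> evpoly h ->
  (forall t, f t.+1 = g t.+1 + h t)%N -> evpoly f.
Proof.
move=> [P [t0 hP]] [Q [t1 hQ]] hf.
exists (P + (Q \Po ('X - 1%:P))), (maxn t0 t1).+1 => -[|t]; rewrite // ltnS geq_max.
move=> /andP[h0 h1]; rewrite hf natrD hornerD horner_comp_XsubC hQ // hP; last first.
  exact: leqW.
by rewrite -natr1 addrK.
Qed.

(** * Lower sets of exponents and the growth of their counting functions *)

Section DownSets.
Variable V : finType.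
Implicit Types (D : expo V -> bool) (cs : seq V) (u v : expo V).

Definition downset D := forall u v : expo V, D (eadd u v) -> D u.
Definition supp_in cs (u : expo V) := [forall c, (c \notin cs) ==> (u c == 0%N)].

Lemma supp_inP cs u : reflect (forall c, c \notin cs -> u c = 0%N) (supp_in cs u).
Proof.
apply: (iffP forallP) => h c; first by move=> hc; apply/eqP/(implyP (h c)).
by apply/implyP => hc; apply/eqP/h.
Qed.

Definition emulX (k : nat) (c : V) : expo V := [ffun c' => if c' == c then k else 0%N].

Lemma unif_bound (P : nat -> nat -> Prop) (N : nat) :
  (forall e k k', (k <= k')%N -> P e k -> P e k') ->
  (forall e, exists k, P e k) -> exists k, forall e, (e < N)%N -> P e k.
Proof.
move=> mon h; elim: N => [|N [k hk]]; first by exists 0%N.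
have [k' hk'] := h N; exists (maxn k k') => e; rewrite ltnS leq_eqVlt.
case/orP => [/eqP ->|/hk]; first by apply: mon hk'; rewrite leq_maxr.
by apply: mon; rewrite leq_maxl.
Qed.

(* Dickson's lemma, as the stabilization of descending chains of lower sets. *)
Lemma chain_stable cs (D : nat -> expo V -> bool) :
  (forall k, downset (D k)) -> (forall k k' u, (k <= k')%N -> D k' u -> D k u) ->
  exists k0, forall k u, (k0 <= k)%N -> supp_in cs u -> D k0 u -> D k u.
Proof.
elim: cs D => [|c cs IH] D dD mD.
  have [[k0 hk0]|h] := pselect (exists k, ~~ D k (e0 V)); last first.
    exists 0%N => k u _ /supp_inP hu _.
    have -> : u = e0 V by apply/ffunP => c; rewrite ffunE hu.
    by apply: contrapT => /negP hk; apply: h; exists k.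
  exists k0 => k u _ /supp_inP hu; have -> : u = e0 V by apply/ffunP => c; rewrite ffunE hu.
  by move/negP: hk0.
have decomp u : supp_in (c :: cs) u ->
    exists2 u', supp_in cs u' & u = eadd u' (emulX (u c) c).
  move=> /supp_inP hu; exists [ffun c' => if c' \in cs then
       (if c' == c then 0%N else u c') else 0%N].
    by apply/supp_inP => c' /negbTE h; rewrite ffunE h.
  apply/ffunP => c'; rewrite !ffunE; case: (eqVneq c' c) => [->|nc] //.
    by case: ifP.
  by case: ifP => //= h; rewrite ?addn0 // hu // inE negb_or nc h.
have sl k e : downset (fun u => D k (eadd u (emulX e c))).
  move=> u v; rewrite -eaddA [eadd v _]eaddC eaddA; exact: dD.
have slm k e e' u : (e <= e')%N ->
    D k (eadd u (emulX e' c)) -> D k (eadd u (emulX e c)).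
  move=> le h; apply: (dD _ _ (emulX (e' - e) c)).
  rewrite (_ : eadd _ _ = eadd u (emulX e' c)) //.
  apply/ffunP => c'; rewrite !ffunE; case: ifP => _; rewrite ?addn0 //.
  by rewrite -addnA subnKC.
(* Diagonal slices, where the stage and the exponent of [c] grow together: once they are stable, all
   exponents of [c] from [e1] on are settled at the same time. *)
have [|k k' u le|e1 He1] := IH (fun e u => D e (eadd u (emulX e c))).
- by move=> k; apply: sl.
- by move=> h; apply: (slm _ _ k') => //; apply: mD h.
(* Each of the finitely many exponents below [e1] has a slice that stabilizes by induction; [k1] is
   a common stage for them. *)
have [||k1 Hk1] := unif_bound (P := fun e k0 => forall k u, (k0 <= k)%N ->
    supp_in cs u -> D k0 (eadd u (emulX e c)) -> D k (eadd u (emulX e c))) e1.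
- move=> e k k' le h k2 u le2 hu h2; apply: h => //; first exact: leq_trans le2.
  exact: mD h2.
- move=> e; apply: (IH (fun k u => D k (eadd u (emulX e c)))).
    by move=> k; apply: sl.
  by move=> k k' u le; apply: mD.
exists (maxn e1 k1) => k u le /decomp[u' hu' ->].
have le1 : (e1 <= k)%N by apply: leq_trans le; rewrite leq_maxl.
have le2 : (k1 <= k)%N by apply: leq_trans le; rewrite leq_maxr.
case: (ltnP (u c) e1) => h hD.
  apply: Hk1 => //; apply: mD hD; exact: leq_maxr.
have h3 : D e1 (eadd u' (emulX e1 c)).
  apply: (slm _ _ (u c)) => //; apply: mD hD; exact: leq_maxl.
have := He1 (maxn k (u c)) u' _ hu' h3; rewrite leq_max le1 => /(_ isT) h4.
apply: (slm _ _ (maxn k (u c))); first exact: leq_maxr.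
apply: mD h4; exact: leq_maxl.
Qed.

(** Separating the exponents divisible by [c] gives [f k t.+1 = g k t.+1 + f k.+1 t], where [g]
    involves one variable less. By [chain_stable] the slices are constant from [k0] to [k0.+1], so
    at [k0] this is a summation of an eventually polynomial function; the recursion then descends
    from [k0] to 0. *)
Lemma downset_evpoly_supp cs D : uniq cs -> downset D ->
  evpoly (fun t => count (fun u => D u && supp_in cs u) (mons V t)).
Proof.
elim: cs D => [|c cs IH] D.
  move=> _ dD; exists 0, 1%N => t t0; rewrite horner0; apply/eqP.
  rewrite pnatr_eq0 eqn0Ngt -has_count; apply/hasP => -[u].
  rewrite mem_mons => /eqP hu /andP[_ /supp_inP h]; move: t0.
  by rewrite -hu /edeg big1 // => c _; rewrite h.
move=> /= /andP[ncs ucs] dD.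
pose Dk k u := D (eadd u (emulX k c)).
have dDk k : downset (Dk k).
  move=> u v; rewrite /Dk -eaddA [eadd v _]eaddC eaddA; exact: dD.
have mDk k k' u : (k <= k')%N -> Dk k' u -> Dk k u.
  move=> le h; apply: (dD _ (emulX (k' - k) c)); move: h; rewrite /Dk.
  set x := eadd _ _; set y := eadd _ _; suff -> : x = y by [].
  apply/ffunP => c'; rewrite !ffunE; case: ifP => _; rewrite ?addn0 //.
  by rewrite -addnA subnKC.
have [k0 Hk0] := chain_stable (c :: cs) dDk mDk.
pose f k t := count (fun u => Dk k u && supp_in (c :: cs) u) (mons V t).
pose g k t := count (fun u => Dk k u && supp_in cs u) (mons V t).
have fg k t : f k t.+1 = (g k t.+1 + f k.+1 t)%N.
  rewrite /f /g (count_split _ (fun u : expo V => (0 < u c)%N)) addnC.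
  congr (_ + _)%N.
    apply: eq_count => u /=; rewrite -leqNgt leqn0 -andbA; congr (_ && _).
    apply/andP/idP => [[/supp_inP h /eqP hc]|/supp_inP h].
      apply/supp_inP => c' hc'; case: (eqVneq c' c) => [->|nc] //.
      by apply: h; rewrite inE negb_or nc.
    split; last by rewrite h.
    by apply/supp_inP => c'; rewrite inE negb_or => /andP[_ /h].
  rewrite (count_mons_shift c (fun u => Dk k u && supp_in (c :: cs) u)).
  apply: eq_count => u /=; congr (_ && _).
    rewrite /Dk -eaddA; congr (D (eadd _ _)); apply/ffunP => c'; rewrite !ffunE.
    by case: ifP.
  apply/supp_inP/supp_inP => h c' hc'; have := h c' hc'; rewrite !ffunE.
    by move=> /eqP; rewrite addn_eq0 => /andP[/eqP].
  move=> ->; case: eqP => // e; by rewrite e inE eqxx in hc'.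
have ff : f k0 =1 f k0.+1.
  move=> t; apply: eq_count => u /=.
  case hs : (supp_in (c :: cs) u); rewrite ?andbF // !andbT; apply/idP/idP.
    exact: Hk0.
  exact: mDk.
have gev k : evpoly (g k) by exact: IH.
have fev j k : (k + j = k0)%N -> evpoly (f k).
  elim: j k => [|j IHj] k.
    rewrite addn0 => ->; apply: (evpoly_diff (t0 := 0%N) (gev k0)) => t _.
    by rewrite fg ff.
  rewrite addnS -addSn => /IHj; move/(evpoly_add_shift (gev k)); apply; exact: fg.
have := fev k0 0%N erefl; rewrite /f.
have -> // : (fun t => count (fun u => Dk 0 u && supp_in (c :: cs) u) (mons V t))
  = (fun t => count (fun u => D u && supp_in (c :: cs) u) (mons V t)).
apply: funext => t; apply: eq_count => u; congr (D _ && _).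
by apply/ffunP => c'; rewrite !ffunE; case: ifP; rewrite addn0.
Qed.

Lemma downset_evpoly D : downset D -> evpoly (fun t => count D (mons V t)).
Proof.
move=> dD; have := downset_evpoly_supp (enum_uniq V) dD.
have -> // : (fun t => count (fun u => D u && supp_in (enum V) u) (mons V t))
  = (fun t => count D (mons V t)).
apply: funext => t; apply: eq_count => u.
rewrite (_ : supp_in _ _) ?andbT //.
by apply/supp_inP => c; rewrite mem_enum.
Qed.

End DownSets.

(** * Forms and Hilbert functions *)

Section LinearAlgebra.
Variable K : fieldType.

Lemma ker_list (T : eqType) (M : nat) (L : seq T) (A : 'I_M -> T -> K) :
  (size L < M)%N ->
  exists b : 'I_M -> K, (exists k, b k != 0) /\
    forall q, q \in L -> \sum_k b k * A k q = 0.
Proof.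
move=> sL; pose B := \matrix_(k < M, j < size L) A k (tnth (in_tuple L) j).
have : kermx B != 0.
  rewrite -mxrank_eq0 mxrank_ker -lt0n subn_gt0.
  exact: leq_ltn_trans (rank_leq_col _) sL.
move=> /rowV0Pn[v /sub_kermxP vB v0]; exists (v 0); split.
  by have /rV0Pn[k hk] := v0; exists k.
move=> q /(tnthP (in_tuple L))[j ->].
have := congr1 (fun X : 'rV_(size L) => X 0 j) vB; rewrite !mxE => {2}<-.
by apply: eq_bigr => k _; rewrite !mxE.
Qed.

(** Points are added one at a time: a combination of the functions vanishing at the points already
    chosen is not zero on [Y], and a point where it does not vanish raises the rank of the
    evaluation matrix. At [M] points the matrix is invertible, so its rows are independent too. *)
Lemma indep_points (W : Type) (Y : W -> Prop) (M : nat) (f : 'I_M -> W -> K) :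
  (forall a : 'I_M -> K, (forall x, Y x -> \sum_j a j * f j x = 0) ->
     forall j, a j = 0) ->
  exists x : 'I_M -> W, (forall l, Y (x l)) /\
    forall b : 'I_M -> K, (forall k, \sum_l b l * f k (x l) = 0) ->
      forall l, b l = 0.
Proof.
move=> ind.
have pts r : (r <= M)%N -> exists x : 'I_r -> W, (forall l, Y (x l)) /\
   row_free (\matrix_(l < r, k < M) f k (x l)).
  elim: r => [|r IH] rM.
    have h (i : 'I_0) : False by case: i.
    exists (fun i => False_rect _ (h i)); split; first by case.
    by rewrite /row_free -leqn0 rank_leq_row.
  have [x [Yx fx]] := IH (ltnW rM); set A := \matrix_(_, _) _ in fx.
  have : kermx A^T != 0.
    rewrite -mxrank_eq0 mxrank_ker mxrank_tr (eqP fx) -lt0n subn_gt0 //.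
  move=> /rowV0Pn[v /sub_kermxP vA v0].
  have [z Yz hz] : exists2 z, Y z & \sum_k v 0 k * f k z != 0.
    apply: contrapT => h; case/rV0Pn: v0 => k /eqP; apply.
    apply: (ind (v 0)) => x' Yx'; apply: contrapT => /eqP hx.
    by apply: h; exists x'.
  pose y (i : 'I_r.+1) := if unlift ord0 i is Some j then x j else z.
  exists y; split; first by move=> l; rewrite /y; case: unliftP.
  rewrite -row_leq_rank.
  pose B := \matrix_(l < r.+1, k < M) f k (y l).
  have AB : (A <= B)%MS.
    apply/row_subP => i; rewrite (_ : row i A = row (lift ord0 i) B) ?row_sub //.
    by apply/rowP => k; rewrite !mxE /y liftK.
  have : ~~ (B <= A)%MS.
    apply/negP => BA; have : (row ord0 B <= A)%MS by apply: submx_trans BA; apply: row_sub.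
    case/submxP => D hD; move/eqP: hz; apply.
    have Av : A *m v^T = 0 by apply: trmx_inj; rewrite trmx_mul trmxK trmx0.
    have : (row ord0 B *m v^T) 0 0 = 0 by rewrite hD -mulmxA Av mulmx0 mxE.
    rewrite mxE => {2}<-.
    by apply: eq_bigr => k _; rewrite !mxE /y unlift_none mulrC.
  move=> nBA; have : (A < B)%MS by rewrite ltmxE AB nBA.
  by move=> /rank_ltmx; rewrite (eqP fx).
have [x [Yx fx]] := pts M (leqnn M); exists x; split=> // b hb l.
have : (\row_l b l) *m (\matrix_(l < M, k < M) f k (x l)) = 0.
  apply/rowP => k; rewrite !mxE -[RHS](hb k).
  by apply: eq_bigr => i _; rewrite !mxE.
move=> /eqP; rewrite mulmx_free_eq0 // => /eqP/rowP/(_ l).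
by rewrite !mxE.
Qed.

End LinearAlgebra.

Section Forms.
Variables (K : fieldType) (V : finType).
Implicit Types (u v w : expo V) (x : V -> K) (f g : (V -> K) -> K).

Definition mon u x : K := \prod_c x c ^+ u c.

Lemma pevalE (p : cpoly K V) x : peval p x = \sum_(q <- p) q.1 * mon q.2 x.
Proof. by []. Qed.

Lemma monD u v x : mon (eadd u v) x = mon u x * mon v x.
Proof.
by rewrite /mon -big_split; apply: eq_bigr => c _; rewrite ffunE exprD.
Qed.

Lemma mon0 x : mon (e0 V) x = 1.
Proof. by rewrite /mon big1 // => c _; rewrite ffunE expr0. Qed.

Lemma monX c x : mon (eX c) x = x c.
Proof.
rewrite /mon (bigD1 c) //= big1 ?ffunE ?eqxx ?expr1 ?mulr1 // => c' /negbTE h.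
by rewrite ffunE h expr0.
Qed.

Lemma mon_scale u x a : mon u (fun c => a * x c) = a ^+ edeg u * mon u x.
Proof.
rewrite /mon /edeg -prodrXr -big_split; apply: eq_bigr => c _.
exact: exprMn.
Qed.

(** Forms are treated as functions, so different lists of terms with the same values need not be
    told apart. *)
Definition isform t f := exists p : cpoly K V, homog_of t p /\ forall x, f x = peval p x.

Lemma isform_ext t f g : (forall x, f x = g x) -> isform t f -> isform t g.
Proof. by move=> e [p [hp fp]]; exists p; split => // x; rewrite -e. Qed.

Lemma isform_peval t (p : cpoly K V) : homog_of t p -> isform t (peval p).
Proof. by move=> hp; exists p. Qed.

Lemma isform_mon u : isform (edeg u) (mon u).
Proof.
exists [:: (1, u)]; split => [q|x]; first by rewrite inE => /eqP ->.
by rewrite /peval big_seq1 mul1r.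
Qed.

Lemma isform0 t : isform t (fun=> 0).
Proof. by exists [::]; split => // x; rewrite /peval big_nil. Qed.

Lemma isformD t f g : isform t f -> isform t g -> isform t (fun x => f x + g x).
Proof.
move=> [p [hp fp]] [q [hq gq]]; exists (p ++ q); split => [r|x].
  by rewrite mem_cat => /orP[/hp|/hq].
by rewrite fp gq /peval big_cat.
Qed.

Lemma isformM t s f g : isform t f -> isform s g -> isform (t + s)%N (fun x => f x * g x).
Proof.
move=> [p [hp fp]] [q [hq gq]].
exists [seq (a.1 * b.1, eadd a.2 b.2) | a <- p, b <- q]; split => [r|x].
  by move=> /allpairsP[[a b] /= [/hp ea /hq eb ->]]; rewrite [LHS]edegD /edeg ea eb.
rewrite fp gq !pevalE big_distrl big_allpairs_dep; apply: eq_bigr => a _.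
rewrite big_distrr; apply: eq_bigr => b _ /=.
by rewrite monD mulrACA.
Qed.

Lemma isformC a : isform 0 (fun=> a).
Proof.
exists [:: (a, e0 V)]; split => [q|x]; first by rewrite inE => /eqP ->; exact: edeg0.
by rewrite pevalE big_seq1 mon0 mulr1.
Qed.

Lemma isformZ t a f : isform t f -> isform t (fun x => a * f x).
Proof. exact: isformM (isformC a). Qed.

Lemma isform_sum t (I : Type) (r : seq I) (P : pred I) (F : I -> (V -> K) -> K) :
  (forall i, P i -> isform t (F i)) -> isform t (fun x => \sum_(i <- r | P i) F i x).
Proof.
move=> h; elim: r => [|i r IH].
  by apply: isform_ext (isform0 t) => x; rewrite big_nil.
case Pi : (P i); last by apply: isform_ext IH => x; rewrite big_cons Pi.
by apply: isform_ext (isformD (h i Pi) IH) => x; rewrite big_cons Pi.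
Qed.

Lemma isformX t f n : isform t f -> isform (t * n)%N (fun x => f x ^+ n).
Proof.
move=> hf; elim: n => [|n IH]; first by rewrite muln0; exact: isformC.
by rewrite mulnS; apply: isform_ext (isformM hf IH) => x; rewrite exprS.
Qed.

Lemma isform_prod (I : Type) (r : seq I) (t : I -> nat) (F : I -> (V -> K) -> K) :
  (forall i, isform (t i) (F i)) ->
  isform (\sum_(i <- r) t i)%N (fun x => \prod_(i <- r) F i x).
Proof.
move=> h; elim: r => [|i r IH].
  by rewrite big_nil; apply: isform_ext (isformC 1) => x; rewrite big_nil.
by rewrite big_cons; apply: isform_ext (isformM (h i) IH) => x; rewrite big_cons.
Qed.

Lemma isform_coord c : isform 1 (fun x => x c).
Proof.
by rewrite -(edegX c); apply: isform_ext (isform_mon (eX c)) => x; rewrite monX.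
Qed.

Lemma isform_scale t f a x : isform t f -> f (fun c => a * x c) = a ^+ t * f x.
Proof.
move=> [p [hp fp]]; rewrite !fp !pevalE big_distrr; apply: eq_big_seq => q qp.
by rewrite mon_scale [edeg _]hp //=; ring.
Qed.

Lemma isformE t f : isform t f ->
  exists b : expo V -> K, forall x, f x = \sum_(u <- mons V t) b u * mon u x.
Proof.
move=> [p [hp fp]]; exists (fun u => \sum_(q <- p | q.2 == u) q.1) => x.
rewrite fp /peval; under [RHS]eq_bigr do rewrite big_distrl /=.
rewrite (exchange_big_dep xpredT) //=; apply: eq_big_seq => q qp.
have e : [seq u <- mons V t | q.2 == u] = [:: q.2].
  rewrite (eq_filter (a2 := pred1 q.2)) => [|u]; last by rewrite /= eq_sym.
  by rewrite filter_pred1_uniq ?mons_uniq // mem_mons; apply/eqP/hp.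
by rewrite -[RHS]big_filter e big_seq1.
Qed.

Lemma isform0_const f (x x' : V -> K) : isform 0 f -> f x = f x'.
Proof.
move=> /isformE[B hB]; rewrite !hB; apply: eq_big_seq => u; rewrite mem_mons => /eqP du.
have -> : u = e0 V; last by rewrite !mon0.
by apply/ffunP => c; rewrite ffunE; apply/eqP; rewrite -leqn0 -du leq_edeg.
Qed.

End Forms.

Lemma isform_linear (K : fieldType) (V W : finType) t (f : (V -> K) -> K)
    (l : V -> (W -> K) -> K) : isform t f -> (forall c, isform 1 (l c)) ->
  isform t (fun x => f (fun c => l c x)).
Proof.
move=> [p [hp fp]] hl.
suff : isform t (fun x => \sum_(q <- p | edeg q.2 == t) q.1 * mon q.2 (fun c => l c x)).
  apply: isform_ext => x; rewrite fp /peval big_mkcond; apply: eq_big_seq => q qp.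
  by rewrite [edeg _]hp // eqxx.
apply: isform_sum => q /eqP <-; apply: isformZ.
rewrite /edeg; apply: isform_prod => c.
by have := isformX (q.2 c) (hl c); rewrite mul1n.
Qed.

(** * The lexicographic order on exponents *)

Section Lex.
Variable V : finType.
Implicit Types (u v w : expo V).

Definition lexlt u v := [exists c, (u c < v c)%N &&
  [forall c', (enum_rank c' < enum_rank c)%N ==> (u c' == v c')]].

Lemma lexltP u v : reflect (exists2 c, (u c < v c)%N &
   forall c', (enum_rank c' < enum_rank c)%N -> u c' = v c') (lexlt u v).
Proof.
apply: (iffP existsP) => [[c /andP[h /forallP h2]]|[c h h2]]; exists c => //.
  by move=> c' /(implyP (h2 c'))/eqP.
by rewrite h; apply/forallP => c'; apply/implyP => /h2 ->.
Qed.

Lemma lexltnn u : lexlt u u = false.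
Proof. by apply/lexltP => -[c]; rewrite ltnn. Qed.

Lemma lexlt_trans v u w : lexlt u v -> lexlt v w -> lexlt u w.
Proof.
move=> /lexltP[c h1 h2] /lexltP[c' h1' h2']; apply/lexltP.
case: (ltngtP (enum_rank c) (enum_rank c')) => e.
- exists c; first by rewrite -h2'.
  by move=> d hd; rewrite h2 ?h2' //; apply: ltn_trans e.
- exists c'; first by rewrite h2.
  by move=> d hd; rewrite h2 ?h2' //; apply: ltn_trans e.
have {}e : c = c' by apply: enum_rank_inj; apply: val_inj.
by subst c'; exists c => [|d hd]; [exact: ltn_trans h1'|rewrite h2 ?h2'].
Qed.

Lemma lexlt_total u v : u != v -> lexlt u v || lexlt v u.
Proof.
move=> uv; have [c0 hc0] : exists c, u c != v c.
  apply/existsP; rewrite -negb_forall; apply: contra uv => /forallP h.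
  by apply/eqP/ffunP => c; apply/eqP.
case: (arg_minnP (P := fun c => u c != v c) (fun c => enum_rank c : nat) hc0) => c hc hm.
have hm' c' : (enum_rank c' < enum_rank c)%N -> u c' = v c'.
  by move=> h; apply/eqP; apply: contraTT h => h; rewrite -leqNgt; apply: hm.
case: (ltngtP (u c) (v c)) hc => // h _; apply/orP; [left|right]; apply/lexltP; exists c => //.
by move=> c' /hm'.
Qed.

Lemma lexltD u v w : lexlt u v -> lexlt (eadd u w) (eadd v w).
Proof.
move=> /lexltP[c h1 h2]; apply/lexltP; exists c; rewrite ?ffunE ?ltn_add2r //.
by move=> c' /h2 e; rewrite !ffunE e.
Qed.

End Lex.

Lemma seq_maximum (T : eqType) (r : rel T) (s : seq T) :
  transitive r -> (forall x y, x != y -> r x y || r y x) -> s != [::] ->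
  exists2 x, x \in s & forall y, y \in s -> y = x \/ r y x.
Proof.
move=> tr tot; elim: s => // x s IH _; have [->|s0] := eqVneq s [::].
  by exists x; rewrite ?inE // => y; rewrite inE => /eqP ->; left.
have [m ms hm] := IH s0; have [e|xm] := eqVneq x m.
  exists m; first by rewrite inE ms orbT.
  by move=> y; rewrite inE => /orP[/eqP ->|/hm //]; left.
case/orP: (tot _ _ xm) => h; [exists m|exists x]; rewrite ?inE ?ms ?eqxx ?orbT // => y.
  by rewrite inE => /orP[/eqP ->|/hm //]; right.
rewrite inE => /orP[/eqP ->|/hm[->|h2]]; [by left|by right|right].
exact: tr h.
Qed.

Lemma tuple_coef (K : fieldType) (T : eqType) (L : seq T) (al : 'I_(size L) -> K) :
  uniq L -> exists B : T -> K, forall F : T -> K,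
    \sum_j al j * F (tnth (in_tuple L) j) = \sum_(q <- L) B q * F q /\
    forall j, B (tnth (in_tuple L) j) = al j.
Proof.
move=> uL; pose B q := if insub (index q L) is Some i then al i else 0.
have BE j : B (tnth (in_tuple L) j) = al j.
  rewrite /B (tnth_nth (tnth (in_tuple L) j)) index_uniq //.
  by case: insubP => [k _ /val_inj -> //|]; rewrite ltn_ord.
exists B => F; split => //; rewrite [RHS](big_tnth _ _ L).
by apply: eq_bigr => j _; rewrite BE.
Qed.

Section Hilbert.
Variables (K : fieldType) (V : finType).
Implicit Types (Y : pset K V) (u v : expo V).

(** Such a [u] is the leading exponent of a form vanishing on [Y]; the remaining exponents,
    [stdmon], give a monomial basis of the homogeneous coordinate ring. *)
Definition reducible_on Y u := exists p : cpoly K V,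
  (forall q, q \in p -> lexlt q.2 u /\ edeg q.2 = edeg u) /\
  forall x, Y x -> mon u x = peval p x.
Definition stdmon Y u : bool := ~~ `[< reducible_on Y u >].
(** Counting the members of a lower set makes [downset_evpoly] applicable; [hilb_hf] identifies this
    number with the Hilbert function. *)
Definition hf Y t : nat := count (stdmon Y) (mons V t).

Lemma stdmonPn Y u : reflect (reducible_on Y u) (~~ stdmon Y u).
Proof. by rewrite negbK; apply: asboolP. Qed.

Lemma stdmon_downset Y : downset (stdmon Y).
Proof.
move=> u v; apply: contraTT => /stdmonPn[p [hp e]]; apply/stdmonPn.
exists [seq (q.1, eadd q.2 v) | q <- p]; split.
  move=> _ /mapP[q /hp[h1 h2] ->] /=; split; first exact: lexltD.
  by rewrite !edegD h2.
move=> x Yx; rewrite monD e // !pevalE big_distrl big_map.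
by apply: eq_bigr => q _; rewrite monD mulrA.
Qed.

Lemma hf_evpoly Y : evpoly (hf Y).
Proof. exact: downset_evpoly (@stdmon_downset Y). Qed.

Definition indep_fun (W : Type) (Y : W -> Prop) m (f : 'I_m -> W -> K) :=
  forall a : 'I_m -> K, (forall x, Y x -> \sum_(j < m) a j * f j x = 0) ->
    forall j, a j = 0.

(** In a nontrivial relation the largest exponent with a nonzero coefficient could be solved for,
    hence would be reducible. *)
Lemma stdmon_indep Y (L : seq (expo V)) (b : expo V -> K) t :
  uniq L -> (forall u, u \in L -> stdmon Y u /\ edeg u = t) ->
  (forall x, Y x -> \sum_(u <- L) b u * mon u x = 0) ->
  forall u, u \in L -> b u = 0.
Proof.
move=> uL hL e u uinL; apply/eqP; apply: contraT => bu.
pose L' := [seq u <- L | b u != 0].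
have L'0 : L' != [::].
  by apply/eqP => h; have : u \in L' by [rewrite mem_filter bu]; rewrite h.
have [m mL' hm] := seq_maximum (@lexlt_trans V) (@lexlt_total V) L'0.
move: (mL'); rewrite mem_filter => /andP[bm mL].
have [sm dm] := hL _ mL; case/stdmonPn: sm.
exists [seq (- b v / b m, v) | v <- rem m L']; split.
  move=> _ /mapP[v vr ->] /=.
  have vL' : v \in L' by apply: mem_rem vr.
  have vL : v \in L by move: vL'; rewrite mem_filter => /andP[].
  split; last by rewrite dm; case: (hL _ vL).
  case: (hm _ vL') => // vm; move: vr.
  by rewrite mem_rem_uniq ?filter_uniq // inE vm eqxx.
move=> x Yx; have := e x Yx; rewrite pevalE big_map /=.
have -> : \sum_(u <- L) b u * mon u x = \sum_(u <- L') b u * mon u x.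
  rewrite big_filter [RHS]big_mkcond; apply: eq_bigr => v _.
  by case: eqP => // ->; rewrite mul0r.
rewrite (perm_big _ (perm_to_rem mL')) big_cons /= => /eqP.
rewrite addr_eq0 => /eqP h; apply: (mulfI bm); rewrite h big_distrr -sumrN.
by apply: eq_bigr => v _; rewrite /=; field.
Qed.

Lemma stdmon_span Y t f : isform t f ->
  exists b : expo V -> K, forall x, Y x ->
   f x = \sum_(u <- mons V t | stdmon Y u) b u * mon u x.
Proof.
pose good g := exists b : expo V -> K, forall x, Y x ->
   g x = \sum_(u <- mons V t | stdmon Y u) b u * mon u x.
have good_lin (p : cpoly K V) : (forall q, q \in p -> good (mon q.2)) -> good (peval p).
  elim: p => [|q p IH] h.
    by exists (fun=> 0) => x _; rewrite /peval big_nil big1 // => u _; rewrite mul0r.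
  have [b hb] := h q (mem_head _ _); have [|b' hb'] := IH.
    by move=> r rp; apply: h; rewrite inE rp orbT.
  exists (fun u => q.1 * b u + b' u) => x Yx; rewrite pevalE big_cons -pevalE hb' //.
  rewrite hb // big_distrr -big_split; apply: eq_bigr => u _ /=; ring.
have all_good u : edeg u = t -> good (mon u).
  move=> du; apply: contrapT => bad.
  pose L := [seq u <- mons V t | ~~ `[< good (mon u) >]].
  have L0 : L != [::].
    apply/eqP => h; have : u \in L; last by rewrite h.
    by rewrite mem_filter mem_mons du eqxx andbT; apply/negP => /asboolP.
  (* The order is reversed, so that [m] is the smallest monomial that is not a combination of
     standard ones. *)
  have [||m mL hm] := @seq_maximum _ (fun u v => lexlt v u) L _ _ L0.
  - by move=> x y z h1 h2; apply: lexlt_trans h1.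
  - by move=> x y; rewrite eq_sym; apply: lexlt_total.
  move: mL; rewrite mem_filter => /andP[/asboolP bm]; rewrite mem_mons => /eqP dm.
  apply: bm; case sm : (stdmon Y m).
    exists (fun u => (u == m)%:R) => x Yx; rewrite -[RHS]big_filter.
    have mF : m \in [seq u <- mons V t | stdmon Y u].
      by rewrite mem_filter sm mem_mons dm eqxx.
    rewrite (bigD1_seq m mF (filter_uniq _ (mons_uniq V t))) /=.
    by rewrite eqxx mul1r big1 ?addr0 // => v /negbTE ->; rewrite mul0r.
  have /stdmonPn[p [hp ep]] := negbT sm.
  have [q qp|b hb] := good_lin p.
    apply: contrapT => bq; have [h1 h2] := hp q qp.
    have : q.2 \in L.
      by rewrite mem_filter mem_mons h2 dm eqxx andbT; apply/negP => /asboolP.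
    case/hm => [h3|/lexlt_trans/(_ h1)]; first by move: h1; rewrite h3 lexltnn.
    by rewrite lexltnn.
  by exists b => x Yx; rewrite ep // hb.
move=> [p [hp fp]]; have [q qp|b hb] := good_lin p; first exact/all_good/hp.
by exists b => x Yx; rewrite fp hb.
Qed.

Lemma hf_ge Y t m (f : 'I_m -> (V -> K) -> K) :
  (forall j, isform t (f j)) -> indep_fun Y f -> (m <= hf Y t)%N.
Proof.
move=> hf' ind; rewrite leqNgt; apply/negP => lt.
have /choice[b hb] : forall j, exists b : expo V -> K, forall x, Y x ->
   f j x = \sum_(u <- mons V t | stdmon Y u) b u * mon u x.
  by move=> j; apply: stdmon_span.
pose L := [seq u <- mons V t | stdmon Y u].
have [|a [[k ak] ha]] := @ker_list _ _ m L b; first by rewrite size_filter.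
move/eqP: ak; apply; apply: ind => x Yx.
under eq_bigr do rewrite hb // big_distrr -big_filter.
rewrite exchange_big big_seq big1 //= => u uL.
under eq_bigr do rewrite mulrA.
by rewrite -big_distrl /= ha ?mul0r.
Qed.

Lemma hf_basis Y t : exists f : 'I_(hf Y t) -> (V -> K) -> K,
  (forall j, isform t (f j)) /\ indep_fun Y f.
Proof.
pose L := [seq u <- mons V t | stdmon Y u].
have sL : size L = hf Y t by rewrite size_filter.
have uL : uniq L by rewrite filter_uniq ?mons_uniq.
have hL u : u \in L -> stdmon Y u /\ edeg u = t.
  by rewrite mem_filter mem_mons => /andP[? /eqP].
rewrite -sL; exists (fun j => mon (tnth (in_tuple L) j)); split.
  by move=> j; have [_ <-] := hL _ (mem_tnth j (in_tuple L)); apply: isform_mon.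
move=> a ha j.
have [B HB] := tuple_coef a uL; have [_ <-] := HB (fun=> 0).
apply: (stdmon_indep (Y := Y) (b := B) uL hL _ (mem_tnth j (in_tuple L))) => x Yx.
by have [<- _] := HB (fun u => mon u x); apply: ha.
Qed.

Lemma hilb_hf Y t : hilb Y t (hf Y t).
Proof.
split; last first.
  by move=> m p hp ind; apply: (hf_ge (f := fun j => peval (p j))) => // j; apply: isform_peval.
have [f [hf1 ind]] := hf_basis Y t.
have /choice[p hp] := hf1; exists p; split=> [j|a ha]; first by case: (hp j).
apply: ind => x Yx; rewrite -[RHS](ha x Yx); apply: eq_bigr => j _.
by case: (hp j) => _ ->.
Qed.

End Hilbert.

(** * Standard exponents *)

(* A coordinate c with row c = Some j occurs in the j-th equation, multiplied
   by the product over the players i of y (i, ix c i); cell j k is the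
   coordinate of row j with multi-index k, and kap i is the number of
   coordinates y (i, _) that are allowed to be nonzero.  Exponents nu refer to
   the variables y, exponents u to the variables x.  *)
Section StandardExponents.
Variables (C : finType) (p b : nat) (row : C -> option nat).
Variables (ix : C -> {ffun 'I_p -> 'I_b.+1}) (cell : nat -> {ffun 'I_p -> 'I_b.+1} -> C).
Variables (dm : 'I_p -> nat) (rows : pred nat).
Notation Q := ('I_p * 'I_b.+1)%type.
Implicit Types (kap a : 'I_p -> nat) (u : expo C) (nu : expo Q) (js : seq nat).

Hypothesis dm_b : forall i, (dm i <= b.+1)%N.
Hypothesis cellP : forall j (k : {ffun 'I_p -> 'I_b.+1}), rows j -> (forall i, (k i < dm i)%N) ->
  row (cell j k) = Some j /\ ix (cell j k) = k.

Definition valid kap := forall i, (0 < kap i <= dm i)%N.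
Definition dec kap (i : 'I_p) := fun i' => (kap i' - (i' == i))%N.
Definition topk kap : {ffun 'I_p -> 'I_b.+1} := [ffun i => inord (kap i).-1].
Definition tp j kap := cell j (topk kap).
Definition tq kap i : Q := (i, topk kap i).
(** When player [k] is the first one whose last available coordinate is missing, this is the product
    of those of the players before it, all of which are present and can be divided out. *)
Definition dlt kap (k : nat) : expo Q :=
  [ffun q : Q => ((q.1 < k)%N && (q.2 == topk kap q.1)) : nat].
Definition sg c : expo Q := [ffun q : Q => (q.2 == ix c q.1) : nat].
Definition qdeg nu i := (\sum_k nu (i, k))%N.
Definition qdegs a nu := [forall i, qdeg nu i == a i].
Definition suppk kap nu := [forall q : Q, (kap q.1 <= q.2)%N ==> (nu q == 0%N)].
Definition isfirst kap nu (i : 'I_p) :=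
  (nu (tq kap i) == 0%N) && [forall i' : 'I_p, (i' < i)%N ==> (0 < nu (tq kap i'))%N].

(* The equation of row j allows one to eliminate any monomial divisible by the
   coordinate tp j kap of x and by the last available coordinates tq kap i of
   all the players; a monomial divisible by tp j kap but by no such product is
   handled in the locus where the first missing tq kap i vanishes.  *)
Fixpoint Std js kap u nu : bool :=
  if js is j :: js' then
    if u (tp j kap) == 0%N then Std js' kap u nu
    else [exists i, [&& isfirst kap nu i, (1 < kap i)%N &
            Std js' (dec kap i) u (esub nu (dlt kap i))]]
  else suppk kap nu.

Lemma topkE kap i : valid kap -> topk kap i = (kap i).-1 :> nat.
Proof.
move=> /(_ i) /andP[h1 h2]; rewrite ffunE inordK //.
by apply: leq_trans (dm_b i); rewrite prednK.
Qed.

Lemma tpP j kap : rows j -> valid kap -> row (tp j kap) = Some j /\ ix (tp j kap) = topk kap.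
Proof.
move=> rj vk; apply: cellP => // i; rewrite topkE //.
by have /andP[h1 h2] := vk i; rewrite prednK.
Qed.

Lemma valid_dec kap i : valid kap -> (1 < kap i)%N -> valid (dec kap i).
Proof.
move=> vk h i'; have /andP[h1 h2] := vk i'; rewrite /dec.
by case: eqP => [->|_]; [have := vk i|]; lia.
Qed.

Lemma suppkP kap nu : reflect (forall q : Q, (kap q.1 <= q.2)%N -> nu q = 0%N) (suppk kap nu).
Proof.
apply: (iffP forallP) => h q; first by move=> hq; apply/eqP/(implyP (h q)).
by apply/implyP => hq; apply/eqP/h.
Qed.

Lemma isfirstP kap nu i : reflect (nu (tq kap i) = 0%N /\
   forall i' : 'I_p, (i' < i)%N -> (0 < nu (tq kap i'))%N) (isfirst kap nu i).
Proof.
apply: (iffP andP) => [[/eqP h /forallP h2]|[h h2]]; split; rewrite ?h //.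
  by move=> i'; apply/implyP.
by apply/forallP => i'; apply/implyP/h2.
Qed.

Lemma isfirst_uniq kap nu i i' : isfirst kap nu i -> isfirst kap nu i' -> i = i'.
Proof.
move=> /isfirstP[h1 h2] /isfirstP[h1' h2']; apply: val_inj => /=.
case: (ltngtP i i') => // h; first by have := h2' _ h; rewrite h1.
by have := h2 _ h; rewrite h1'.
Qed.

Lemma dlt_tq kap k i : dlt kap k (tq kap i) = (i < k)%N.
Proof. by rewrite ffunE /= eqxx andbT. Qed.

Lemma qdegD nu nu' i : qdeg (eadd nu nu') i = (qdeg nu i + qdeg nu' i)%N.
Proof. by rewrite /qdeg -big_split; apply: eq_bigr => k _; rewrite ffunE. Qed.

Lemma qdeg_dlt kap k i : qdeg (dlt kap k) i = (i < k)%N.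
Proof.
rewrite /qdeg (bigD1 (topk kap i)) //= ffunE /= eqxx andbT big1 ?addn0 //.
by move=> k' /negbTE h; rewrite ffunE /= h andbF.
Qed.

Lemma qdeg_sg c i : qdeg (sg c) i = 1%N.
Proof.
rewrite /qdeg (bigD1 (ix c i)) //= ffunE /= eqxx big1 ?addn0 //.
by move=> k' /negbTE h; rewrite ffunE /= h.
Qed.

Lemma Std_supp js kap u nu : valid kap -> Std js kap u nu -> suppk kap nu.
Proof.
elim: js kap nu => [|j js IH] kap nu vk //=; case: ifP => _; first exact: IH.
case/existsP => i /and3P[_ ki hs]; have /suppkP h := IH _ _ (valid_dec vk ki) hs.
apply/suppkP => q hq; have := h q; rewrite {1}/dec => /(_ (leq_trans (leq_subr _ _) hq)).
rewrite !ffunE; have /negbTE -> : q.2 != inord (kap q.1).-1.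
  apply/eqP => /(congr1 val) /=; have := topkE q.1 vk; rewrite ffunE => -> e.
  by have := vk q.1; lia.
by rewrite andbF subn0.
Qed.

Lemma Std_indiff js kap u u' nu : all rows js -> valid kap ->
  (forall c j, j \in js -> row c = Some j -> u c = u' c) ->
  Std js kap u nu = Std js kap u' nu.
Proof.
elim: js kap nu => [|j js IH] kap nu //= /andP[rj rjs] vk h.
have h' c j' : j' \in js -> row c = Some j' -> u c = u' c.
  by move=> j'js; apply: h; rewrite inE j'js orbT.
have [rt _] := tpP rj vk; rewrite (h _ j) ?mem_head // IH //; case: ifP => // _.
apply: eq_existsb => i; case: isfirst => //=; case: ltnP => //= ki.
by rewrite IH //; apply: valid_dec.
Qed.

(* Dual form of the statement that standard monomials span: phi is a functional
   on monomials of degree a in y that kills the ideal of the equations.  *)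
Lemma Std_upper (K : zmodType) js kap a (phi : expo C -> expo Q -> K) :
  valid kap -> uniq js -> all rows js -> (forall i, (size js < a i)%N) ->
  (forall u nu j, j \in js ->
     \sum_(c | row c == Some j) phi (eadd u (eX c)) (eadd nu (sg c)) = 0) ->
  (forall u nu (q : Q), (kap q.1 <= q.2)%N -> (0 < nu q)%N -> phi u nu = 0) ->
  (forall u nu, ~~ qdegs a nu -> phi u nu = 0) ->
  (forall u nu, Std js kap u nu -> phi u nu = 0) ->
  forall u nu, phi u nu = 0.
Proof.
elim: js kap a phi => [|j js IH] kap a phi vk ujs rjs ha h1 h2 h3 h4.
  move=> u nu; case hs : (suppk kap nu); first exact: h4.
  have /forallPn[q] := negbT hs; rewrite negb_imply => /andP[hq]; rewrite -lt0n.
  exact: h2.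
move: ujs rjs => /= /andP[njs ujs] /andP[rj rjs].
have ha' i : (size js < a i)%N by apply: leq_trans (ha i) => /=.
have [rt it] := tpP rj vk.
pose top := tp j kap.
have h1' u nu j' : j' \in js ->
    \sum_(c | row c == Some j') phi (eadd u (eX c)) (eadd nu (sg c)) = 0.
  by move=> j'js; apply: h1; rewrite inE j'js orbT.
have etop u c j' : j' \in js -> row c == Some j' -> (eadd u (eX c)) top = u top.
  move=> j'js /eqP rc; rewrite !ffunE.
  case: eqP => [tc|]; rewrite ?addn0 //; move: rc; rewrite -tc /top rt => -[jj'].
  by rewrite jj' j'js in njs.
(* Restricting [phi] to exponents free of [top] keeps the relations of the other rows, since [top]
   occurs in none of them. *)
have S0 u nu : u top = 0%N -> phi u nu = 0.
  move=> ut; suff : (if u top == 0%N then phi u nu else 0) = 0 by rewrite ut.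
  apply: (IH kap a (fun u nu => if u top == 0%N then phi u nu else 0)) => //.
  - move=> {ut nu}u nu j' j'js; rewrite -[RHS](if_same (u top == 0%N) 0).
    rewrite (eq_bigr (fun c => if u top == 0%N then phi (eadd u (eX c)) (eadd nu (sg c)) else 0)).
      by case: ifP => _; [exact: h1'|rewrite big1].
    by move=> c rc; rewrite (etop _ _ j').
  - by move=> {ut nu}u nu q hq nq; case: ifP => // _; apply: h2 hq nq.
  - by move=> {ut nu}u nu hn; case: ifP => // _; apply: h3.
  - move=> {ut nu}u nu hs; case: ifP => // ut; apply: h4 => /=.
    by rewrite -/top ut.
move=> u nu; move: {2}(u top) (erefl (u top)) => e.
elim: e u nu => [|e IHe] u nu; first exact: S0.
(* Within the induction on the exponent of [top], a second one runs on the number [m] of players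
   beyond the first [k], whose last available coordinates divide the monomial. At [k = p] the [top]
   term of equation [j] divides it and is traded for terms with a lower exponent of [top]. *)
suff P m k u' nu' : (k + m = p)%N -> u' top = e.+1 ->
    (forall i' : 'I_p, (i' < k)%N -> (0 < nu' (tq kap i'))%N) -> phi u' nu' = 0.
  by move=> ut; apply: (P p 0%N) => //.
elim: m k u' nu' => [|m IHm] k {}u {}nu.
  rewrite addn0 => -> ut hnu; pose u1 := esub u (eX top).
  pose nu1 := esub nu (sg top).
  have := h1 u1 nu1 j (mem_head _ _); rewrite (bigD1 top) ?rt //=.
  rewrite /u1 /nu1 esubXK ?ut // esubK; last first.
    move=> q; rewrite ffunE it; case: eqP => // hq.
    by have := hnu q.1 (ltn_ord _); rewrite /tq -hq; case: (q).
  rewrite big1 ?addr0 // => c /andP[_ ct]; apply: IHe.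
  by rewrite !ffunE eqxx eq_sym (negbTE ct) ut subn1 addn0.
rewrite addnS -addSn => km ut hnu.
have kp : (k < p)%N by rewrite -km leq_addr.
pose i := Ordinal kp.
have IHm' u' nu' : u' top = e.+1 ->
    (forall i' : 'I_p, (i' < k.+1)%N -> (0 < nu' (tq kap i'))%N) -> phi u' nu' = 0.
  exact: IHm.
case: (posnP (nu (tq kap i))) => [nui|nui]; last first.
  apply: IHm' => // i'; rewrite ltnS leq_eqVlt => /orP[/eqP e'|]; last exact: hnu.
  by rewrite (_ : i' = i) //; apply: val_inj.
(* Player [i] may use only the coordinate of index 0, which is absent here; as [a i] is positive, a
   forbidden coordinate must occur. *)
case: (leqP (kap i) 1) => ki.
  case hd : (qdegs a nu); last by apply: h3; rewrite hd.
  have /eqP di := forallP hd i.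
  have [l hl] : exists l, (0 < nu (i, l))%N.
    apply/existsP; have := ha i; rewrite -di; apply: contraTT.
    rewrite negb_exists => /forallP h; rewrite -leqNgt /qdeg big1 ?leq0n // => l _.
    by apply/eqP; rewrite eqn0Ngt h.
  apply: (h2 _ _ _ _ hl) => /=; apply: (leq_trans ki); rewrite lt0n; apply/eqP => l0.
  suff e' : (i, l) = tq kap i by rewrite e' nui in hl.
  congr (_, _); apply: val_inj; rewrite [RHS]topkE //= l0.
  by have := vk i; lia.
(* This functional lives on the locus where [tq kap i] vanishes as well: it kills multiples of that
   coordinate because they are covered by the case [k.+1]. Its [y]-degree has dropped by at most one
   per player, just as [js] has lost one row. *)
pose psi u1 nu1 := if u1 top == e then phi (eadd u1 (eX top)) (eadd nu1 (dlt kap k)) else 0.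
have vk' : valid (dec kap i) by apply: valid_dec.
suff psi0 u1 nu1 : psi u1 nu1 = 0.
  have := psi0 (esub u (eX top)) (esub nu (dlt kap k)); rewrite /psi.
  rewrite esubXK ?ut // esubK.
    by rewrite !ffunE eqxx ut subn1 eqxx.
  move=> q; rewrite ffunE; case: andP => // -[q1 /eqP q2].
  by have := hnu q.1 q1; rewrite /tq -q2; case: (q).
apply: (IH (dec kap i) (fun i' => a i' - (i' < k))%N psi) => //.
- by move=> i'; have := ha i'; rewrite /=; case: (i' < k)%N => /=; lia.
- move=> {}u1 {}nu1 j' j'js; rewrite -[RHS](if_same (u1 top == e) 0).
  rewrite (eq_bigr (fun c => if u1 top == e then
      phi (eadd (eadd u1 (eX top)) (eX c)) (eadd (eadd nu1 (dlt kap k)) (sg c)) else 0)).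
    by case: ifP => _; [exact: h1'|rewrite big1].
  move=> c rc; rewrite /psi (etop _ _ j') //; case: ifP => // _.
  by congr phi; apply: eaddAC.
- move=> {}u1 {}nu1 q hq nq; rewrite /psi; case: ifP => // /eqP ute.
  case: (leqP (kap q.1) q.2) => hq2.
    by apply: h2 hq2 _; rewrite ffunE addn_gt0 nq.
  have [q1 q2] : q.1 = i /\ q.2 = (kap i).-1 :> nat.
    move: hq hq2; rewrite /dec; case: eqP => [->|_]; last by lia.
    by split => //; lia.
  have qi : q = tq kap i.
    by case: q q1 q2 {hq nq hq2} => x y /= -> h; congr (_, _); apply: val_inj; rewrite /= topkE.
  apply: IHm'; first by rewrite !ffunE eqxx ute addn1.
  move=> i'; rewrite ltnS leq_eqVlt => /orP[/eqP e'|]; rewrite ffunE addn_gt0.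
    by rewrite (_ : i' = i) -?qi ?nq //; apply: val_inj.
  by move=> h; rewrite dlt_tq h orbT.
- move=> {}u1 {}nu1 hn; rewrite /psi; case: ifP => // _; apply: h3.
  apply: contra hn => /forallP h; apply/forallP => i'; apply/eqP.
  by have /eqP := h i'; rewrite qdegD qdeg_dlt => <-; rewrite addnK.
- move=> {}u1 {}nu1 hs; rewrite /psi; case: ifP => // /eqP ute; apply: h4 => /=.
  rewrite -/top !ffunE eqxx addn1 /=; apply/existsP; exists i.
  rewrite eaddK ki /=; apply/andP; split.
    apply/isfirstP; split.
      rewrite ffunE dlt_tq ltnn addn0; move/suppkP: (Std_supp vk' hs); apply.
      by rewrite /= topkE // /dec eqxx subn1.
    by move=> i' hi'; rewrite ffunE dlt_tq hi' addn1.
  rewrite (@Std_indiff _ _ _ u1) // => c j' j'js rc.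
  by rewrite !ffunE; case: eqP => [tc|]; rewrite ?addn0 //;
     move: rc; rewrite tc /top rt => -[jj']; rewrite jj' j'js in njs.
Qed.

End StandardExponents.

(** * The incidence variety *)

Section NonVanishing.
Variable K : fieldType.
Hypothesis K0 : forall n, (n.+1%:R : K) != 0.

Lemma natr_injK m n : (m%:R : K) = n%:R -> m = n.
Proof.
wlog le : m n / (m <= n)%N.
  by move=> h e; case: (leqP m n) => [|/ltnW] l; [|symmetry]; apply: h l _.
move=> /eqP; rewrite eq_sym -subr_eq0 -natrB // => e.
have := K0 (n - m).-1; case: (ltnP m n) => lt; last by move=> _; lia.
by rewrite prednK ?subn_gt0 // e.
Qed.

(** Natural numbers remain distinct in [K], and [P] has fewer roots than its size. *)
Lemma poly_nonroot (P : {poly K}) : P != 0 -> exists n : nat, P.[n%:R] != 0.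
Proof.
move=> P0; apply: contrapT => h.
pose rs : seq K := [seq n%:R | n <- iota 0 (size P)].
have := @max_poly_roots _ P rs P0; rewrite size_map size_iota ltnn => H; suff: false by []; apply: H.
  apply/allP => _ /mapP[n _ ->]; apply/rootP/eqP; apply: contraT => hn.
  by case: h; exists n.
by rewrite map_inj_uniq ?iota_uniq // => m n; apply: natr_injK.
Qed.

End NonVanishing.

Section Kronecker.
Variable V : finType.

(** Two distinct exponents differ by a nonzero polynomial in the base [B]; any [B] that is not a
    root of the product of all these differences works. *)
Lemma distinct_weights (L : seq (expo V)) : exists B : nat,
  {in L &, injective (fun u : expo V => \sum_v u v * B ^ enum_rank v)%N}.
Proof.
pose D (q : expo V * expo V) : {poly rat} :=
  \sum_v ((q.1 v)%:R - (q.2 v)%:R)%:P * 'X^(enum_rank v).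
have D0 q : q.1 != q.2 -> D q != 0.
  apply: contra => /eqP e; apply/eqP/ffunP => v; apply/eqP.
  have := congr1 (fun P : {poly rat} => P`_(enum_rank v)) e.
  rewrite coef_sum coef0 (bigD1 v) //= coefCM coefXn eqxx mulr1 big1 ?addr0.
    by move/eqP; rewrite subr_eq0 eqr_nat.
  move=> v' vv'; rewrite coefCM coefXn; case: eqP => [h|]; rewrite ?mulr0 //.
  by case/eqP: vv'; apply: enum_rank_inj; apply: val_inj.
pose P := \prod_(q <- [seq (u, v) | u <- L, v <- L] | q.1 != q.2) D q.
have [||B hB] := @poly_nonroot rat _ P.
- by move=> n; rewrite pnatr_eq0.
- by rewrite /P prodf_seq_neq0; apply/allP => q _; apply/implyP/D0.
exists B => u v uL vL e; apply/eqP; apply: contraTT hB => uv; rewrite negbK.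
rewrite /P horner_prod prodf_seq_eq0; apply/hasP; exists (u, v).
  by apply/allpairsP; exists (u, v).
rewrite /= uv /= /D horner_sum; apply/eqP.
under eq_bigr do rewrite hornerM hornerC hornerXn mulrBl.
rewrite sumrB; apply/eqP; rewrite subr_eq0; apply/eqP.
have := congr1 (fun n => n%:R : rat) e; rewrite !natr_sum.
by under eq_bigr do rewrite natrM natrX;
  move=> ->; apply: eq_bigr => i _; rewrite natrM natrX.
Qed.

(** Kronecker substitution: setting the variable [v] to [n ^+ (B ^ enum_rank v)] turns distinct
    monomials of [L] into distinct powers of [n], so nothing cancels. *)
Lemma mon_sum_neq0 (K : fieldType) (L : seq (expo V)) (b : expo V -> K) :
  (forall n, (n.+1%:R : K) != 0) -> uniq L -> L != [::] ->
  (forall u, u \in L -> b u != 0) ->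
  exists x : V -> K, (forall v, x v != 0) /\ \sum_(u <- L) b u * mon u x != 0.
Proof.
move=> K0 uL L0 hb; have [B hB] := distinct_weights L.
pose code (u : expo V) := (\sum_v u v * B ^ enum_rank v)%N.
pose P : {poly K} := \sum_(u <- L) (b u)%:P * 'X^(code u).
have [u0 u0L] : exists u, u \in L.
  by case: (L) L0 => // u s _; exists u; rewrite mem_head.
have P0 : P != 0.
  apply: contra (hb _ u0L) => /eqP e; have := congr1 (fun p : {poly K} => p`_(code u0)) e.
  rewrite coef_sum coef0 (bigD1_seq u0) //= coefCM coefXn eqxx mulr1 big_seq_cond.
  rewrite big1 ?addr0 => [->//|u /andP[uinL uu0]].
  rewrite coefCM coefXn; case: eqP => [h|]; rewrite ?mulr0 //.
  by case/eqP: uu0; apply: hB.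
(* The factor ['X] makes [n], and so every coordinate of the point, nonzero. *)
have [|n] := @poly_nonroot K K0 ('X * P); first by rewrite mulf_neq0 ?polyX_eq0.
rewrite hornerM hornerX mulf_eq0 negb_or => /andP[n0 hn].
exists (fun v => n%:R ^+ (B ^ enum_rank v)); split.
  by move=> v; apply: expf_neq0.
apply: contra hn; rewrite /P horner_sum => /eqP e; apply/eqP; rewrite -[RHS]e.
apply: eq_bigr => u _; rewrite hornerM hornerC hornerXn; congr (_ * _).
rewrite /code /mon -prodrXr; apply: eq_bigr => v _.
by rewrite -exprM mulnC.
Qed.

End Kronecker.

Lemma bigmax_attained (T : eqType) (F : T -> nat) (L : seq T) : L != [::] ->
  exists2 q, q \in L & F q = (\max_(q <- L) F q)%N.
Proof.
elim: L => // q L IH _; have [->|/IH[r rL er]] := eqVneq L [::].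
  by exists q; rewrite ?mem_head // big_seq1.
rewrite big_cons -er; case: (leqP (F r) (F q)) => h.
  by exists q; rewrite ?mem_head //; apply/esym/maxn_idPl.
by exists r; rewrite ?inE ?rL ?orbT //; apply/esym/maxn_idPr/ltnW.
Qed.

(** * Curves on the incidence variety and independence of standard monomials *)

Section Incidence.
Variable K : fieldType.
Hypothesis K0 : forall n, (n.+1%:R : K) != 0.
Variables (C : finType) (p b : nat) (row : C -> option nat).
Variables (ix : C -> {ffun 'I_p -> 'I_b.+1}) (cell : nat -> {ffun 'I_p -> 'I_b.+1} -> C).
Variables (dm : 'I_p -> nat) (rows : pred nat).
Notation Q := ('I_p * 'I_b.+1)%type.
Implicit Types (kap a : 'I_p -> nat) (u : expo C) (nu : expo Q) (js : seq nat).
Implicit Types (x : C -> K) (y : Q -> K) (F G : (C -> K) -> (Q -> K) -> K).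

Hypothesis dm_b : forall i, (dm i <= b.+1)%N.
Hypothesis cellP : forall j (k : {ffun 'I_p -> 'I_b.+1}), rows j ->
  (forall i, (k i < dm i)%N) -> row (cell j k) = Some j /\ ix (cell j k) = k.

Local Notation sg := (sg ix).
Local Notation valid := (valid dm).
Local Notation tp := (tp cell).
Local Notation Std := (Std cell).

Definition roweqn j x y : K := \sum_(c | row c == Some j) x c * mon (sg c) y.
Definition Inc js kap x y := [/\ forall i, exists k, y (i, k) != 0,
  forall q : Q, (kap q.1 <= q.2)%N -> y q = 0 & forall j, j \in js -> roweqn j x y = 0].

(** Only restrictions to polynomial curves enter the irreducibility argument, so polynomiality in
    both sets of variables is recorded in this form. *)
Definition polyfun F := forall (g : C -> {poly K}) (h : Q -> {poly K}),
  exists P : {poly K}, forall t, F (fun c => (g c).[t]) (fun q => (h q).[t]) = P.[t].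

Lemma polyfun_const k : polyfun (fun _ _ => k).
Proof. by move=> g h; exists k%:P => t; rewrite hornerC. Qed.
Lemma polyfun_x c : polyfun (fun x _ => x c).
Proof. by move=> g h; exists (g c). Qed.
Lemma polyfun_y q : polyfun (fun _ y => y q).
Proof. by move=> g h; exists (h q). Qed.
Lemma polyfunD F G : polyfun F -> polyfun G -> polyfun (fun x y => F x y + G x y).
Proof.
move=> hF hG g h; have [P hP] := hF g h; have [P' hP'] := hG g h.
by exists (P + P') => t; rewrite hP hP' hornerD.
Qed.
Lemma polyfunM F G : polyfun F -> polyfun G -> polyfun (fun x y => F x y * G x y).
Proof.
move=> hF hG g h; have [P hP] := hF g h; have [P' hP'] := hG g h.
by exists (P * P') => t; rewrite hP hP' hornerM.
Qed.
Lemma polyfunX F n : polyfun F -> polyfun (fun x y => F x y ^+ n).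
Proof.
move=> hF g h; have [P hP] := hF g h.
by exists (P ^+ n) => t; rewrite hP horner_exp.
Qed.
Lemma polyfunN F : polyfun F -> polyfun (fun x y => - F x y).
Proof.
move=> hF g h; have [P hP] := hF g h.
by exists (- P) => t; rewrite hP hornerN.
Qed.
Lemma polyfun_ext F G : (forall x y, F x y = G x y) -> polyfun F -> polyfun G.
Proof. by move=> e h g k; have [P hP] := h g k; exists P => t; rewrite -e. Qed.
Lemma polyfun_sum (I : Type) (r : seq I) (P : pred I) (F : I -> (C -> K) -> (Q -> K) -> K) :
  (forall i, polyfun (F i)) -> polyfun (fun x y => \sum_(i <- r | P i) F i x y).
Proof.
move=> h; elim: r => [|i r IH].
  by apply: polyfun_ext (polyfun_const 0) => x y; rewrite big_nil.
case Pi : (P i); last by apply: polyfun_ext IH => x y; rewrite big_cons Pi.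
by apply: polyfun_ext (polyfunD (h i) IH) => x y; rewrite big_cons Pi.
Qed.
Lemma polyfun_prod (I : Type) (r : seq I) (F : I -> (C -> K) -> (Q -> K) -> K) :
  (forall i, polyfun (F i)) -> polyfun (fun x y => \prod_(i <- r) F i x y).
Proof.
move=> h; elim: r => [|i r IH].
  by apply: polyfun_ext (polyfun_const 1) => x y; rewrite big_nil.
by apply: polyfun_ext (polyfunM (h i) IH) => x y; rewrite big_cons.
Qed.
Lemma polyfun_monx u : polyfun (fun x _ => mon u x).
Proof. by apply: polyfun_prod => c; apply/polyfunX/polyfun_x. Qed.
Lemma polyfun_mony nu : polyfun (fun _ y => mon nu y).
Proof. by apply: polyfun_prod => c; apply/polyfunX/polyfun_y. Qed.

Lemma mon_neq0 (V : finType) (u : expo V) (z : V -> K) :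
  (forall v, (0 < u v)%N -> z v != 0) -> mon u z != 0.
Proof.
move=> h; apply/prodf_neq0 => v _; case: (posnP (u v)) => [->|/h/expf_neq0 //].
by rewrite expr0 oner_neq0.
Qed.

Lemma mon_eq0 (V : finType) (u : expo V) (z : V -> K) v :
  (0 < u v)%N -> z v = 0 -> mon u z = 0.
Proof.
by move=> h e; apply/eqP/prodf_eq0; exists v; rewrite // e expr0n; case: (u v) h.
Qed.

Lemma sg_cell_neq0 js kap x y j : rows j -> valid kap -> Inc js kap x y ->
  exists2 c, row c = Some j & mon (sg c) y != 0.
Proof.
move=> rj vk [hy hk _]; have /choice[k hk'] := hy.
pose kf : {ffun 'I_p -> 'I_b.+1} := [ffun i => k i].
have klt i : (kf i < dm i)%N.
  have /andP[_ h] := vk i; apply: leq_trans h; rewrite ltnNge ffunE.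
  apply/negP => h; have := hk' i; rewrite (hk (i, k i)) ?eqxx //.
have [rc ic] := cellP rj klt; exists (cell j kf) => //.
apply: mon_neq0 => -[i l]; rewrite ffunE /= ic.
by case: eqP => // ->; rewrite ffunE.
Qed.

(* Two points are joined by a polynomial curve: y moves linearly, and w in row j
   follows w (c.s) - c (w.s), which solves the equation with coefficients
   s = s(y) and is proportional to w as soon as w.s = 0.  *)
Lemma Inc_irr js kap F G : all rows js -> valid kap -> polyfun F -> polyfun G ->
  (exists x y, Inc js kap x y /\ F x y != 0) ->
  (exists x y, Inc js kap x y /\ G x y != 0) ->
  exists x y, [/\ Inc js kap x y, F x y != 0 & G x y != 0].
Proof.
move=> rjs vk pF pG [x1 [y1 [I1 F1]]] [x2 [y2 [I2 G2]]].
have [y1n y1s y1e] := I1; have [y2n y2s y2e] := I2.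
have /choice[k1 hk1] := y1n.
have pick x y : Inc js kap x y -> exists s : nat -> C, forall j, j \in js ->
    row (s j) = Some j /\ mon (sg (s j)) y != 0.
  move=> I; have /choice[s hs] : forall j, exists c, j \in js ->
      row c = Some j /\ mon (sg c) y != 0; last by exists s.
  move=> j; case jjs : (j \in js); last by exists (cell 0 [ffun=> ord0]).
  by have [c h1 h2] := sg_cell_neq0 (allP rjs _ jjs) vk I; exists c.
have [s1 hs1] := pick _ _ I1; have [s2 hs2] := pick _ _ I2.
pose h q : {poly K} := (1 - 'X) * (y1 q)%:P + 'X * (y2 q)%:P.
pose mp c : {poly K} := \prod_q h q ^+ sg c q.
have mpE c t : (mp c).[t] = mon (sg c) (fun q => (h q).[t]).
  by rewrite horner_prod; apply: eq_bigr => q _; rewrite horner_exp.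
(* The auxiliary vector is the basis vector of [s j], and [A] normalizes its product with the tensor
   to 1 at the endpoint, so that the curve passes through [x] itself and not a multiple of it. *)
pose W x (s : nat -> C) y j c : {poly K} := let A := (mon (sg (s j)) y)^-1 in
  (x c)%:P * (A%:P * mp (s j)) -
  ((c == s j)%:R * A)%:P * \sum_(c' | row c' == Some j) (x c')%:P * mp c'.
have Worth x s y j t : row (s j) = Some j ->
    \sum_(c | row c == Some j) (W x s y j c).[t] * (mp c).[t] = 0.
  move=> rs; under eq_bigr do rewrite hornerD hornerN mulrBl.
  rewrite sumrB; apply/eqP; rewrite subr_eq0; apply/eqP.
  rewrite [RHS](bigD1 (s j)) ?rs //= [X in _ = _ + X]big1; last first.
    by move=> c /andP[_ /negbTE ->]; rewrite mul0r hornerM hornerC !mul0r.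
  rewrite addr0 !eqxx mul1r !hornerM !hornerC horner_sum big_distrr /= big_distrl /=.
  by apply: eq_bigr => c _; rewrite !hornerM !hornerC; ring.
have h0 : (fun q => (h q).[0]) = y1.
  by apply: funext => q; rewrite /h !hornerE; ring.
have h1 : (fun q => (h q).[1]) = y2.
  by apply: funext => q; rewrite /h !hornerE; ring.
have Wend x s y t c j : j \in js -> roweqn j x y = 0 -> mon (sg (s j)) y != 0 ->
    (fun q => (h q).[t]) = y -> (W x s y j c).[t] = x c.
  move=> jjs e n0 ht; rewrite /W !(hornerD, hornerN, hornerM, hornerC, horner_sum) mpE ht.
  rewrite mulVf // mulr1 (_ : \sum_(_ | _) _ = 0) ?mulr0 ?subr0 // -[RHS]e.
  by apply: eq_bigr => c' _; rewrite hornerM hornerC mpE ht.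
clearbody W.
pose g c : {poly K} :=
  if row c is Some j then
    if j \in js then (1 - 'X) * W x1 s1 y1 j c + 'X * W x2 s2 y2 j c
    else (1 - 'X) * (x1 c)%:P + 'X * (x2 c)%:P
  else (1 - 'X) * (x1 c)%:P + 'X * (x2 c)%:P.
have g0 : (fun c => (g c).[0]) = x1.
  apply: funext => c; rewrite /g; case: (row c) => [j|]; last by rewrite !hornerE; ring.
  case: ifP => jjs; last by rewrite !hornerE; ring.
  rewrite !(hornerD, hornerM, hornerN, hornerX, hornerC) (Wend x1 s1 y1) ?y1e //.
    by ring.
  by case: (hs1 j jjs).
have g1 : (fun c => (g c).[1]) = x2.
  apply: funext => c; rewrite /g; case: (row c) => [j|]; last by rewrite !hornerE; ring.
  case: ifP => jjs; last by rewrite !hornerE; ring.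
  rewrite !(hornerD, hornerM, hornerN, hornerX, hornerC) (Wend x2 s2 y2) ?y2e //.
    by ring.
  by case: (hs2 j jjs).
have [PF hPF] := pF g h; have [PG hPG] := pG g h.
(* Nonvanishing of [P1] keeps the vector [y] of every player nonzero. *)
pose P1 := \prod_i h (i, k1 i).
have PF0 : PF != 0.
  by apply: contra F1 => /eqP e; rewrite -g0 -h0 hPF e horner0.
have PG0 : PG != 0.
  by apply: contra G2 => /eqP e; rewrite -g1 -h1 hPG e horner0.
have P10 : P1 != 0.
  apply/prodf_neq0 => i _; apply: contra (hk1 i) => /eqP e.
  by rewrite -h0 e horner0.
have [|n] := @poly_nonroot K K0 (PF * PG * P1); first by rewrite !mulf_neq0.
rewrite !hornerM !mulf_eq0 !negb_or -andbA => /and3P[nF nG n1].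
exists (fun c => (g c).[n%:R]), (fun q => (h q).[n%:R]); split.
- split.
  + move=> i; exists (k1 i); move: n1; rewrite horner_prod => /prodf_neq0; exact.
  + by move=> q hq; rewrite /h y1s // y2s // !hornerE; ring.
  + move=> j jjs; rewrite /roweqn.
    transitivity (\sum_(c | row c == Some j) ((1 - n%:R) * ((W x1 s1 y1 j c).[n%:R] * (mp c).[n%:R])
        + n%:R * ((W x2 s2 y2 j c).[n%:R] * (mp c).[n%:R]))).
      apply: eq_bigr => c /eqP rc; rewrite /g rc jjs -mpE.
      by rewrite !(hornerD, hornerM, hornerN, hornerX, hornerC); ring.
    have [r1 _] := hs1 j jjs; have [r2 _] := hs2 j jjs.
    by rewrite big_split -!big_distrr /= !Worth // !mulr0 addr0.
- by rewrite hPF.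
- by rewrite hPG.
Qed.

Definition upd x (t : C) (v : K) := fun c => if c == t then v else x c.
Definition clr (t : C) (n : nat) u : expo C := [ffun c => if c == t then n else u c].
Definition ev (q : expo C * expo Q) x y : K := mon q.1 x * mon q.2 y.

Lemma mon_clr t u x : mon u x = x t ^+ u t * mon (clr t 0 u) x.
Proof.
rewrite {1}/mon (bigD1 t) //=; congr (_ * _); rewrite /mon [RHS](bigD1 t) //=.
rewrite ffunE eqxx expr0 mul1r; apply: eq_bigr => c /negbTE ct.
by rewrite ffunE ct.
Qed.

Lemma mon_clr_upd t u x v : mon (clr t 0 u) (upd x t v) = mon (clr t 0 u) x.
Proof.
by apply: eq_bigr => c _; rewrite ffunE /upd; case: eqP.
Qed.

Lemma Inc_sub js kap kap' x y : (forall i, kap i <= kap' i)%N ->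
  Inc js kap x y -> Inc js kap' x y.
Proof.
by move=> le [h1 h2 h3]; split => // q hq; apply: h2; apply: leq_trans (le _) hq.
Qed.

Definition yall kap : Q -> K := fun q => ((q.2 < kap q.1)%N)%:R.

Lemma Inc_yall js kap x : valid kap ->
  (forall c j, j \in js -> row c = Some j -> x c = 0) -> Inc js kap x (yall kap).
Proof.
move=> vk h; split.
- move=> i; exists ord0; rewrite /yall /=; have /andP[-> _] := vk i.
  by rewrite oner_neq0.
- by move=> q hq; rewrite /yall ltnNge hq.
- move=> j jjs; rewrite /roweqn big1 // => c /eqP rc.
  by rewrite (h c j) ?mul0r.
Qed.

Lemma mon_yall kap (nu : expo Q) :
  (forall q : Q, (0 < nu q)%N -> (q.2 < kap q.1)%N) -> mon nu (yall kap) != 0.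
Proof. by move=> h; apply: mon_neq0 => q /h; rewrite /yall => ->; rewrite oner_neq0. Qed.

Lemma yall_cell kap j (k : {ffun 'I_p -> 'I_b.+1}) : rows j -> valid kap ->
  (forall i, (k i < kap i)%N) -> mon (sg (cell j k)) (yall kap) != 0.
Proof.
move=> rj vk hk; have [_ ic] : row (cell j k) = Some j /\ ix (cell j k) = k.
  by apply: cellP => // i; have /andP[_] := vk i; apply: leq_trans.
by apply: mon_yall => q; rewrite ffunE ic; case: eqP => // ->.
Qed.

Lemma topk_lt kap i : valid kap -> (topk b kap i < kap i)%N.
Proof. by move=> vk; rewrite (topkE dm_b) //; have /andP[h _] := vk i; rewrite prednK. Qed.

Definition rest j kap x y := \sum_(c | (row c == Some j) && (c != tp j kap)) x c * mon (sg c) y.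

(** Row [j] is solved for [tp j kap]; the other rows do not contain that coordinate. *)
Lemma Inc_adjust j js kap x y : rows j -> all rows js -> j \notin js -> valid kap ->
  Inc js kap x y -> mon (sg (tp j kap)) y != 0 ->
  Inc (j :: js) kap (upd x (tp j kap) (- rest j kap x y / mon (sg (tp j kap)) y)) y.
Proof.
move=> rj rjs njs vk [h1 h2 h3] s0; split => // j'.
have [rt _] := tpP dm_b cellP rj vk.
rewrite inE => /orP[/eqP ->|j'js].
  rewrite /roweqn (bigD1 (tp j kap)) ?rt //= {1}/upd eqxx divfK // /rest addrC.
  rewrite (eq_bigr (fun c => x c * mon (sg c) y)) ?subrr // => c /andP[_ /negbTE h].
  by rewrite /upd h.
rewrite -[RHS](h3 _ j'js); apply: eq_bigr => c /eqP rc; congr (_ * _).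
rewrite /upd; case: eqP => // ct; move: rc; rewrite ct rt => -[jj'].
by rewrite jj' j'js in njs.
Qed.

(** Without equations both sets of variables are free, so they are merged into one and
    [mon_sum_neq0] applies. *)
Lemma Std_indep_base kap (L : seq (expo C * expo Q)) (B : expo C * expo Q -> K) :
  valid kap -> uniq L -> L != [::] -> (forall q, q \in L -> suppk kap q.2 /\ B q != 0) ->
  exists x y, Inc [::] kap x y /\ \sum_(q <- L) B q * ev q x y != 0.
Proof.
move=> vk uL L0 hL.
pose jn (q : expo C * expo Q) : expo (C + Q)%type :=
  [ffun v => match v with inl c => q.1 c | inr r => q.2 r end].
pose un (w : expo (C + Q)%type) : expo C * expo Q :=
  ([ffun c => w (inl c)], [ffun r => w (inr r)]).
have jnK : cancel jn un.
  by case=> u nu; congr (_, _); apply/ffunP => c; rewrite !ffunE.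
have [|||z [z0 hz]] := @mon_sum_neq0 _ K (map jn L) (B \o un) K0.
- by rewrite (map_inj_uniq (can_inj jnK)).
- by case: (L) L0.
- by move=> w /mapP[q qL ->] /=; rewrite jnK; case: (hL q qL).
exists (fun c => z (inl c)), (fun r : Q => if (kap r.1 <= r.2)%N then 0 else z (inr r)).
split; first split=> //; [move=> i|by move=> q ->|].
  by exists ord0; rewrite leqNgt /=; have /andP[-> _] := vk i; exact: z0.
move: hz; rewrite big_map => hz; apply: contra hz => /eqP e; apply/eqP.
rewrite -[RHS]e; apply: eq_big_seq => q qL /=; rewrite jnK; congr (_ * _).
rewrite /mon /ev big_sumType /=; congr (_ * _).
  by apply: eq_bigr => c _; rewrite ffunE.
apply: eq_bigr => r _; rewrite ffunE; case: ifP => // h.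
by have [/suppkP/(_ r h) -> _] := hL q qL.
Qed.

(** Standard monomials are independent on the incidence variety. Solving row [j] for [top] and
    clearing denominators turns a combination into [h], a function on the variety of the remaining
    rows. If [top] occurs at all, [h] is tested where one more coordinate of [y] vanishes: there it
    factors through a combination of monomials standard for [dec kap i], to which induction
    applies. *)
Lemma Std_indep js kap (L : seq (expo C * expo Q)) (B : expo C * expo Q -> K) :
  valid kap -> uniq js -> all rows js -> uniq L -> L != [::] ->
  (forall q, q \in L -> Std js kap q.1 q.2 /\ B q != 0) ->
  exists x y, Inc js kap x y /\ \sum_(q <- L) B q * ev q x y != 0.
Proof.
elim: js kap L B => [|j js IH] kap L B vk; first by move=> _ _; exact: Std_indep_base.
move=> /= /andP[njs ujs] /andP[rj rjs] uL L0 hL.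
have [rt it] := tpP dm_b cellP rj vk.
pose top := tp j kap; pose E := (\max_(q <- L) q.1 top)%N.
(* The sum multiplied by the [E]-th power of the coefficient of [top], after substituting the
   solution of row [j]. *)
pose h x y := \sum_(q <- L) B q * (mon (sg top) y ^+ (E - q.1 top) *
    (- rest j kap x y) ^+ q.1 top * ev (clr top 0 q.1, q.2) x y).
have leE q : q \in L -> (q.1 top <= E)%N.
  by move=> qL; rewrite /E (big_rem _ qL) leq_maxl.
have prest : polyfun (rest j kap).
  by apply: polyfun_sum => c; apply: polyfunM (polyfun_x c) (polyfun_mony _).
have pev q : polyfun (ev q) by apply: polyfunM (polyfun_monx _) (polyfun_mony _).
have ph : polyfun h.
  apply: polyfun_sum => q; apply: polyfunM (polyfun_const _) _.
  apply: polyfunM _ (pev _); apply: polyfunM; first exact/polyfunX/polyfun_mony.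
  exact/polyfunX/polyfunN.
suff [x [y [I hxy]]] : exists x y, Inc js kap x y /\ h x y != 0.
  have [||x' [y' [I' h' s']]] := Inc_irr rjs vk ph (polyfun_mony (sg top)).
  - by exists x, y.
  - exists (fun=> 0), (yall kap); split; first exact: Inc_yall.
    by apply: yall_cell => // i; apply: topk_lt.
  exists (upd x' top (- rest j kap x' y' / mon (sg top) y')), y'; split.
    exact: Inc_adjust.
  apply: contra h' => /eqP e; apply/eqP.
  rewrite -[RHS](mulr0 (mon (sg top) y' ^+ E)) -e big_distrr; apply: eq_big_seq => q qL /=.
  rewrite /ev /= [mon q.1 _](mon_clr top) mon_clr_upd /upd eqxx expr_div_n.
  rewrite -(subnK (leE q qL)) exprD addnK; field.
  by rewrite expf_neq0.
have [E0|E0] := posnP E.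
  have q0 q : q \in L -> q.1 top = 0%N.
    by move=> qL; apply/eqP; rewrite -leqn0 -E0 leE.
  have [|x [y [I hxy]]] := IH kap L B vk ujs rjs uL L0.
    move=> q qL; have [] := hL q qL; by rewrite -/top (q0 q qL) eqxx.
  exists x, y; split => //; apply: contra hxy => /eqP e; apply/eqP; rewrite -[RHS]e.
  apply: eq_big_seq => q qL; congr (_ * _); rewrite E0 (q0 q qL) !expr0 !mul1r /ev /=.
  by rewrite [mon q.1 x](mon_clr top) q0 // expr0 mul1r.
pose Pn n := has (fun q : expo C * expo Q => (q.1 top == E) &&
   [exists i : 'I_p, isfirst kap q.2 i && (i == n :> nat)]) L.
have firstE q : q \in L -> q.1 top = E -> exists i, [/\ isfirst kap q.2 i, (1 < kap i)%N &
     Std js (dec kap i) q.1 (esub q.2 (dlt b kap i))].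
  move=> qL qE; have [] := hL q qL; rewrite -/top qE (gtn_eqF E0).
  by case/existsP => i /and3P[h1 h2 h3] _; exists i.
have exPn : exists n, Pn n.
  have [q qL qE] : exists2 q, q \in L & q.1 top = E.
    exact: bigmax_attained L0.
  have [i [h1 h2 h3]] := firstE q qL qE; exists i; apply/hasP; exists q => //.
  by rewrite qE eqxx; apply/existsP; exists i; rewrite h1 /=.
case: (ex_minnP exPn) => n /hasP[q0 q0L /andP[/eqP q0E /existsP[i /andP[fi0 /eqP ni]]]] nmin.
have [i' [fi0' ki st0]] := firstE q0 q0L q0E.
have ii' := isfirst_uniq fi0' fi0; subst i'.
pose sel (q : expo C * expo Q) := (q.1 top == E) && isfirst kap q.2 i.
pose L1 := [seq q <- L | sel q].
pose st (q : expo C * expo Q) := (clr top 0 q.1, esub q.2 (dlt b kap i)).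
pose un (q : expo C * expo Q) := (clr top E q.1, eadd q.2 (dlt b kap i)).
have stK q : q \in L1 -> un (st q) = q.
  rewrite mem_filter => /andP[/andP[/eqP qE /isfirstP[_ qi]] _].
  case: q qE qi => u nu /= qE qi; congr (_, _).
    by apply/ffunP => c; rewrite !ffunE; case: eqP => // ->.
  apply: esubK => r; rewrite ffunE; case: andP => // -[r1 /eqP r2].
  by have := qi r.1 r1; rewrite /tq -r2; case: (r).
have vk' : valid (dec kap i) by apply: valid_dec.
have [||q' |x1 [y1 [I1 g1]]] := IH (dec kap i) (map st L1) (B \o un) vk' ujs rjs.
- by rewrite map_inj_in_uniq ?filter_uniq // => q q' h1 h2 e; rewrite -(stK q) // -(stK q') // e.
- rewrite -size_eq0 size_map size_eq0; apply/eqP => e.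
  by have : q0 \in L1; [rewrite mem_filter /sel q0E eqxx fi0|rewrite e].
- move=> /mapP[q qL1 ->] /=; rewrite stK //; move: qL1; rewrite mem_filter => /andP[/andP[/eqP qE fi] qL].
  split; last by case: (hL q qL).
  have [i' [fi' _ hs]] := firstE q qL qE.
  have e := isfirst_uniq fi' fi; subst i'.
  rewrite -(Std_indiff dm_b cellP (u := q.1)) // => c j' j'js rc.
  rewrite ffunE; case: eqP => // ct; move: rc; rewrite ct /top rt => -[jj'].
  by rewrite jj' j'js in njs.
pose g x y := \sum_(q <- map st L1) (B \o un) q * ev q x y.
have pg : polyfun g by apply: polyfun_sum => q; apply: polyfunM (polyfun_const _) (pev _).
have kle i' : (dec kap i i' <= kap i')%N by apply: leq_subr.
have [||x2 [y2 [I2 g2 r2]]] := Inc_irr rjs vk' pg prest.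
- by exists x1, y1.
(* [rest] omits [top], but the coordinate of multi-index 0 remains in it: it differs from [top] at
   player [i] because [1 < kap i]. *)
- pose c0 := cell j [ffun=> ord0].
  have [rc0 ic0] : row c0 = Some j /\ ix c0 = [ffun=> ord0].
    by apply: cellP => // i'; rewrite ffunE; have /andP[] := vk i'; exact: leq_trans.
  exists (fun c => (c == c0)%:R), (yall (dec kap i)); split.
    apply: Inc_yall => // c j' j'js rc; case: eqP => // e.
    by move: rc; rewrite e rc0 => -[jj']; rewrite jj' j'js in njs.
  rewrite /rest (bigD1 c0) /=; last first.
    rewrite rc0 eqxx /=; apply/eqP => e; have := congr1 (fun c => ix c i) e.
    rewrite it ic0 => ke.
    have : topk b kap i = ord0 by rewrite -ke ffunE.
    by move/(congr1 val) => /= k0; move: ki; rewrite -ltn_predRL -(topkE dm_b) // k0.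
  rewrite eqxx mul1r big1 ?addr0 => [|c /andP[_ /negbTE ->]]; last by rewrite mul0r.
  apply: yall_cell => // i'; rewrite ffunE /=.
  by have /andP[] := vk' i'.
have [||x3 [y3 [I3 gr3 D3]]] := Inc_irr rjs vk' (polyfunM pg prest) (polyfun_mony (dlt b kap i)).
- by exists x2, y2; split => //; rewrite mulf_neq0.
- exists (fun=> 0), (yall (dec kap i)); split; first exact: Inc_yall.
  apply: mon_yall => r; rewrite ffunE; case: andP => // -[r1 /eqP r2'] _.
  rewrite r2' /dec; have := topk_lt r.1 vk; case: eqP => [e|_]; last by rewrite subn0.
  by move: r1; rewrite e ltnn.
exists x3, y3; split; first exact: Inc_sub I3.
move: gr3; rewrite mulf_eq0 negb_or => /andP[g3 r3].
have [_ y3s _] := I3.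
have y3t : y3 (tq b kap i) = 0.
  by apply: y3s; rewrite /= (topkE dm_b) // /dec eqxx subn1.
have s3 : mon (sg top) y3 = 0.
  apply: (@mon_eq0 _ _ _ (tq b kap i)) => //.
  by rewrite ffunE /= it eqxx.
(* The coefficient of [top] vanishes at [y3], which removes all terms with exponent of [top] below
   [E]; the minimality of [i] removes those not in [L1]. *)
suff -> : h x3 y3 = (- rest j kap x3 y3) ^+ E * mon (dlt b kap i) y3 * g x3 y3.
  by rewrite !mulf_neq0 // expf_neq0 // oppr_eq0.
rewrite /h /g big_map big_filter big_distrr [RHS]big_mkcond.
apply: eq_big_seq => q qL /=; case: ifP => [sq|nsq].
  rewrite stK ?mem_filter ?sq //; move: sq => /andP[/eqP qE /isfirstP[_ qi]].
  rewrite qE subnn expr0 mul1r /ev /=.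
  rewrite -{1}(@esubK _ q.2 (dlt b kap i)) ?monD; first by ring.
  move=> r; rewrite ffunE; case: andP => // -[r1 /eqP r2'].
  by have := qi r.1 r1; rewrite /tq -r2'; case: (r).
have [qE|qE] := eqVneq (q.1 top) E; last first.
  rewrite s3 expr0n (_ : (E - q.1 top == 0)%N = false) ?mul0r ?mulr0 //.
  by apply/negbTE; rewrite subn_eq0 -ltnNge ltn_neqAle qE leE.
have [i' [fi' ki' _]] := firstE q qL qE.
have ii' : (i < i')%N.
  have : (n <= i')%N.
    apply: nmin; apply/hasP; exists q => //; rewrite qE eqxx.
    by apply/existsP; exists i'; rewrite fi' eqxx.
  rewrite -ni leq_eqVlt => /orP[/eqP/val_inj e|//].
  by move: nsq; rewrite /sel qE eqxx e fi'.
have /isfirstP[_ /(_ i ii') qi] := fi'.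
by rewrite /ev /= (mon_eq0 (z := y3) qi y3t) !mulr0.
Qed.

End Incidence.

(** * Counting standard exponents *)

(** Normalized leading term [e / D!], as for degrees of projective varieties. The value [e = 0] is
    allowed and encodes slower growth. *)
Definition asym (f : nat -> nat) (D e : nat) : Prop :=
  exists (P : {poly rat}) t0, [/\ forall t, (t0 <= t)%N -> (f t)%:R = P.[t%:R],
    (size P <= D.+1)%N & P`_D * D`!%:R = e%:R].

Lemma asym_eq f g D e : f =1 g -> asym f D e -> asym g D e.
Proof. by move=> fg [P [t0 [h1 h2 h3]]]; exists P, t0; split => // t; rewrite -fg; apply: h1. Qed.

Lemma asym_weak f D e : asym f D e -> asym f D.+1 0.
Proof.
move=> [P [t0 [h1 h2 h3]]]; exists P, t0; split => //; first exact: leqW.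
by rewrite nth_default ?mul0r.
Qed.

Lemma asymD f g D e e' : asym f D e -> asym g D e' ->
  asym (fun t => f t + g t)%N D (e + e').
Proof.
move=> [P [t0 [h1 h2 h3]]] [Q [t1 [k1 k2 k3]]]; exists (P + Q), (maxn t0 t1); split.
- by move=> t; rewrite geq_max => /andP[? ?]; rewrite natrD h1 // k1 // hornerD.
- by apply: leq_trans (size_polyD _ _) _; rewrite geq_max h2.
- by rewrite coefD mulrDl h3 k3 natrD.
Qed.

Lemma asym0 D : asym (fun=> 0%N) D 0.
Proof. by exists 0, 0%N; split; rewrite ?size_poly0 ?coef0 ?mul0r // => t _; rewrite horner0. Qed.

Lemma asym_sum (I : finType) (P : pred I) (f : I -> nat -> nat) D (e : I -> nat) :
  (forall i, P i -> asym (f i) D (e i)) ->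
  asym (fun t => \sum_(i | P i) f i t)%N D (\sum_(i | P i) e i).
Proof.
move=> h; rewrite /index_enum; elim: (Finite.enum _) => [|i r IH].
  by rewrite big_nil; apply: asym_eq (asym0 D) => t; rewrite big_nil.
rewrite big_cons; case: ifP => Pi; last by apply: asym_eq IH => t; rewrite big_cons Pi.
by apply: asym_eq (asymD (h i Pi) IH) => t; rewrite big_cons Pi.
Qed.

Lemma asymM f D e n : asym f D e -> asym (fun t => n * f t)%N D (n * e).
Proof.
move=> [P [t0 [h1 h2 h3]]]; exists (n%:R *: P), t0; split.
- by move=> t ht; rewrite natrM h1 // hornerZ.
- exact: leq_trans (size_scale_leq _ _) h2.
- by rewrite coefZ -mulrA h3 natrM.
Qed.

Lemma asym_shift f D e k : asym f D e -> asym (fun t => f (t - k))%N D e.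
Proof.
move=> [P [t0 [h1 h2 h3]]]; have [c1 c2] := comp_XsubC_coef k%:R h2.
exists (P \Po ('X - k%:R%:P)), (t0 + k)%N; split => //; last by rewrite c1.
move=> t ht; rewrite horner_comp_XsubC h1; last by lia.
by rewrite natrB //; lia.
Qed.

Lemma asym_diff f g D e : asym f D.+1 e -> (forall t, g t.+1 + f t = f t.+1)%N ->
  asym g D e.
Proof.
move=> [P [t0 [h1 h2 h3]]] hg; have [d1 d2] := diff_coef h2.
exists (P - (P \Po ('X - 1%:P))), t0.+1; split => //.
  case=> // t; rewrite ltnS => ht; rewrite hornerD hornerN horner_comp_XsubC.
  by rewrite -[X in P.[X - 1]]natr1 addrK -!h1 ?(leqW ht) // -(hg t) natrD addrK.
transitivity ((D.+1%:R * P`_(D.+1)) * D`!%:R); first by congr (_ * _).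
by rewrite -h3 factS natrM; ring.
Qed.

Lemma asym_binomial m : asym (fun t => 'C(t + m, m)) m 1.
Proof.
elim: m => [|m [P [t0 [h1 h2 h3]]]].
  by exists 1, 0%N; split; rewrite ?size_poly1 ?coef1 ?mul1r // => t _; rewrite bin0 hornerC.
exists (m.+1%:R^-1 *: (P * ('X + m.+1%:R%:P))), t0.
have m0 : (m.+1%:R : rat) != 0 by rewrite pnatr_eq0.
split.
- move=> t ht; rewrite hornerZ hornerM -h1 // hornerD hornerX hornerC.
  apply: (mulfI m0); rewrite mulVKf // -natrD -!natrM addnS -mul_bin_diag /=.
  by rewrite mulnC.
- apply: leq_trans (size_scale_leq _ _) _; apply: leq_trans (size_polyMleq _ _) _.
  by rewrite size_XaddC addn2 /= ltnS.
- rewrite coefZ mulrDr coefD coefMX /= coefMC [P`_(m.+1)]nth_default // mul0r.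
  by rewrite addr0 factS natrM -[RHS]h3 mulrACA mulVf // mul1r.
Qed.

Lemma count_exists (I : finType) (T : Type) (P : I -> pred T) (s : seq T) :
  (forall q i i', P i q -> P i' q -> i = i') ->
  count (fun q => [exists i, P i q]) s = (\sum_i count (P i) s)%N.
Proof.
move=> h; elim: s => [|q s IH] /=; first by rewrite big1.
rewrite big_split IH /=; congr (_ + _)%N.
case: existsP => [[i Pi]|n]; last first.
  by rewrite big1 // => i _; apply/eqP; rewrite eqb0; apply/negP => Pi; apply: n; exists i.
rewrite (bigD1 i) //= Pi big1 ?addn0 // => i' ii'.
by apply/eqP; rewrite eqb0; apply: contraNN ii' => Pi'; apply/eqP/(h q).
Qed.

Lemma size_mons (V : finType) m t : #|V| = m.+1 -> size (mons V t) = 'C(t + m, m).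
Proof.
move=> cV; rewrite addnC -(card_ord_partitions m t) size_filter count_map.
have [f [g fK gK]] : exists f : V -> 'I_m.+1, exists2 g, cancel f g & cancel g f.
  exists (fun v => cast_ord cV (enum_rank v)), (fun i => enum_val (cast_ord (esym cV) i)).
    by move=> v; rewrite cast_ordK enum_rankK.
  by move=> i; rewrite enum_valK cast_ordKV.
pose F (h : {ffun V -> 'I_t.+1}) := [tuple h (g i) | i < m.+1].
pose G (s : m.+1.-tuple 'I_t.+1) := [ffun v => tnth s (f v)].
rewrite -sum1_count big_enum_cond -sum1_card.
rewrite (reindex_onto G F) /=; last first.
  by move=> h _; apply/ffunP => v; rewrite ffunE tnth_mktuple fK.
apply: eq_bigl => s; rewrite inE /edeg.
have -> : F (G s) == s by apply/eqP/eq_from_tnth => i; rewrite tnth_mktuple ffunE gK.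
rewrite andbT; congr (_ == t).
rewrite big_tuple [RHS](reindex f) /=; last by exists g => x _; rewrite ?fK ?gK.
by apply: eq_bigr => v _; rewrite !ffunE.
Qed.

Section StandardCount.
Variables (C : finType) (p b : nat) (row : C -> option nat).
Variables (ix : C -> {ffun 'I_p -> 'I_b.+1}) (cell : nat -> {ffun 'I_p -> 'I_b.+1} -> C).
Variables (dm : 'I_p -> nat) (rows : pred nat).
Notation Q := ('I_p * 'I_b.+1)%type.
Implicit Types (kap a : 'I_p -> nat) (u : expo C) (nu : expo Q) (js : seq nat).
Hypothesis dm_b : forall i, (dm i <= b.+1)%N.
Hypothesis cellP : forall j (k : {ffun 'I_p -> 'I_b.+1}), rows j ->
  (forall i, (k i < dm i)%N) -> row (cell j k) = Some j /\ ix (cell j k) = k.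
Local Notation valid := (valid dm).
Local Notation Std := (Std cell).

Definition qexps a : seq (expo Q) := [seq nu <- mons Q (\sum_i a i) | qdegs a nu].
Definition bexps a t : seq (expo C * expo Q) := [seq (u, nu) | u <- mons C t, nu <- qexps a].
Definition NN js kap a t := count (fun q => Std js kap q.1 q.2) (bexps a t).

Lemma edeg_qdeg nu : edeg nu = (\sum_i qdeg nu i)%N.
Proof. by rewrite /edeg pair_bigA /=; apply: eq_bigr => -[]. Qed.

Lemma qdegsP a nu : reflect (forall i, qdeg nu i = a i) (qdegs a nu).
Proof. by apply: (iffP forallP) => h i; apply/eqP/h. Qed.

Lemma mem_qexps a nu : (nu \in qexps a) = qdegs a nu.
Proof.
rewrite mem_filter mem_mons andb_idr // => /qdegsP h.
by rewrite edeg_qdeg; apply/eqP/eq_bigr.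
Qed.

Lemma mem_bexps a t q : (q \in bexps a t) = (edeg q.1 == t) && qdegs a q.2.
Proof.
apply/allpairsP/andP => [[[u nu] /= [hu hn ->]]|[hu hn]] /=.
  by rewrite -mem_mons -mem_qexps.
by exists q; rewrite mem_mons mem_qexps; case: (q) hu hn.
Qed.

Lemma qexps_uniq a : uniq (qexps a).
Proof. exact/filter_uniq/mons_uniq. Qed.

Lemma bexps_uniq a t : uniq (bexps a t).
Proof.
apply: allpairs_uniq (mons_uniq _ _) (qexps_uniq a) _.
by move=> [? ?] [? ?] _ _ [-> ->].
Qed.

Definition adec a (i : 'I_p) := fun i' : 'I_p => (a i' - (i' < i))%N.

(** Standard exponents for [j :: js] free of [top] are those for [js] free of [top], that is, all of
    them minus the multiples of [top]; the others are divided by [top] and by the product [dlt] of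
    the first missing player. The additive form avoids truncated subtraction. *)
Lemma NN_rec j js kap a t : rows j -> all rows js -> j \notin js -> valid kap ->
  (forall i, (0 < a i)%N) ->
  (NN (j :: js) kap a t.+1 + NN js kap a t =
   NN js kap a t.+1 + \sum_(i | (1 < kap i)%N) NN js (dec kap i) (adec a i) t)%N.
Proof.
move=> rj rjs njs vk ha; have [rt it] := tpP dm_b cellP rj vk.
pose top := tp cell j kap.
have indiff kap' u u' nu : valid kap' -> (forall c, c != top -> u c = u' c) ->
    Std js kap' u nu = Std js kap' u' nu.
  move=> vk' h; apply: (Std_indiff dm_b cellP) => // c j' j'js rc; apply: h.
  by apply: contraNneq njs => e; move: rc; rewrite e rt => -[->].
rewrite {1 3}/NN (count_split _ (fun q : expo C * expo Q => q.1 top == 0%N)).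
rewrite [in RHS](count_split _ (fun q : expo C * expo Q => q.1 top == 0%N)).
have -> : count (fun q => Std js kap q.1 q.2 && (q.1 top != 0%N)) (bexps a t.+1) = NN js kap a t.
  apply: (@count_bij _ _ (fun q => (esub q.1 (eX top), q.2)) (fun q => (eadd q.1 (eX top), q.2)));
    rewrite ?bexps_uniq // => -[u nu]; rewrite !mem_bexps /= => /andP[/eqP du dn].
    rewrite -lt0n => /andP[hs u0]; rewrite esubXK //; split => //.
      by rewrite dn andbT -eqSS edeg_subX // du.
    by rewrite -(indiff _ u) // => c ct; rewrite !ffunE (negbTE ct) subn0.
  move=> hs; rewrite eaddK edegD edegX du dn addn1 eqxx; split => //.
  rewrite !ffunE eqxx addn1 andbT -(indiff _ u) // => c ct.
  by rewrite !ffunE (negbTE ct) addn0.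
have -> : count (fun q => Std (j :: js) kap q.1 q.2 && (q.1 top == 0%N)) (bexps a t.+1) =
    count (fun q => Std js kap q.1 q.2 && (q.1 top == 0%N)) (bexps a t.+1).
  by apply: eq_count => q /=; rewrite -/top; case: eqP; rewrite ?andbT ?andbF.
suff -> : count (fun q => Std (j :: js) kap q.1 q.2 && (q.1 top != 0%N)) (bexps a t.+1) =
    (\sum_(i | (1 < kap i)%N) NN js (dec kap i) (adec a i) t)%N.
  by rewrite -!addnA; congr (_ + _)%N; rewrite addnC.
pose P i (q : expo C * expo Q) := [&& isfirst kap q.2 i, (1 < kap i)%N,
   Std js (dec kap i) q.1 (esub q.2 (dlt b kap i)) & q.1 top != 0%N].
rewrite (eq_count (a2 := fun q => [exists i, P i q])); last first.
  move=> q /=; rewrite -/top; case: (eqVneq (q.1 top) 0%N) => u0 /=.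
    by rewrite andbF; apply/esym/existsP => -[i /and4P[_ _ _]]; rewrite u0.
  by rewrite andbT; apply: eq_existsb => i; rewrite /P u0 andbT.
rewrite count_exists; last first.
  by move=> q i i' /and4P[h _ _ _] /and4P[h' _ _ _]; apply: isfirst_uniq h h'.
rewrite [RHS]big_mkcond; apply: eq_bigr => i _; case: ifP => ki; last first.
  by apply/eqP; rewrite eqn0Ngt -has_count; apply/hasP => -[q _]; rewrite /P ki andbF.
apply: (@count_bij _ _ (fun q => (esub q.1 (eX top), esub q.2 (dlt b kap i)))
    (fun q => (eadd q.1 (eX top), eadd q.2 (dlt b kap i))));
  rewrite ?bexps_uniq // => -[u nu]; rewrite !mem_bexps /= => /andP[/eqP du /qdegsP dn].
  rewrite /P /= -lt0n => /and4P[/isfirstP[_ fi] _ hs u0].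
  have nK : eadd (esub nu (dlt b kap i)) (dlt b kap i) = nu.
    apply: esubK => r; rewrite ffunE; case: andP => // -[r1 /eqP r2].
    by have := fi r.1 r1; rewrite /tq -r2; case: (r).
  rewrite esubXK // nK; split => //; last first.
    rewrite -(indiff _ u) // => [|c ct]; first exact: valid_dec.
    by rewrite !ffunE (negbTE ct) subn0.
  rewrite -eqSS edeg_subX // du eqxx /=; apply/qdegsP => i'.
  have := qdegD (esub nu (dlt b kap i)) (dlt b kap i) i'.
  by rewrite nK dn qdeg_dlt /adec => ->; rewrite addnK.
move=> hs; rewrite !eaddK edegD edegX du addn1 eqxx; split => //.
  apply/qdegsP => i'; rewrite qdegD dn qdeg_dlt /adec subnK //.
  by case: (i' < i)%N; rewrite ?ha.
have vk' := valid_dec vk ki.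
rewrite /P /= eaddK ki !ffunE eqxx addn1 /= andbT; apply/andP; split.
  apply/isfirstP; split.
    rewrite ffunE dlt_tq ltnn addn0; move/suppkP: (Std_supp dm_b vk' hs); apply.
    by rewrite /= (topkE dm_b) // /dec eqxx subn1.
  by move=> i' hi'; rewrite ffunE dlt_tq hi' addn1.
by rewrite -(indiff _ u) // => c ct; rewrite !ffunE (negbTE ct) addn0.
Qed.

(** The dimension of the product of projective spaces in which [y] varies. *)
Definition mu kap := (\sum_i (kap i).-1)%N.

Lemma prod_fact_dec kap i : (1 < kap i)%N ->
  ((kap i).-1 * \prod_i' (dec kap i i').-1`! = \prod_i' (kap i').-1`!)%N.
Proof.
move=> ki; rewrite (bigD1 i) //= [in RHS](bigD1 i) //= mulnA; congr (_ * _)%N.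
  by rewrite /dec eqxx subn1; case: (kap i) ki => // -[] // n _; rewrite /= -factS.
by apply: eq_bigr => i' /negbTE h; rewrite /dec h subn0.
Qed.

Lemma mu_dec kap i : (1 < kap i)%N -> (mu (dec kap i)).+1 = mu kap.
Proof.
move=> ki; rewrite /mu (bigD1 i) //= [in RHS](bigD1 i) //= /dec eqxx -addSn.
congr (_ + _)%N; first by lia.
by apply: eq_bigr => i' /negbTE ->; rewrite subn0.
Qed.

Lemma count_suppk1 kap a : valid kap -> mu kap = 0%N -> count (suppk kap) (qexps a) = 1%N.
Proof.
move=> vk /eqP; rewrite sum_nat_eq0 => /forallP k1.
have k1' i : kap i = 1%N by have /implyP/(_ isT)/eqP := k1 i; have := vk i; lia.
pose n0 : expo Q := [ffun q : Q => if q.2 == ord0 then a q.1 else 0%N].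
rewrite (eq_in_count (a2 := pred1 n0)).
  rewrite count_uniq_mem ?qexps_uniq // mem_qexps.
  apply/eqP; rewrite eqb1; apply/qdegsP => i.
  rewrite /qdeg (bigD1 ord0) //= ffunE /= big1 ?addn0 // => k /negbTE h.
  by rewrite ffunE /= h.
move=> nu; rewrite mem_qexps => /qdegsP dn /=.
apply/suppkP/eqP => [h|-> q]; last first.
  by rewrite k1' ffunE; case: eqP => // ->.
apply/ffunP => -[i k]; rewrite ffunE /=; case: (eqVneq k ord0) => [->|k0].
  rewrite -dn /qdeg (bigD1 ord0) //= big1 ?addn0 // => l l0.
  by apply: h; rewrite /= k1' lt0n.
by apply: h; rewrite /= k1' lt0n.
Qed.

(** Multiplication by a coordinate outside the rows [js] preserves standardness. This makes the
    truncated difference in the recursion a true one. *)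
Lemma NN_mono j js kap a t : rows j -> all rows js -> j \notin js -> valid kap ->
  (NN js kap a t <= NN js kap a t.+1)%N.
Proof.
move=> rj rjs njs vk; have [rt _] := tpP dm_b cellP rj vk; pose top := tp cell j kap.
pose F (q : expo C * expo Q) := (eadd q.1 (eX top), q.2).
pose L t := [seq q <- bexps a t | Std js kap q.1 q.2].
suff : (size (map F (L t)) <= size (L t.+1))%N by rewrite size_map /L !size_filter.
apply: uniq_leq_size => [|w].
  rewrite map_inj_uniq ?(filter_uniq _ (bexps_uniq _ _)) // => -[u nu] [u' nu'] [h ->].
  congr (_, _); apply/ffunP => c; have := congr1 (fun v : expo C => v c) h.
  by rewrite !ffunE => /addIn.
move=> /mapP[[u nu]]; rewrite mem_filter mem_bexps /= => /andP[hs /andP[/eqP du dn]] ->.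
rewrite mem_filter mem_bexps /= edegD edegX du addn1 eqxx dn !andbT.
rewrite -(Std_indiff dm_b cellP (u := u)) // => c j' j'js rc; rewrite !ffunE.
case: eqP => [e'|]; rewrite ?addn0 //; move: rc; rewrite e' /top rt => -[ej].
by rewrite ej j'js in njs.
Qed.

Lemma NN_asym js kap a : valid kap -> uniq js -> all rows js ->
  (forall i, (size js < a i)%N) -> (size js < #|C|)%N ->
  exists e, asym (NN js kap a) (#|C|.-1 - (size js - mu kap)) e /\
    ((mu kap <= size js)%N ->
     e * (\prod_i (kap i).-1`! * (size js - mu kap)`!) = (size js)`!)%N.
Proof.
elim: js kap a => [|j js IH] kap a vk.
  move=> _ _ _ C0; exists (count (suppk kap) (qexps a) * 1)%N; split.
    rewrite sub0n subn0; apply: asym_eq (asymM _ (asym_binomial _)) => t.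
    rewrite -(@size_mons C) ?prednK // mulnC.
    rewrite /NN /bexps; elim: (mons C t) => //= u s IHs.
    by rewrite mulSn count_cat IHs count_map; congr (_ + _)%N; apply: eq_count.
  rewrite leqn0 muln1 sub0n => /eqP m0; rewrite count_suppk1 // muln1 mul1n big1 // => i _.
  by move/eqP: m0; rewrite sum_nat_eq0 => /forallP/(_ i)/implyP/(_ isT)/eqP ->.
move=> /= /andP[njs ujs] /andP[rj rjs] ha lC.
have ha1 i : (size js < a i)%N by apply: ltnW.
have ha2 i i' : (size js < adec a i i')%N.
  by rewrite /adec; have := ha i'; case: (i' < i)%N; clear; lia.
have [e0 [A0 E0]] := IH kap a vk ujs rjs ha1 (ltnW lC).
have /choice[e He] : forall i, exists e, (1 < kap i)%N ->
   asym (NN js (dec kap i) (adec a i)) (#|C|.-1 - (size js - mu (dec kap i))) e /\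
    ((mu (dec kap i) <= size js)%N ->
     e * (\prod_i' (dec kap i i').-1`! * (size js - mu (dec kap i))`!) = (size js)`!)%N.
  move=> i; case: (ltnP 1 (kap i)) => ki; last by exists 0%N.
  by have [e he] := IH _ _ (valid_dec vk ki) ujs rjs (ha2 i) (ltnW lC); exists e.
pose df t := (NN js kap a t - NN js kap a t.-1)%N.
have ndf t : (df t.+1 + NN js kap a t = NN js kap a t.+1)%N.
  by rewrite /df /= subnK // (NN_mono a t rj).
have rec t : (NN (j :: js) kap a t.+1 =
    df t.+1 + \sum_(i | (1 < kap i)%N) NN js (dec kap i) (adec a i) t)%N.
  have := NN_rec t rj rjs njs vk (fun i => leq_ltn_trans (leq0n _) (ha1 i)).
  by rewrite -(ndf t) addnAC => /addIn.
have fin D e1 e2 : asym df D e1 ->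
    asym (fun t => \sum_(i | (1 < kap i)%N) NN js (dec kap i) (adec a i) t)%N D e2 ->
    asym (NN (j :: js) kap a) D (e1 + e2).
  move=> h1 /(asym_shift 1) h2; have [P [t0 [k1 k2 k3]]] := asymD h1 h2.
  exists P, t0.+1; split => // -[|t] // ht.
  by rewrite rec -k1 ?subn1 //; apply: ltnW.
have sumE : (\sum_(i | (1 < kap i)%N) (kap i).-1 = mu kap)%N.
  rewrite big_mkcond; apply: eq_bigr => i _; case: ltnP => //.
  by case: (kap i) => // -[].
have ei i : (1 < kap i)%N -> (mu kap <= (size js).+1)%N ->
   (e i * (\prod_i (kap i).-1`! * ((size js).+1 - mu kap)`!) = (size js)`! * (kap i).-1)%N.
  move=> ki; rewrite -(mu_dec ki) ltnS subSS => le.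
  have [_ /(_ le) <-] := He i ki; rewrite -(prod_fact_dec ki).
  by rewrite -!mulnA; congr (_ * _)%N; rewrite mulnC -!mulnA.
case: (leqP (mu kap) (size js)) => le.
  exists (e0 + \sum_(i | (1 < kap i)%N) e i)%N; split.
    apply: fin.
      apply: (asym_diff _ ndf).
      have -> : ((#|C|.-1 - ((size js).+1 - mu kap)).+1 = #|C|.-1 - (size js - mu kap))%N.
        move: lC le; clear; move: #|C| (size js) (mu kap) => *; lia.
      exact: A0.
    apply: asym_sum => i ki; have [+ _] := He i ki.
    have -> // : (#|C|.-1 - (size js - mu (dec kap i)) = #|C|.-1 - ((size js).+1 - mu kap))%N.
    have := mu_dec ki; move: lC le; clear; move: #|C| (size js) (mu kap) (mu _) => *; lia.
  move=> _; rewrite mulnDl big_distrl /=.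
  rewrite [X in (_ + X)%N](eq_bigr (fun i => (size js)`! * (kap i).-1)%N); last first.
    by move=> i ki; rewrite ei ?(leqW le).
  rewrite -big_distrr /= sumE subSn // factS.
  have -> : (e0 * (\prod_i (kap i).-1`! * ((size js - mu kap).+1 * (size js - mu kap)`!)) =
    (size js)`! * (size js - mu kap).+1)%N by rewrite -(E0 le); clear; lia.
  by rewrite -mulnDr factS mulnC; congr (_ * _)%N; clear -le; lia.
(* With [size js < mu kap] the expected codimension is 0 before and after adding row [j], so the
   difference [df] has smaller degree and contributes 0 to the leading term. *)
exists (0 + \sum_(i | (1 < kap i)%N) e i)%N; split.
  apply: fin.
    have -> : (#|C|.-1 - ((size js).+1 - mu kap) = #|C|.-2.+1)%N by move: lC le; clear; move: #|C| (size js) (mu kap) => *; lia.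
    apply: (asym_weak (e := e0)); apply: (asym_diff _ ndf).
    have -> // : (#|C|.-2.+1 = #|C|.-1 - (size js - mu kap))%N by move: lC le; clear; move: #|C| (size js) (mu kap) => *; lia.
  apply: asym_sum => i ki; have [+ _] := He i ki.
  have -> // : (#|C|.-1 - (size js - mu (dec kap i)) = #|C|.-1 - ((size js).+1 - mu kap))%N.
  have := mu_dec ki; move: lC le; clear; move: #|C| (size js) (mu kap) (mu _) => *; lia.
move=> le2; rewrite add0n big_distrl /=.
rewrite [LHS](eq_bigr (fun i => (size js)`! * (kap i).-1)%N); last by move=> i ki; rewrite ei.
by rewrite -big_distrr /= sumE factS mulnC; congr (_ * _)%N; clear -le le2; lia.
Qed.

End StandardCount.

(** * Comparison of polynomials with rational coefficients at large integers *)

Lemma poly_ev_pos (P : {poly rat}) : 0 < lead_coef P ->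
  exists e t0, 0 < e /\ forall t, (t0 <= t)%N -> e <= P.[t%:R].
Proof.
elim/poly_ind: P => [|P c IH]; first by rewrite lead_coef0 ltxx.
have [->|P0] := eqVneq P 0.
  rewrite mul0r add0r lead_coefC => c0; exists c, 0%N; split => // t _.
  by rewrite hornerC.
rewrite lead_coefDl ?size_mulX // ?size_polyC; last first.
  by case: (c == 0); rewrite //= ltnS lt0n size_poly_eq0.
rewrite lead_coefMX => /IH[e [t0 [e0 h]]].
have [n hn] : exists n : nat, (e - c) / e <= n%:R.
  exists (Num.bound `|(e - c) / e|); apply: le_trans (ler_norm _) _.
  exact/ltW/archi_boundP/normr_ge0.
exists e, (maxn t0 n); split => // t; rewrite geq_max => /andP[tt0 tn].
rewrite hornerD hornerM hornerX hornerC -lerBlDr.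
have h1 := h t tt0.
have h2 : e - c <= e * t%:R.
  by rewrite mulrC -ler_pdivrMr // (le_trans hn) // ler_nat.
by apply: le_trans h2 _; apply: ler_wpM2r h1; rewrite ler0n.
Qed.

Lemma poly_ev_ge0 (P : {poly rat}) t0 :
  (forall t : nat, (t0 <= t)%N -> 0 <= P.[t%:R]) -> 0 <= lead_coef P.
Proof.
move=> h; rewrite leNgt; apply/negP => l0.
have [|e [t1 [e0 h1]]] := @poly_ev_pos (- P); first by rewrite lead_coefN oppr_gt0.
have := h1 (maxn t0 t1) (leq_maxr _ _); have := h (maxn t0 t1) (leq_maxl _ _).
by rewrite hornerN; lra.
Qed.

Lemma poly_ev_le (P Q : {poly rat}) t0 :
  (forall t : nat, (t0 <= t)%N -> 0 <= P.[t%:R] <= Q.[t%:R]) -> (size P <= size Q)%N.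
Proof.
move=> h; rewrite leqNgt; apply/negP => lt.
have P0 : lead_coef P != 0.
  by rewrite lead_coef_eq0; apply: contraTneq lt => ->; rewrite size_poly0.
have h1 : 0 <= lead_coef P by apply: (@poly_ev_ge0 _ t0) => t /h/andP[].
have : 0 <= lead_coef (- P + Q).
  by apply: (@poly_ev_ge0 _ t0) => t /h/andP[_]; rewrite hornerD hornerN addrC subr_ge0.
rewrite lead_coefDl ?size_polyN // lead_coefN oppr_ge0 => h2.
by move: P0; rewrite eq_le h1 h2.
Qed.

Lemma size_diff (Q : {poly rat}) (k : rat) : Q != 0 ->
  (size (Q - (Q \Po ('X - k%:P)))%R < size Q)%N.
Proof.
move=> Q0; have sQ : size Q = (size Q).-1.+1 by rewrite prednK // lt0n size_poly_eq0.
have [c1 c2] := @comp_XsubC_coef _ Q k _ (eq_leq sQ).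
rewrite [ltnRHS]sQ ltnS; apply/leq_sizeP => j; rewrite leq_eqVlt => /orP[/eqP <-|nj].
  by rewrite coefB c1 subrr.
rewrite coefB !nth_default ?subrr //; first by apply: leq_trans c2 _.
by rewrite sQ.
Qed.

(** [Q - P] lies between 0 and the difference of [Q] and its translate, which has smaller degree
    than [Q]. *)
Lemma poly_squeeze (P Q : {poly rat}) (k : rat) t0 :
  (forall t : nat, (t0 <= t)%N -> Q.[t%:R - k] <= P.[t%:R] <= Q.[t%:R]) ->
  Q != 0 -> size P = size Q /\ lead_coef P = lead_coef Q.
Proof.
move=> h Q0; have lt : (size (Q - P)%R < size Q)%N.
  apply: leq_ltn_trans (size_diff k Q0).
  apply: (@poly_ev_le _ _ t0) => t /h/andP[h1 h2].
  by rewrite !(hornerD, hornerN) horner_comp_XsubC; lra.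
have -> : P = Q + (- (Q - P)) by rewrite opprB addrC subrK.
by rewrite size_polyDl ?size_polyN // lead_coefDl ?size_polyN.
Qed.

Section Derivation.
Variables (K : fieldType) (C : finType).
Hypothesis K0 : forall n, (n.+1%:R : K) != 0.
Implicit Types (x v : C -> K) (f : (C -> K) -> K).

(** [D] stands for the gradient of [f], through three properties: degree, Euler's identity, and the
    first-order Taylor expansion along lines. *)
Definition diffform t f (D : C -> (C -> K) -> K) :=
  [/\ forall c, isform t (D c), forall x, \sum_c x c * D c x = t.+1%:R * f x &
    forall x v, exists P : {poly K}, forall s,
      f (fun c => x c + s * v c) = f x + s * (\sum_c v c * D c x) + s ^+ 2 * P.[s]].

Lemma sum_delta (g : C -> K) c m : \sum_c' g c' * ((c' == c)%:R * m) = g c * m.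
Proof.
rewrite (bigD1 c) //= eqxx mul1r big1 ?addr0 // => c' /negbTE ->.
by rewrite mul0r mulr0.
Qed.

Lemma diffform_mon t u : edeg u = t.+1 -> exists D, diffform t (mon (K := K) u) D.
Proof.
elim: t u => [|t IH] u du.
all: have [c uc] : exists c, (0 < u c)%N
  by apply/existsP; apply: contraPT du; rewrite negb_exists => /forallP h;
     rewrite /edeg big1 // => c _; apply/eqP; rewrite eqn0Ngt.
all: have uE x : mon u x = x c * mon (esub u (eX c)) x
  by rewrite -{1}(esubXK uc) monD monX mulrC.
all: have du' := edeg_subX uc; rewrite du in du'; case: du' => du'.
- have m1 x : mon (esub u (eX c)) x = 1 :> K.
    suff -> : esub u (eX c) = e0 C by rewrite mon0.
    apply/ffunP => c'; rewrite [RHS]ffunE; apply/eqP; rewrite -leqn0 -du'; exact: leq_edeg.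
  exists (fun c' _ => (c' == c)%:R); split.
  + by move=> c'; apply: isformC.
  + move=> x; rewrite uE m1 (bigD1 c) //= eqxx big1 ?addr0 ?mulr1 ?mul1r //.
    by move=> c' /negbTE ->; rewrite mulr0.
  + move=> x v; exists 0 => s; rewrite !uE !m1 horner0 (bigD1 c) //= eqxx big1.
      rewrite mulr1n; ring.
    by move=> c' /negbTE ->; rewrite mulr0.
- have [D [D1 D2 D3]] := IH _ du'; set m := mon (esub u (eX c)) in uE D2 D3.
  have fm : isform t.+1 m by rewrite -du'; apply: isform_mon.
  exists (fun c' x => x c * D c' x + (c' == c)%:R * m x); split.
  + move=> c'; apply: isformD; last exact: isformZ.
    exact: isformM (isform_coord _ _) (D1 c').
  + move=> x; rewrite uE; under eq_bigr do rewrite mulrDr.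
    rewrite big_split /= sum_delta; under eq_bigr do rewrite mulrCA.
    by rewrite -big_distrr /= D2 -[t.+2%:R]natr1; ring.
  + move=> x v; have [P hP] := D3 x v.
    have E : \sum_c' v c' * (x c * D c' x + (c' == c)%:R * m x) =
        x c * (\sum_c' v c' * D c' x) + v c * m x.
      under eq_bigr do rewrite mulrDr.
      rewrite big_split /= sum_delta; congr (_ + _).
      by under eq_bigr do rewrite mulrCA; rewrite -big_distrr.
    exists ((x c)%:P * P + (v c * (\sum_c v c * D c x))%:P + (v c)%:P * 'X * P) => s.
    by rewrite !uE -/m hP E !hornerE; ring.
Qed.

Lemma diffform_exists t f : isform t.+1 f -> exists D, diffform t f D.
Proof.
move=> /isformE[b hf].
have /choice[D HD] : forall u, exists D, edeg u = t.+1 -> diffform t (mon (K := K) u) D.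
  move=> u; have [/diffform_mon[D hD]|ne] := eqVneq (edeg u) t.+1; first by exists D.
  by exists (fun _ _ => 0) => e; rewrite e eqxx in ne.
have HD' u : u \in mons C t.+1 -> diffform t (mon (K := K) u) (D u).
  by rewrite mem_mons => /eqP /HD.
exists (fun c x => \sum_(u <- mons C t.+1 | edeg u == t.+1) b u * D u c x).
have condE (F : expo C -> K) : \sum_(u <- mons C t.+1 | edeg u == t.+1) F u =
    \sum_(u <- mons C t.+1) F u.
  by rewrite big_mkcond; apply: eq_big_seq => u; rewrite mem_mons => ->.
have sumE (g x : C -> K) :
    \sum_c g c * (\sum_(u <- mons C t.+1 | edeg u == t.+1) b u * D u c x) =
    \sum_(u <- mons C t.+1) b u * (\sum_c g c * D u c x).
  under eq_bigr do rewrite condE big_distrr.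
  rewrite exchange_big; apply: eq_bigr => u _ /=.
  by under eq_bigr do rewrite mulrCA; rewrite -big_distrr.
split.
- move=> c; apply: isform_sum => u /eqP du; apply: isformZ.
  by have [h _ _] := HD u du.
- move=> x; rewrite sumE hf big_distrr /=.
  by apply: eq_big_seq => u /HD'[_ -> _] /=; ring.
- move=> x v.
  have /choice[P HP] : forall u, exists P : {poly K}, u \in mons C t.+1 -> forall s,
      mon u (fun c => x c + s * v c) = mon u x + s * (\sum_c v c * D u c x) + s ^+ 2 * P.[s].
    move=> u; case uin : (u \in mons C t.+1); last by exists 0.
    by have [_ _ /(_ x v)[P hP]] := HD' u uin; exists P.
  exists (\sum_(u <- mons C t.+1) (b u)%:P * P u) => s; rewrite !hf sumE.
  rewrite horner_sum !big_distrr -!big_split; apply: eq_big_seq => u uin /=.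
  by rewrite HP // hornerM hornerC; ring.
Qed.

Lemma lin_coef_zero (d : K) (P : {poly K}) :
  (forall s, s * d + s ^+ 2 * P.[s] = 0) -> d = 0.
Proof.
move=> h; apply/eqP; apply: contraT => d0.
have [|n] := @poly_nonroot K K0 ('X * (d%:P + 'X * P)).
  rewrite mulf_neq0 ?polyX_eq0 //; apply: contra d0 => /eqP e.
  by have := congr1 (fun p : {poly K} => p.[0]) e; rewrite !hornerE /= => ->.
by rewrite !hornerE mulrDr mulrA -expr2 h eqxx.
Qed.

End Derivation.

(** * Hilbert polynomials of degeneracy loci *)

(** Too many monomials become dependent on [Y]; in characteristic zero a nontrivial combination of
    monomials is a nonzero function. *)
Lemma form_vanishing_on (K : fieldType) (C : finType) (Y : pset K C) t :
  (forall n, (n.+1%:R : K) != 0) -> (hf Y t < size (mons C t))%N ->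
  exists f, [/\ isform t f, exists x, f x != 0 & forall x, Y x -> f x = 0].
Proof.
move=> K0 lt; set L := mons C t in lt.
pose m (j : 'I_(size L)) : (C -> K) -> K := mon (tnth (in_tuple L) j).
have mf j : isform t (m j).
  have : tnth (in_tuple L) j \in L := mem_tnth j (in_tuple L).
  by rewrite mem_mons => /eqP <-; apply: isform_mon.
have [al [hal [j alj]]] : exists al : 'I_(size L) -> K,
    (forall x, Y x -> \sum_j al j * m j x = 0) /\ exists j, al j != 0.
  apply: contrapT => h; move: lt; rewrite ltnNge (hf_ge mf) // => al hal j.
  by apply/eqP; apply: contraT => alj; case: h; exists al; split => //; exists j.
exists (fun x => \sum_j al j * m j x); split => //.
  by apply: isform_sum => k _; apply: isformZ.
have [B HB] := tuple_coef al (mons_uniq C t).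
pose L' := [seq u <- L | B u != 0].
have [|||x [_ hx]] := @mon_sum_neq0 C K L' B K0.
- exact/filter_uniq/mons_uniq.
- have [_ Bj] := HB (fun=> 0); apply/eqP => e.
  have : tnth (in_tuple L) j \in L' by rewrite mem_filter Bj alj; exact: (mem_tnth j (in_tuple L)).
  by rewrite e.
- by move=> u; rewrite mem_filter => /andP[].
exists x; apply: contra hx => /eqP e; apply/eqP; rewrite -[RHS]e.
have [-> _] := HB (fun u => mon u x); rewrite big_filter big_mkcond; apply: eq_bigr => u _.
by case: eqP => // ->; rewrite mul0r.
Qed.

Section DegeneracyLocus.
Variable K : fieldType.
Hypothesis K0 : forall n, (n.+1%:R : K) != 0.
Variables (C : finType) (p b : nat) (row : C -> option nat).
Variables (ix : C -> {ffun 'I_p -> 'I_b.+1}) (cell : nat -> {ffun 'I_p -> 'I_b.+1} -> C).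
Variables (dm : 'I_p -> nat) (rows : pred nat).
Notation Q := ('I_p * 'I_b.+1)%type.
Implicit Types (kap a : 'I_p -> nat) (u : expo C) (nu : expo Q) (js : seq nat).
Implicit Types (x : C -> K) (y : Q -> K).
Hypothesis dm_b : forall i, (dm i <= b.+1)%N.
Hypothesis cellP : forall j (k : {ffun 'I_p -> 'I_b.+1}), rows j ->
  (forall i, (k i < dm i)%N) -> row (cell j k) = Some j /\ ix (cell j k) = k.
Variable c0 : C.
Hypothesis row_c0 : row c0 = None.

Local Notation sg := (sg ix).
Local Notation valid := (valid dm).
Local Notation Std := (Std cell).
Local Notation Inc := (Inc row ix).
Local Notation NN := (NN cell).
Local Notation Inc_irr := (Inc_irr K0 cellP).
Local Notation polyfun := (@polyfun K C p b).

Definition locus js kap : pset K C := fun x => nonzero x /\ exists y, Inc js kap x y.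

Lemma polyfun_form t f : isform t f -> polyfun (fun x _ => f x).
Proof.
move=> /isformE[B hf]; apply: (@polyfun_ext K C p b (fun x y => \sum_(u <- mons C t) B u * mon u x)).
  by move=> x y; rewrite hf.
by apply: polyfun_sum => u; apply: polyfunM (polyfun_const _) (polyfun_monx _).
Qed.

Lemma Inc_c0 js kap : valid kap -> exists x y, Inc js kap x y /\ x c0 != 0.
Proof.
move=> vk; exists (fun c => (c == c0)%:R), (yall K kap); rewrite eqxx oner_neq0.
split => //; apply: (Inc_yall ix vk) => c j _ rc.
by case: eqP => // e; move: rc; rewrite e row_c0.
Qed.

(** The incidence set also contains pairs with [x = 0]. The coordinate [c0] occurs in no equation,
    so a generic point has [x c0 != 0] and is projective. *)
Lemma locus_point js kap F : all rows js -> valid kap -> polyfun F ->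
  (exists x y, Inc js kap x y /\ F x y != 0) ->
  exists x y, [/\ Inc js kap x y, locus js kap x & F x y != 0].
Proof.
move=> rjs vk pF hF.
have [x [y [I Fxy xc0]]] := Inc_irr rjs vk pF (polyfun_x (b := b) c0) hF (Inc_c0 js vk).
by exists x, y; split => //; split; [exists c0|exists y].
Qed.

Lemma locus_neq0 js kap : valid kap -> exists x, locus js kap x.
Proof.
move=> vk; have [x [y [I h]]] := Inc_c0 js vk.
by exists x; split; [exists c0|exists y].
Qed.

Lemma locus_irr js kap t s f g : all rows js -> valid kap -> isform t f -> isform s g ->
  (exists2 x, locus js kap x & f x != 0) -> (exists2 x, locus js kap x & g x != 0) ->
  exists x, [/\ locus js kap x, f x != 0 & g x != 0].
Proof.
move=> rjs vk ff fg [x1 [_ [y1 I1]] h1] [x2 [_ [y2 I2]] h2].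
have [||x [y [I fx gx]]] := Inc_irr rjs vk (polyfun_form ff) (polyfun_form fg).
- by exists x1, y1.
- by exists x2, y2.
have [||x' [y' [I' L' ]]] := @locus_point js kap (fun x y => f x * g x) rjs vk.
- exact: polyfunM (polyfun_form ff) (polyfun_form fg).
- by exists x, y; rewrite mulf_neq0.
by rewrite mulf_eq0 negb_or => /andP[? ?]; exists x'.
Qed.

(** By duality: if there were more independent forms than standard exponents, some nonzero
    combination of evaluations at separating points would kill all standard monomials, hence by
    [Std_upper] every monomial of bidegree [(t, a)], and then every form of degree [t] times a fixed
    monomial in [y]. *)
Lemma hf_le_NN js kap a t : valid kap -> uniq js -> all rows js ->
  (forall i, (size js < a i)%N) -> (hf (locus js kap) t <= NN js kap a t)%N.
Proof.
move=> vk ujs rjs ha; set M := hf _ t; rewrite leqNgt; apply/negP => lt.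
have [f [ff ind]] := hf_basis (locus js kap) t; rewrite -/M in f ff ind.
(* At these points the monomial in the [y (i, ord0)], used below to pass from forms in [x] to
   bidegree [(t, a)], does not vanish; they suffice by [Inc_irr]. *)
pose Om (w : (C -> K) * (Q -> K)) := Inc js kap w.1 w.2 /\ forall i, w.2 (i, ord0) != 0.
pose n1 : expo Q := [ffun q : Q => (q.2 == ord0) : nat].
have indW (al : 'I_M -> K) : (forall w, Om w -> \sum_j al j * f j w.1 = 0) -> forall j, al j = 0.
  move=> h; apply: ind => x [_ [y I]]; apply/eqP; apply: contraT => nz.
  have [||||x' [y' [I' h' n1']]] := @Inc_irr js kap (fun x y => \sum_j al j * f j x)
     (fun x y => mon n1 y) rjs vk.
  - apply: polyfun_sum => j; apply: polyfunM (polyfun_const _) (polyfun_form (ff j)).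
  - exact: polyfun_mony.
  - by exists x, y.
  - exists (fun=> 0), (yall K kap); split; first exact: (Inc_yall ix vk).
    apply: mon_yall => q; rewrite ffunE; case: eqP => // -> _.
    by have /andP[] := vk q.1.
  suff O' : Om (x', y') by have := h _ O' => /= e; rewrite e eqxx in h'.
  split => // i; apply: contraNneq n1' => yi; apply/eqP.
  by apply: (@mon_eq0 _ _ _ _ (i, ord0)) => //; rewrite ffunE.
have [w [Ow sep]] := indep_points (f := fun j w => f j w.1) indW.
pose L := [seq q <- bexps C b a t | Std js kap q.1 q.2].
have [|B [[l Bl] HB]] := @ker_list K _ M L (fun l q => ev q (w l).1 (w l).2).
  by rewrite size_filter.
pose phi u nu := if (edeg u == t) && qdegs a nu then
  \sum_l B l * ev (u, nu) (w l).1 (w l).2 else 0.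
have phi0 : forall u nu, phi u nu = 0.
  apply: (Std_upper (js := js) (kap := kap) (a := a) (phi := phi) dm_b cellP) => //.
  - move=> u nu j jjs.
    pose ok := (edeg u == t.-1) && (0 < t)%N && [forall i, (qdeg nu i).+1 == a i].
    have okE c : (edeg (eadd u (eX c)) == t) && qdegs a (eadd nu (sg c)) = ok.
      rewrite edegD edegX addn1 /ok; congr (_ && _).
        by case: (t) => [|t'] /=; rewrite ?andbF // eqSS andbT.
      by apply: eq_forallb => i; rewrite qdegD qdeg_sg addn1.
    transitivity (\sum_(c | row c == Some j) if ok then
        \sum_l B l * (ev (u, nu) (w l).1 (w l).2 * ((w l).1 c * mon (sg c) (w l).2)) else 0).
      apply: eq_bigr => c _; rewrite /phi okE; case: ifP => // _.
      by apply: eq_bigr => l' _; rewrite /ev /= !monD monX; ring.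
    case: (ok); last by rewrite big1.
    rewrite exchange_big big1 // => l' _.
    rewrite -big_distrr -big_distrr /=; have [[_ _ /(_ j jjs) e] _] := Ow l'.
    by rewrite /roweqn in e; rewrite e !mulr0.
  - move=> u nu q hq nq; rewrite /phi; case: ifP => // _; apply: big1 => l' _.
    have [[_ /(_ q hq) yq _] _] := Ow l'.
    by rewrite /ev /= (mon_eq0 nq yq) !mulr0.
  - by move=> u nu; rewrite /phi => /negbTE ->; rewrite andbF.
  - move=> u nu hs; rewrite /phi; case: ifP => // hd.
    by apply: (HB (u, nu)); rewrite mem_filter hs mem_bexps.
pose n0 : expo Q := [ffun q : Q => if q.2 == ord0 then a q.1 else 0%N].
have n0d : qdegs a n0.
  apply/qdegsP => i; rewrite /qdeg (bigD1 ord0) //= ffunE /= big1 ?addn0 // => k /negbTE h.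
  by rewrite ffunE /= h.
have n0w l' : mon n0 (w l').2 != 0.
  apply: mon_neq0 => -[i k]; rewrite ffunE /=; case: eqP => // -> _.
  by case: (Ow l') => _; apply.
suff hk k : \sum_l (B l * mon n0 (w l).2) * f k (w l).1 = 0.
  have /eqP := sep (fun l => B l * mon n0 (w l).2) hk l.
  by rewrite mulf_eq0 (negbTE Bl) (negbTE (n0w l)).
have [cf hcf] := isformE (ff k).
under eq_bigr do rewrite hcf big_distrr.
rewrite exchange_big big_seq big1 // => u; rewrite mem_mons => /eqP du /=.
have := phi0 u n0; rewrite /phi du eqxx n0d /= => e.
transitivity (cf u * \sum_l B l * ev (u, n0) (w l).1 (w l).2); last by rewrite e mulr0.
rewrite big_distrr; apply: eq_bigr => l' _ /=.
by rewrite /ev /=; ring.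
Qed.

(** More rows than [mu kap] push the growth of [NN], and so of the Hilbert function, below that of
    the number of all monomials. *)
Lemma vanishing_form js kap : valid kap -> uniq js -> all rows js ->
  (mu kap < size js < #|C|)%N ->
  exists t f, [/\ isform t f, exists x, f x != 0 & forall x, locus js kap x -> f x = 0].
Proof.
move=> vk ujs rjs /andP[lmu lC].
have C0 : (0 < #|C|)%N by apply: leq_trans lC.
have [e [[P [t0 [h1 h2 h3]]] _]] :=
  NN_asym (a := fun=> (size js).+1) dm_b cellP vk ujs rjs (fun=> leqnn _) lC.
have [P' [t1 [k1 k2 k3]]] := asym_binomial #|C|.-1.
have [t lt] : exists t, (hf (locus js kap) t < size (mons C t))%N.
  apply: contrapT => h.
  have le : (size P' <= size P)%N.
    apply: (@poly_ev_le _ _ (maxn t0 t1)) => t; rewrite geq_max => /andP[ht0 ht1].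
    rewrite -h1 // -k1 // ler0n ler_nat -(@size_mons C) ?prednK //=.
    apply: leq_trans (@hf_le_NN js kap _ t vk ujs rjs (fun=> leqnn _)).
    by rewrite leqNgt; apply/negP => lt; apply: h; exists t.
  have sP : (size P <= #|C|.-1)%N.
    by apply: (leq_trans h2); move: lmu lC; clear; move: #|C| (size js) (mu kap) => *; lia.
  have /eqP := k3; rewrite nth_default ?(leq_trans le sP) // mul0r eq_sym.
  by rewrite oner_eq0.
by have [f hf] := form_vanishing_on K0 lt; exists t, f.
Qed.

Lemma locus_form0 js kap t f x y : isform t.+1 f -> (forall x, locus js kap x -> f x = 0) ->
  Inc js kap x y -> f x = 0.
Proof.
move=> ff h I; have [nx|z] := pselect (nonzero x); first by apply: h; split => //; exists y.
have -> : x = (fun c => 0 * x c).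
  apply: funext => c; rewrite mul0r; apply/eqP; apply: contraT => xc.
  by case: z; exists c.
by rewrite (isform_scale _ _ ff) expr0n mul0r.
Qed.

(* The gradient, along one row, of a form of minimal degree vanishing on the
   locus is proportional to the tensor y that witnesses membership.  *)
Lemma conductor js kap : valid kap -> uniq js -> all rows js ->
  (mu kap < size js < #|C|)%N ->
  exists s (D : C -> (C -> K) -> K) j c, [/\ forall c', isform s (D c'), j \in js,
    row c = Some j, exists x y, Inc js kap x y /\ D c x != 0 &
    forall c' x y, row c' = Some j -> Inc js kap x y ->
      mon (sg c) y * D c' x = mon (sg c') y * D c x].
Proof.
move=> vk ujs rjs lmu.
pose van t f := [/\ isform t f, exists x, f x != 0 & forall x, locus js kap x -> f x = 0].
have exP : exists t, `[< exists f, van t f >].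
  by have [t [f h]] := vanishing_form vk ujs rjs lmu; exists t; apply/asboolP; exists f.
case: (ex_minnP exP) => -[|s] /asboolP[f [ff [x0 fx0] fv]] smin.
  have [x Yx] := locus_neq0 js vk.
  by move: fx0; rewrite (isform0_const x0 x ff) fv ?eqxx.
have [D [Df De Dt]] := diffform_exists ff.
(* If a whole line stays in the locus, the form vanishes along it, hence so does its linear
   coefficient. *)
have tangent x y v c' : (forall r, exists y, Inc js kap (fun c => x c + r * v c) y) ->
    Inc js kap x y -> \sum_c v c * D c x = c' -> c' = 0.
  move=> h I <-; have [P hP] := Dt x v; apply: (lin_coef_zero K0 (P := P)) => r.
  have [y' I'] := h r; have := hP r; rewrite (locus_form0 ff fv I') (locus_form0 ff fv I).
  by rewrite add0r => <-.
(* Euler's identity gives a nonzero partial derivative; having smaller degree, it cannot vanish on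
   the locus. *)
have [c [xc [Yxc Dc]]] : exists c x, locus js kap x /\ D c x != 0.
  apply: contrapT => h.
  have [c Dc] : exists c, D c x0 != 0.
    apply: contrapT => h2; have := De x0; rewrite big1 => [/esym/eqP|c _].
      by rewrite mulf_eq0 (negbTE (K0 _)) (negbTE fx0).
    rewrite (_ : D c x0 = 0) ?mulr0 //; apply/eqP; apply: contraT => Dc.
    by case: h2; exists c.
  have := smin s; rewrite ltnn => H; suff: false by []; apply: H.
  apply/asboolP; exists (D c); split => //; first by exists x0.
  move=> x Yx; apply/eqP; apply: contraT => Dx; case: h; by exists c, x.
have [nxc [yc Ic]] := Yxc.
(* A coordinate outside the rows can be moved freely, which would make its partial derivative vanish
   at [xc]. *)
have [j [jjs rc]] : exists j, j \in js /\ row c = Some j.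
  apply: contrapT => h; case/eqP: Dc.
  apply: (tangent xc yc (fun c' => (c' == c)%:R)) => //.
    move=> r; exists yc; have [i1 i2 i3] := Ic; split => // j jjs.
    rewrite -[RHS](i3 j jjs); apply: eq_bigr => c' /eqP rc'; congr (_ * _).
    case: eqP => [e|_]; last by rewrite mulr0 addr0.
    by case: h; exists j; rewrite -e.
  by have := sum_delta (D^~ xc) c 1; under eq_bigr do rewrite mulr1 mulrC; rewrite mulr1.
exists s, D, j, c; split => //; first by exists xc, yc.
move=> c' x y rc' I; apply/eqP; rewrite -subr_eq0; apply/eqP.
(* This direction is orthogonal to the tensor in row [j] and leaves the other rows unchanged. *)
apply: (tangent x y (fun d => (d == c')%:R * mon (sg c) y - (d == c)%:R * mon (sg c') y)) => //.
  move=> r; exists y; have [i1 i2 i3] := I; split => // j' j'js.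
  rewrite -[RHS](i3 j' j'js) /roweqn; under eq_bigr do rewrite mulrDl -mulrA.
  rewrite big_split -big_distrr /=; set S := (X in _ + _ * X).
  suff -> : S = 0 by rewrite mulr0 addr0.
  rewrite /S; under eq_bigr do rewrite mulrBl.
  rewrite sumrB; have [jj'|nj] := eqVneq j j'.
    rewrite (bigD1 c') ?rc' ?jj' //= eqxx mul1r big1 => [|d /andP[_ /negbTE ->]]; last by rewrite !mul0r.
    rewrite (bigD1 c) ?rc ?jj' //= eqxx mul1r big1 => [|d /andP[_ /negbTE ->]]; last by rewrite !mul0r.
    by rewrite !addr0 mulrC subrr.
  rewrite !big1 ?subrr // => d /eqP rd; case: eqP => [e|_]; rewrite ?mul0r //.
    by move: rd nj; rewrite e rc => -[->]; rewrite eqxx.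
  by move: rd nj; rewrite e rc' => -[->]; rewrite eqxx.
under eq_bigr do rewrite mulrBl; rewrite sumrB.
by congr (_ - _); rewrite [RHS]mulrC -[RHS](sum_delta (D^~ x)); apply: eq_bigr => d _; ring.
Qed.

(** Up to a common factor for each player, the coordinates of [y] are the partial derivatives [G] of
    the form from [conductor]. Substituting them turns the standard monomials of bidegree [(t, a)]
    into forms of degree [t + k] in [x], and [Std_indep] keeps these independent. *)
Lemma NN_le_hf js kap a : valid kap -> uniq js -> all rows js ->
  (mu kap < size js < #|C|)%N ->
  exists k, forall t, (NN js kap a t <= hf (locus js kap) (t + k))%N.
Proof.
move=> vk ujs rjs lmu.
have [s [D [j [c [Df jjs rc [xc [yc [Ic Dc]]] prop]]]]] := conductor vk ujs rjs lmu.
have rj := allP rjs _ jjs.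
have ixk x y : Inc js kap x y -> mon (sg c) y != 0 -> forall i, (ix c i < kap i)%N.
  move=> [_ i2 _] sc i; rewrite ltnNge; apply: contra sc => h; apply/eqP.
  by apply: (@mon_eq0 _ _ _ _ (i, ix c i)); [rewrite ffunE /= eqxx|apply: i2].
have [c2 rc2 sc2] := sg_cell_neq0 cellP rj vk Ic.
have sc : mon (sg c) yc != 0.
  by have := mulf_neq0 sc2 Dc; rewrite -(prop c2 xc yc) // mulf_eq0 negb_or => /andP[].
have ixc := ixk _ _ Ic sc.
(* Changing one index of [c] to [q.2] compares [y q] with [y (q.1, ix c q.1)] inside the same
   row. *)
pose mv (q : Q) := cell j [ffun i => if i == q.1 then q.2 else ix c i].
pose G (q : Q) x := if (q.2 < kap q.1)%N then D (mv q) x else 0.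
have mvP (q : Q) : (q.2 < kap q.1)%N -> row (mv q) = Some j /\
    ix (mv q) = [ffun i => if i == q.1 then q.2 else ix c i].
  move=> hq; apply: cellP => // i; have /andP[_ le] := vk i; apply: leq_trans le.
  by rewrite ffunE; case: eqP => [->|_].
have GE (q : Q) x y : Inc js kap x y -> mon (sg c) y != 0 ->
    G q x = y q * (D c x / y (q.1, ix c q.1)).
  move=> I s0; rewrite /G; case: ltnP => hq; last first.
    by have [_ i2 _] := I; rewrite (i2 q hq) mul0r.
  have [rm im] := mvP q hq; have := prop _ x y rm I.
  have yi : y (q.1, ix c q.1) != 0.
    apply: contraNneq s0 => e; apply/eqP; apply: mon_eq0 e.
    by rewrite ffunE /= eqxx.
  have smv : mon (sg (mv q)) y * y (q.1, ix c q.1) = mon (sg c) y * y q.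
    rewrite -[y (q.1, ix c q.1)]monX -[y q]monX -!monD.
    apply: (congr1 (fun n => mon n y)); apply/ffunP => -[i l]; rewrite !ffunE /= im ffunE (surjective_pairing q) !xpair_eqE /=.
    by case: (eqVneq i q.1) => [->|_]; rewrite ?addn0 //= addnC.
  move=> e; apply: (mulfI s0); rewrite e [RHS]mulrA -smv; field.
  exact: yi.
have Gf (q : Q) : isform s (G q) by rewrite /G; case: (q.2 < kap q.1)%N; [apply: Df|apply: isform0].
have GnuE nu x y : Inc js kap x y -> mon (sg c) y != 0 -> qdegs a nu ->
    \prod_q G q x ^+ nu q = mon nu y * \prod_i (D c x / y (i, ix c i)) ^+ a i.
  move=> I s0 /qdegsP dn; under eq_bigr do rewrite (GE _ x y) // exprMn.
  rewrite big_split /=; congr (_ * _).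
  transitivity (\prod_i \prod_k (D c x / y (i, ix c i)) ^+ nu (i, k)).
    by rewrite pair_bigA; apply: eq_bigr => -[].
  by apply: eq_bigr => i _; rewrite prodrXr -dn.
pose k := (s * \sum_i a i)%N; exists k => t.
pose L := [seq q <- bexps C b a t | Std js kap q.1 q.2].
have uL : uniq L by apply/filter_uniq/bexps_uniq.
have -> : NN js kap a t = size L by rewrite size_filter.
pose g (l : 'I_(size L)) x := let q := tnth (in_tuple L) l in
  mon q.1 x * \prod_r G r x ^+ q.2 r.
apply: (hf_ge (f := g)).
  move=> l; have : tnth (in_tuple L) l \in L := mem_tnth l (in_tuple L).
  rewrite mem_filter mem_bexps => /andP[_ /andP[/eqP dt /qdegsP dn]]; rewrite /g /=.
  rewrite -dt; apply: isformM; first exact: isform_mon.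
  set nu := (tnth _ _).2 in dn *.
  have -> : k = (\sum_r s * nu r)%N.
    by rewrite -big_distrr /= -/(edeg nu) edeg_qdeg; congr (_ * _)%N; apply: eq_bigr.
  by apply: isform_prod => r; apply: isformX.
move=> al hal l; apply/eqP; apply: contraT => all0.
have [B HB] := tuple_coef al uL.
pose L' := [seq q <- L | B q != 0].
have [||q|x [y [I hxy]]] := Std_indep K0 dm_b cellP (L := L') (B := B) vk ujs rjs.
- exact/filter_uniq.
- have [_ Bj] := HB (fun=> 0); apply/eqP => e.
  have : tnth (in_tuple L) l \in L' by rewrite mem_filter Bj all0; exact: (mem_tnth l (in_tuple L)).
  by rewrite e.
- by rewrite mem_filter mem_filter => /andP[-> /andP[]].
have pF : polyfun (fun x y => \sum_(q <- L') B q * ev q x y).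
  apply: polyfun_sum => q; apply: polyfunM (polyfun_const _) _.
  exact: polyfunM (polyfun_monx _) (polyfun_mony _).
have pG : polyfun (fun x y => mon (sg c) y * D c x).
  exact: polyfunM (polyfun_mony _) (polyfun_form (Df c)).
have [||x1 [y1 [I1 F1 G1]]] := Inc_irr rjs vk pF pG.
- by exists x, y.
- by exists xc, yc; split => //; rewrite mulf_neq0.
have [||x2 [y2 [I2 L2 FG]]] := @locus_point js kap
   (fun x y => (\sum_(q <- L') B q * ev q x y) * (mon (sg c) y * D c x)) rjs vk.
- exact: polyfunM pF pG.
- by exists x1, y1; split => //; rewrite mulf_neq0.
move: FG; rewrite !mulf_eq0 !negb_or => /and3P[F2 s2 D2].
(* The factor produced by the substitution depends on the [y]-degree only, so it is common to all
   terms. *)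
pose W := \prod_i (D c x2 / y2 (i, ix c i)) ^+ a i.
have W0 : W != 0.
  apply/prodf_neq0 => i _; apply: expf_neq0; rewrite mulf_neq0 // invr_eq0.
  apply: contraNneq s2 => e; apply/eqP; apply: mon_eq0 e.
  by rewrite ffunE /= eqxx.
have [eB _] := HB (fun q => mon q.1 x2 * \prod_r G r x2 ^+ q.2 r).
have E : (\sum_(q <- L') B q * ev q x2 y2) * W =
    \sum_(q <- L) B q * (mon q.1 x2 * \prod_r G r x2 ^+ q.2 r).
  rewrite big_distrl /= big_filter big_mkcond; apply: eq_big_seq => q.
  rewrite mem_filter mem_bexps => /andP[_ /andP[_ dn]].
  case: eqP => [->|_] /=; first by rewrite mul0r.
  by rewrite (GnuE _ x2 y2) // /ev /W; ring.
by have := mulf_neq0 F2 W0; rewrite E -eB (hal x2 L2) eqxx.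
Qed.

Definition locus_dim kap (l : nat) := (#|C|.-1 - (l - mu kap))%N.

Lemma locus_hilbert js kap : valid kap -> uniq js -> all rows js ->
  (mu kap < size js < #|C|)%N ->
  exists (P : {poly rat}) t0 (e : nat),
  [/\ forall t, (t0 <= t)%N -> (hf (locus js kap) t)%:R = P.[t%:R],
      size P = (locus_dim kap (size js)).+1,
      lead_coef P * ((locus_dim kap (size js))`!)%:R = e%:R &
     (e * (\prod_i (kap i).-1`! * (size js - mu kap)`!) = (size js)`!)%N].
Proof.
move=> vk ujs rjs lmu; have /andP[lm lC] := lmu.
have [e [[P [t0 [h1 h2 h3]]] he]] :=
  (* The least [y]-degree for which [hf_le_NN] applies; [e] is fixed by the multinomial identity. *)
  NN_asym (a := fun=> (size js).+1) dm_b cellP vk ujs rjs (fun=> leqnn _) lC.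
have {}he := he (ltnW lm).
have [k hk] := NN_le_hf (fun=> (size js).+1) vk ujs rjs lmu.
have [H [t1 hH]] := hf_evpoly (locus js kap).
rewrite -/(locus_dim kap (size js)) in h2 h3; set d := locus_dim kap (size js) in h2 h3 *.
have e0 : (0 < e)%N by rewrite lt0n; apply: contraTneq (fact_gt0 (size js)) => e0; rewrite -he e0.
have sP : size P = d.+1.
  apply/eqP; rewrite eqn_leq h2 ltnNge; apply/negP => le.
  by move: h3; rewrite nth_default // mul0r => /esym/eqP; rewrite pnatr_eq0 eqn0Ngt e0.
have P0 : P != 0 by rewrite -size_poly_eq0 sP.
have [|sH lH] := @poly_squeeze H P k%:R (maxn t1 (t0 + k)) _ P0.
  move=> t; rewrite geq_max => /andP[ht1 ht0].
  have kt : (k <= t)%N by apply: leq_trans ht0; rewrite leq_addl.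
  have tk : (t0 <= t - k)%N by rewrite leq_subRL // addnC.
  rewrite -natrB // -(h1 _ tk) -(h1 t) ?(leq_trans tk (leq_subr _ _)) //.
  rewrite -hH // !ler_nat; apply/andP; split.
    by rewrite -{2}(subnK kt).
  by apply: hf_le_NN.
exists H, t1, e; split => //; first by rewrite sH.
by rewrite lH lead_coefE sP -h3.
Qed.

End DegeneracyLocus.

(** * Chains of irreducible sets *)

Section Chains.
Variables (K : fieldType) (C : finType).
Implicit Types (Y Z W : pset K C) (x : C -> K) (f g : (C -> K) -> K).

(** Irreducibility tested on hypersurfaces: two nonempty open sets given by forms meet. This passes
    between a set and its closure. *)
Definition form_irr Y := forall t s f g, isform t f -> isform s g ->
  (exists2 x, Y x & f x != 0) -> (exists2 x, Y x & g x != 0) ->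
  exists x, [/\ Y x, f x != 0 & g x != 0].

Lemma pirreducible_forms Y : (exists x, Y x) -> form_irr Y -> pirreducible Y.
Proof.
move=> Y0 irr; split => // A B [FA [hA eA]] [FB [hB eB]] sub.
have wit (A' : pset K C) FA' : (forall x, A' x <-> nonzero x /\ (forall q, FA' q -> peval q x = 0)) ->
    ~ psubset Y A' -> (forall x, Y x -> nonzero x) ->
    exists2 q, FA' q & exists2 x, Y x & peval q x != 0.
  move=> e ns nz; apply: contrapT => h; apply: ns => x Yx; apply/e; split; first exact: nz.
  move=> q Fq; apply/eqP; apply: contraT => qx; case: h; exists q => //; by exists x.
have nz x : Y x -> nonzero x by move=> /sub[/eA[]|/eB[]].
apply: contrapT => /not_orP[nA nB].
have [pA FpA wA] := wit _ _ eA nA nz; have [pB FpB wB] := wit _ _ eB nB nz.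
have [tA hpA] := hA _ FpA; have [tB hpB] := hB _ FpB.
have [x [Yx Ax Bx]] := irr _ _ _ _ (isform_peval hpA) (isform_peval hpB) wA wB.
case: (sub x Yx) => [/eA[_ /(_ _ FpA) e]|/eB[_ /(_ _ FpB) e]].
  by rewrite e eqxx in Ax.
by rewrite e eqxx in Bx.
Qed.

Lemma pclosed_form t f : isform t f -> pclosed (fun x => nonzero x /\ f x = 0).
Proof.
move=> [p [hp fp]]; exists (fun q => q = p); split; first by move=> _ ->; exists t.
by move=> x; split=> [[nx e]|[nx e]]; split => //; [move=> _ ->; rewrite -fp|rewrite fp e].
Qed.

Lemma forms_pirreducible Y : (forall x, Y x -> nonzero x) -> pirreducible Y -> form_irr Y.
Proof.
move=> nz [_ irr] t s f g ff fg [x1 Y1 f1] [x2 Y2 g2]; apply: contrapT => h.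
have [] := irr _ _ (pclosed_form ff) (pclosed_form fg).
- move=> x Yx; have [fx|fx] := eqVneq (f x) 0; first by left; split => //; apply: nz.
  have [gx|gx] := eqVneq (g x) 0; first by right; split => //; apply: nz.
  by case: h; exists x.
- by move=> /(_ _ Y1)[_ e]; rewrite e eqxx in f1.
- by move=> /(_ _ Y2)[_ e]; rewrite e eqxx in g2.
Qed.

Lemma hf_mono Y Z t : psubset Y Z -> (hf Y t <= hf Z t)%N.
Proof.
move=> sub; have [f [ff ind]] := hf_basis Y t.
by apply: (hf_ge ff) => al h; apply: ind => x /sub; apply: h.
Qed.

Lemma hf_gt0 Y t : (exists2 x, Y x & nonzero x) -> (0 < hf Y t)%N.
Proof.
move=> [x Yx [c xc]]; apply: (@hf_ge _ _ Y t 1 (fun _ x => x c ^+ t)) => [_|al h j].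
  by have := isformX t (isform_coord K c); rewrite mul1n.
have /eqP := h x Yx; rewrite big_ord1 mulf_eq0 expf_eq0 (negbTE xc) andbF orbF.
by rewrite (ord1 j) => /eqP.
Qed.

(* Multiplication by a form vanishing on Z but not on the irreducible Y is
   injective on functions on Y. *)
Lemma hf_add Y Z t s f : form_irr Y -> isform s f -> psubset Z Y ->
  (forall x, Z x -> f x = 0) -> (exists2 x, Y x & f x != 0) ->
  (hf Z (t + s) + hf Y t <= hf Y (t + s))%N.
Proof.
move=> irr ff sub fz fy.
have [a [af aind]] := hf_basis Z (t + s); have [c [cf cind]] := hf_basis Y t.
pose g (j : 'I_(hf Z (t + s) + hf Y t)) x :=
  match split j with inl k => a k x | inr k => c k x * f x end.
apply: (hf_ge (f := g)) => [j|al h].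
  rewrite /g; case: (split j) => k; first exact: af.
  exact: isformM (cf k) ff.
have sumE x : \sum_j al j * g j x = \sum_k al (lshift _ k) * a k x +
    (\sum_k al (rshift _ k) * c k x) * f x.
  rewrite big_split_ord big_distrl; congr (_ + _); apply: eq_bigr => k _ /=.
    by rewrite /g; case: split_ordP => k' /eqP; rewrite eq_shift // => /eqP ->.
  by rewrite /g; case: split_ordP => k' /eqP; rewrite eq_shift // => /eqP ->; rewrite mulrA.
have a0 k : al (lshift _ k) = 0.
  apply: (aind (fun k => al (lshift _ k))) => x Zx.
  by have := h x (sub _ Zx); rewrite sumE fz // mulr0 addr0.
have c0 k : al (rshift _ k) = 0.
  apply: (cind (fun k => al (rshift _ k))) => x Yx; apply/eqP; apply: contraT => nz.
  have [||x' [Yx' f' c']] := irr s t f (fun x => \sum_k al (rshift _ k) * c k x) ff _ fy.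
  - by apply: isform_sum => k' _; apply: isformZ.
  - by exists x.
  have := h x' Yx'; rewrite sumE big1 => [|k' _]; last by rewrite a0 mul0r.
  by rewrite add0r => /eqP; rewrite mulf_eq0 (negbTE f') (negbTE c').
by move=> j; rewrite -(splitK j); case: (split j) => k; [exact: a0|exact: c0].
Qed.

(** A form of degree [s] separating consecutive members bounds the smaller Hilbert function at [t]
    by the difference of the larger one between [t] and [t - s], whose degree is smaller. So the
    size of the Hilbert polynomial grows at every step. *)
Lemma chain_bound Y r Zc (P : {poly rat}) t0 : pchain Y r Zc ->
  (forall t, (t0 <= t)%N -> (hf Y t)%:R = P.[t%:R]) -> (r < size P)%N.
Proof.
move=> [h1 h2] hP.
have nz j x : (j <= r)%N -> Zc j x -> nonzero x.
  by move=> /h1[[A [[F [_ eA]] eZ]] _] /eZ[_ /eA[]].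
have /choice[Pj HPj] : forall j, exists P : {poly rat}, exists t0, forall t, (t0 <= t)%N ->
    (hf (Zc j) t)%:R = P.[t%:R] by move=> j; have [H hH] := hf_evpoly (Zc j); exists H.
have ne j : (j <= r)%N -> exists2 x, Zc j x & nonzero x.
  by move=> jr; have [_ [[x Zx] _]] := h1 j jr; exists x => //; apply: nz Zx.
have Pn0 j : (j <= r)%N -> Pj j != 0.
  move=> jr; have [t1 ht] := HPj j; apply/eqP => e.
  have := ht t1 (leqnn _); rewrite e horner0 => /eqP; rewrite pnatr_eq0.
  by rewrite eqn0Ngt (hf_gt0 t1 (ne j jr)).
have st j : (j <= r)%N -> (j < size (Pj j))%N.
  elim: j => [|j IH] jr; first by rewrite lt0n size_poly_eq0 Pn0.
  have /IH lt := ltnW jr; have [sub [x [Zx nZx]]] := h2 j jr.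
  have [[A [[F [hF eA]] eZ]] irrj] := h1 j (ltnW jr).
  have [[A' [_ eZ']] irrj'] := h1 j.+1 jr.
  have [q Fq qx] : exists2 q, F q & peval q x != 0.
    apply: contrapT => h; apply: nZx; apply/eZ; split; first by case/eZ': Zx.
    apply/eA; split; first exact: nz Zx.
    by move=> q Fq; apply/eqP; apply: contraT => qx; case: h; exists q.
  have [s hq] := hF q Fq; have fq := isform_peval hq.
  have q0 z : Zc j z -> peval q z = 0 by move=> /eZ[_ /eA[_ ->]].
  have irr' := forms_pirreducible (fun x => @nz j.+1 x jr) irrj'.
  have [t1 ht1] := HPj j; have [t2 ht2] := HPj j.+1.
  apply: leq_ltn_trans lt (leq_ltn_trans _ (size_diff s%:R (Pn0 _ jr))).
  apply: (@poly_ev_le _ _ (maxn t1 (t2 + s))) => t; rewrite geq_max => /andP[tt1 tt2].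
  have ts : (s <= t)%N by apply: leq_trans tt2; rewrite leq_addl.
  have t2s : (t2 <= t - s)%N by rewrite leq_subRL // addnC.
  rewrite hornerD hornerN horner_comp_XsubC -natrB // -ht1 // -(ht2 _ t2s).
  rewrite -(ht2 t) ?(leq_trans t2s (leq_subr _ _)) // ler0n /= lerBrDr -natrD ler_nat.
  have := hf_add (t - s) irr' fq sub q0; rewrite subnK //; apply.
  by exists x.
apply: leq_trans (st r (leqnn _)) _; have [t1 ht1] := HPj r.
apply: (@poly_ev_le _ _ (maxn t0 t1)) => t; rewrite geq_max => /andP[tt0 tt1].
rewrite -ht1 // -hP // ler0n ler_nat; apply: hf_mono => x.
by have [[A [_ eZ]] _] := h1 r (leqnn _) => /eZ[].
Qed.

(** A basis of forms on [Z] is too large to stay independent on [Y]. *)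
Lemma separating_form Y Z t : (hf Y t < hf Z t)%N ->
  exists f, [/\ isform t f, forall x, Y x -> f x = 0 & exists2 x, Z x & f x != 0].
Proof.
move=> lt; have [g [gf ind]] := hf_basis Z t.
have [al [hal [j alj]]] : exists al : 'I_(hf Z t) -> K,
    (forall x, Y x -> \sum_j al j * g j x = 0) /\ exists j, al j != 0.
  apply: contrapT => h; move: lt; rewrite ltnNge (hf_ge gf) // => al hal j.
  by apply/eqP; apply: contraT => alj; case: h; exists al; split => //; exists j.
exists (fun x => \sum_j al j * g j x); split => //.
  by apply: isform_sum => k _; apply: isformZ.
apply: contrapT => h; case/eqP: alj; apply: ind => x Zx; apply/eqP; apply: contraT => nx.
by case: h; exists x.
Qed.

(* The chain consists of the closures in Y of the W j. *)
Lemma chain_exists Y r (W : nat -> pset K C) :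
  (forall x, Y x -> nonzero x) ->
  (forall j, (j <= r)%N -> [/\ psubset (W j) Y, exists x, W j x & form_irr (W j)]) ->
  (forall j, (j < r)%N -> psubset (W j) (W j.+1) /\ exists t f,
     [/\ isform t f, forall x, W j x -> f x = 0 & exists2 x, W j.+1 x & f x != 0]) ->
  exists Z : nat -> pset K C, pchain Y r Z.
Proof.
move=> nz hW hs; pose van j (q : cpoly K C) := homog q /\ forall x, W j x -> peval q x = 0.
pose Z j x := Y x /\ forall q, van j q -> peval q x = 0.
have WZ j : (j <= r)%N -> psubset (W j) (Z j).
  by move=> /hW[sub _ _] x Wx; split; [exact: sub|move=> q [_]; apply].
exists Z; split=> j jr.
  have [sub [x Wx] irr] := hW j jr; split.
    exists (fun x => nonzero x /\ forall q, van j q -> peval q x = 0); split.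
      by exists (van j); split => // q [].
    by move=> z; split=> [[Yz h]|[Yz [_ h]]]; split => //; split => //; apply: nz.
  apply: pirreducible_forms; first by exists x; apply: WZ.
  have wit t f : isform t f -> (exists2 z, Z j z & f z != 0) -> exists2 z, W j z & f z != 0.
    move=> [q [hq fq]] [z [Yz hz] fz]; apply: contrapT => h; move: fz.
    rewrite fq hz ?eqxx //; split; first by exists t.
    by move=> w Ww; rewrite -fq; apply/eqP; apply: contraT => fw; case: h; exists w.
  move=> t s f g ff fg wf wg.
  have [w [Ww fw gw]] := irr _ _ _ _ ff fg (wit _ _ ff wf) (wit _ _ fg wg).
  by exists w; split => //; apply: WZ.
have [sub [t [f [[q [hq fq]] f0 [w Ww fw]]]]] := hs j jr; split.
  move=> z [Yz hz]; split => // p [hp pz]; apply: hz; split => // x Wx.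
  exact/pz/sub.
exists w; split; first exact: WZ.
move=> [_ /(_ q) h]; move: fw; rewrite fq h ?eqxx //; split; first by exists t.
by move=> x Wx; rewrite -fq f0.
Qed.

Lemma coord_subspace_irr (S : pred C) : (forall n, (n.+1%:R : K) != 0) ->
  form_irr (fun x => nonzero x /\ forall c, ~~ S c -> x c = 0).
Proof.
move=> K0 t s f g ff fg [x1 [[c xc] S1] f1] [x2 [_ S2] g2].
pose ga c : {poly K} := (x1 c)%:P + 'X * (x2 c - x1 c)%:P.
have ga0 : (fun c => (ga c).[0]) = x1.
  by apply: funext => c'; rewrite /ga hornerD hornerM hornerX !hornerC mul0r addr0.
have ga1 : (fun c => (ga c).[1]) = x2.
  by apply: funext => c'; rewrite /ga hornerD hornerM hornerX !hornerC mul1r addrC subrK.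
(* With [p := 0] the second family of variables is empty. *)
have [PF hF] := polyfun_form (p := 0) (b := 0) ff ga (fun=> 0).
have [PG hG] := polyfun_form (p := 0) (b := 0) fg ga (fun=> 0).
have PF0 : PF != 0 by apply: contra f1 => /eqP e; rewrite -ga0 hF e horner0.
have PG0 : PG != 0 by apply: contra g2 => /eqP e; rewrite -ga1 hG e horner0.
have c0 : ga c != 0.
  by apply: contra xc => /eqP e; rewrite -[x1 c]/((fun c => x1 c) c) -ga0 e horner0.
have [|n] := @poly_nonroot K K0 (PF * PG * ga c); first by rewrite !mulf_neq0.
rewrite !hornerM !mulf_eq0 !negb_or -andbA => /and3P[nF nG nc].
exists (fun c => (ga c).[n%:R]); split; rewrite ?hF ?hG //; split; first by exists c.
by move=> c' /[dup] /S1 e1 /S2 e2; rewrite /ga e1 e2 hornerD hornerM hornerX !hornerC subrr mulr0 addr0.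
Qed.

Variables (L L' : (C -> K) -> C -> K).
Hypothesis Lf : forall c, isform 1 (fun x => L x c).
Hypothesis Lf' : forall c, isform 1 (fun x => L' x c).
Hypothesis LK : cancel L L'.
Hypothesis LK' : cancel L' L.

Lemma isform_comp t f : isform t f -> isform t (fun x => f (L x)).
Proof. by move=> ff; exact: (isform_linear ff Lf). Qed.

Lemma isform_comp' t f : isform t f -> isform t (fun x => f (L' x)).
Proof. by move=> ff; exact: (isform_linear ff Lf'). Qed.

Lemma hf_linear Y t : hf (fun x => Y (L x)) t = hf Y t.
Proof.
apply/eqP; rewrite eqn_leq; apply/andP; split.
  have [f [ff ind]] := hf_basis (fun x => Y (L x)) t.
  apply: (hf_ge (f := fun j x => f j (L' x))) => [j|al h]; first exact: isform_comp'.
  by apply: ind => x /h; under eq_bigr do rewrite LK.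
have [f [ff ind]] := hf_basis Y t.
apply: (hf_ge (f := fun j x => f j (L x))) => [j|al h]; first exact: isform_comp.
apply: ind => x Yx; have := h (L' x); under eq_bigr do rewrite LK'.
by apply; rewrite LK'.
Qed.

Lemma form_irr_linear Y : form_irr Y -> form_irr (fun x => Y (L x)).
Proof.
move=> irr t s f g ff fg [x1 Y1 f1] [x2 Y2 f2].
have [||x [Yx fx gx]] := irr _ _ _ _ (isform_comp' ff) (isform_comp' fg).
- by exists (L x1); rewrite ?LK.
- by exists (L x2); rewrite ?LK.
by exists (L' x); rewrite LK'.
Qed.

Lemma nonzero_linear x : nonzero (L x) <-> nonzero x.
Proof.
have aux (M : (C -> K) -> C -> K) z : (forall c, isform 1 (fun x => M x c)) ->
    nonzero (M z) -> nonzero z.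
  move=> Mf [c Mc]; apply: contrapT => nz.
  have z0 : z = (fun c' => 0 * z c').
    apply: funext => c'; rewrite mul0r; apply/eqP; apply: contraT => zc.
    by case: nz; exists c'.
  by move: Mc; rewrite z0 (isform_scale _ _ (Mf c)) expr1 mul0r eqxx.
split; first exact: aux Lf.
by move=> nx; apply: (aux L' _ Lf'); rewrite LK.
Qed.

End Chains.

(** * The resultant variety as a degeneracy locus *)

Section NashCoordinates.
Variables (K : fieldType) (q : nat) (d : nat -> nat).
Hypothesis hd : forall i, (i < q.+1)%N -> (2 <= d i)%N.
Notation C := (gcoord q.+1 d).
Notation lst := (@ord_max q).

Lemma dpos (l : 'I_q.+1) : (0 < d l)%N.
Proof. exact/ltnW/hd. Qed.

Definition mkd (l : 'I_q.+1) (m : nat) : 'I_(d l) := insubd (Ordinal (dpos l)) m.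
Definition wd (i : 'I_q) : 'I_q.+1 := widen_ord (leqnSn q) i.
(** A common index range for the strategies of all players but the last; [Inc] forces the surplus
    coordinates of [y] to be 0. *)
Definition dbd := (\max_(i < q) d i)%N.
Notation b := dbd.
Definition sv (s : profile q.+1 d) (l : 'I_q.+1) : nat := s l.
Definition mkp (F : 'I_q.+1 -> nat) : profile q.+1 d := [ffun l : 'I_q.+1 => mkd l (F l)].
(** The first strategy of the last player has no row: its payoffs are subtracted from the others.
    Payoffs of the other players have none either. *)
Definition nrow (c : C) : option nat :=
  if (c.1 == lst) && (0 < sv c.2 lst)%N then Some (sv c.2 lst) else None.
Definition nix (c : C) : {ffun 'I_q -> 'I_b.+1} := [ffun i => inord (sv c.2 (wd i))].
Definition nrows : pred nat := fun j => (0 < j < d q)%N.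
Definition kext (k : {ffun 'I_q -> 'I_b.+1}) (l : nat) : nat :=
  oapp (fun i : 'I_q => k i : nat) 0%N (insub l).
Definition ncell (j : nat) (k : {ffun 'I_q -> 'I_b.+1}) : C :=
  (lst, mkp (fun l => if l == lst then j else kext k l)).
Definition ndm (i : 'I_q) : nat := d i.
Definition setl (s : profile q.+1 d) (m : nat) : profile q.+1 d :=
  mkp (fun l => if l == lst then m else sv s l).

Lemma sv_lt s l : (sv s l < d l)%N.
Proof. exact: ltn_ord. Qed.

Lemma sv_mkp (F : 'I_q.+1 -> nat) (l : 'I_q.+1) : (F l < d l)%N -> sv (mkp F) l = F l.
Proof. by move=> h; rewrite /sv /mkp ffunE /mkd insubdK. Qed.

Lemma sv_inj s s' : (forall l, sv s l = sv s' l) -> s = s'.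
Proof. by move=> h; apply/ffunP => l; apply: val_inj; apply: h. Qed.

Lemma ndm_b i : (ndm i <= b.+1)%N.
Proof. by apply: leqW; apply: (leq_bigmax (F := fun i : 'I_q => d i)). Qed.

Lemma wd_lst i : (wd i == lst) = false.
Proof. by apply/eqP => /(congr1 val) /= e; have := ltn_ord i; rewrite e ltnn. Qed.

Lemma lst_or_wd (l : 'I_q.+1) : l = lst \/ exists i, l = wd i.
Proof.
have [->|mn] := eqVneq l lst; [by left|right].
have mq : (l < q)%N.
  by rewrite ltn_neqAle -ltnS ltn_ord andbT; apply: contra mn => /eqP h; apply/eqP/val_inj.
by exists (Ordinal mq); apply: val_inj.
Qed.

Lemma kext_wd k i : kext k (wd i) = k i.
Proof. by rewrite /kext insubT //= => h; congr (nat_of_ord (k _)); apply: val_inj. Qed.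

Lemma sv_nix c i : nix c i = sv c.2 (wd i) :> nat.
Proof. by rewrite ffunE inordK // (leq_trans (sv_lt _ _)) //; apply: (ndm_b i). Qed.

Lemma sv_setl_lst s m : (m < d q)%N -> sv (setl s m) lst = m.
Proof. by move=> h; rewrite sv_mkp eqxx. Qed.

Lemma sv_setl_wd s m i : sv (setl s m) (wd i) = sv s (wd i).
Proof. by rewrite sv_mkp wd_lst //; apply: sv_lt. Qed.

Lemma nrowE c j : (nrow c == Some j) = [&& c.1 == lst, (0 < j)%N & sv c.2 lst == j].
Proof.
rewrite /nrow; case: (c.1 == lst) => //=; case: (posnP (sv c.2 lst)) => h.
  by rewrite h; case: j.
rewrite -[in RHS](inj_eq Some_inj); case: eqP => [[<-]|_]; last by rewrite andbF.
by rewrite h.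
Qed.

Lemma ncellP j (k : {ffun 'I_q -> 'I_b.+1}) : nrows j ->
  (forall i, (k i < ndm i)%N) -> nrow (ncell j k) = Some j /\ nix (ncell j k) = k.
Proof.
move=> /andP[j0 jd] hk; split.
  by apply/eqP; rewrite nrowE eqxx j0 /= sv_mkp eqxx.
by apply/ffunP => i; apply: val_inj; rewrite /= sv_nix /= sv_mkp wd_lst kext_wd.
Qed.

Lemma nrow_inj c c' j : nrow c = Some j -> nrow c' = Some j -> nix c = nix c' -> c = c'.
Proof.
move=> /eqP; rewrite nrowE => /and3P[/eqP c1 _ /eqP e].
move=> /eqP; rewrite nrowE => /and3P[/eqP c1' _ /eqP e'] ei.
case: c c' c1 c1' e e' ei => [l s] [l' s'] /= -> -> e e' ei; congr (_, _).
apply: sv_inj => m; have [->|[i ->]] := lst_or_wd m; first by rewrite e e'.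
by rewrite -[LHS](sv_nix (lst, s)) -[RHS](sv_nix (lst, s')) ei.
Qed.

Lemma nrow_setl (l : 'I_q.+1) s : nrow (l, setl s 0) = None.
Proof. by rewrite /nrow /= sv_setl_lst ?andbF //; apply/ltnW/hd. Qed.

(* In the new coordinates X is replaced, in the rows of the last player, by its
   differences with the row of the first strategy.  *)
Definition diffc (X : C -> K) : C -> K := fun c =>
  if nrow c is Some _ then X c - X (c.1, setl c.2 0) else X c.
Definition undiffc (X : C -> K) : C -> K := fun c =>
  if nrow c is Some _ then X c + X (c.1, setl c.2 0) else X c.

Lemma diffcK : cancel diffc undiffc.
Proof.
move=> X; apply: funext => c; rewrite /undiffc /diffc nrow_setl.
by case: (nrow c) => // _; rewrite subrK.
Qed.

Lemma undiffcK : cancel undiffc diffc.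
Proof.
move=> X; apply: funext => c; rewrite /undiffc /diffc nrow_setl.
by case: (nrow c) => // _; rewrite addrK.
Qed.

Lemma diffc_form c : isform 1 (fun X => diffc X c).
Proof.
rewrite /diffc; case: (nrow c) => [_|]; last exact: isform_coord.
apply: isform_ext (isformD (isform_coord K c) (isformZ (-1) (isform_coord K (c.1, setl c.2 0)))).
by move=> X; rewrite mulN1r.
Qed.

Lemma undiffc_form c : isform 1 (fun X => undiffc X c).
Proof.
rewrite /undiffc; case: (nrow c) => [_|]; last exact: isform_coord.
exact: isformD (isform_coord K c) (isform_coord K (c.1, setl c.2 0)).
Qed.

Lemma mon_sg (y : 'I_q * 'I_b.+1 -> K) c : mon (sg nix c) y = \prod_i y (i, nix c i).
Proof.
rewrite /mon; transitivity (\prod_i \prod_k y (i, k) ^+ sg nix c (i, k)).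
  by rewrite pair_bigA; apply: eq_bigr => -[].
have sgE r : sg nix c r = (r.2 == nix c r.1) by rewrite ffunE.
apply: eq_bigr => i _; rewrite (bigD1 (nix c i)) //= sgE eqxx expr1 big1 ?mulr1 //.
by move=> k /negbTE h; rewrite sgE /= h expr0.
Qed.

Lemma prod_not_lst (F : 'I_q.+1 -> K) : \prod_(l | l != lst) F l = \prod_i F (wd i).
Proof.
rewrite big_mkcond big_ord_recr /= eqxx mulr1; apply: eq_bigr => i _.
have -> : widen_ord (leqnSn q) i = wd i by [].
by rewrite wd_lst.
Qed.

(** Profiles ending in [k0] are matched with those ending in [k] by replacing the last entry, which
    the coefficient in [y] does not see. *)
Lemma roweqn_nash X (y : 'I_q * 'I_b.+1 -> K) (pi : forall l : 'I_q.+1, 'I_(d l) -> K)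
    (k k0 : 'I_(d lst)) : (0 < k)%N -> k0 = 0%N :> nat ->
  (forall (s : profile q.+1 d) i, pi (wd i) (s (wd i)) = y (i, inord (sv s (wd i)))) ->
  roweqn nrow nix k (diffc X) y = nash_f X pi lst k - nash_f X pi lst k0.
Proof.
move=> k_gt0 k00 hpi.
have kd : (k < d q)%N by apply: (ltn_ord k).
have d0 : (0 < d q)%N by apply: leq_ltn_trans kd.
pose G (s : profile q.+1 d) := \prod_i y (i, inord (sv s (wd i))).
have nashE (m : 'I_(d lst)) : nash_f X pi lst m = \sum_(s | sv s lst == m) X (lst, s) * G s.
  apply: eq_bigr => s _; congr (_ * _); rewrite prod_not_lst.
  by apply: eq_bigr => i _; rewrite hpi.
have -> : nash_f X pi lst k0 = \sum_(s | sv s lst == k) X (lst, setl s 0) * G s.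
  rewrite nashE (reindex_onto (fun s => setl s 0) (fun s => setl s k)) /=.
    apply: eq_big => [s|s _].
      rewrite sv_setl_lst // k00 eqxx /=; apply/eqP/eqP => [<-|e].
        by rewrite sv_setl_lst.
      apply: sv_inj => l; have [->|[i ->]] := lst_or_wd l; last by rewrite !sv_setl_wd.
      by rewrite sv_setl_lst.
    by congr (_ * _); apply: eq_bigr => i _; rewrite sv_setl_wd.
  move=> s /eqP e; apply: sv_inj => l.
  have [->|[i ->]] := lst_or_wd l; last by rewrite !sv_setl_wd.
  by rewrite sv_setl_lst // e k00.
rewrite nashE -sumrB /roweqn.
rewrite (reindex_onto (fun s : profile q.+1 d => (lst, s) : C) (fun c => c.2)) /=; last first.
  by move=> [l s]; rewrite nrowE /= => /andP[/eqP -> _].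
apply: eq_big => [s|s]; first by rewrite nrowE !eqxx k_gt0 andbT.
move=> /andP[/eqP rs _]; rewrite /diffc rs -mulrBl; congr (_ * _).
by rewrite mon_sg; apply: eq_bigr => i _; rewrite ffunE.
Qed.

Definition lastrows : seq nat := iota 1 (d q).-1.

Lemma mem_lastrows j : (j \in lastrows) = (0 < j < d q)%N.
Proof.
have d0 : (0 < d q)%N by apply: ltnW; apply: hd.
by rewrite mem_iota add1n prednK.
Qed.

Lemma nash_Inc X : nash_nonempty X -> exists y, Inc nrow nix lastrows ndm (diffc X) y.
Proof.
move=> [pi [pin pie]].
pose y (r : 'I_q * 'I_b.+1) := if insub (r.2 : nat) : option 'I_(d (wd r.1)) is Some k
  then pi (wd r.1) k else 0.
have yE i (m : 'I_(d (wd i))) : y (i, inord m) = pi (wd i) m.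
  have mb : (m < b.+1)%N by apply: leq_trans (ltn_ord m) (ndm_b i).
  rewrite /y /= inordK //; case: insubP => [k _ /val_inj -> //|].
  by rewrite ltn_ord.
exists y; split.
- by move=> i; have [k hk] := pin (wd i); exists (inord k); rewrite yE.
- by move=> r hr; rewrite /y insubF //; apply/negbTE; rewrite -leqNgt.
- move=> j; rewrite mem_lastrows => /andP[j0 jd]; pose k : 'I_(d lst) := Ordinal (jd : (j < d lst)%N).
  have := pie lst k j0; set k0 := Ordinal _ => e.
  by rewrite (@roweqn_nash X y pi k k0) // ?e ?subrr // => s i; rewrite yE.
Qed.

Hypothesis hc : (\sum_(i < q) (d i).-1 < (d q).-1)%N.

(* The equations of the other players are linear in the mixed strategy of the
   last one, and there are fewer of them than unknowns.  *)
Lemma Inc_nash X y : Inc nrow nix lastrows ndm (diffc X) y -> nash_nonempty X.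
Proof.
move=> [y1 y2 y3].
have d0 : (0 < d q)%N by apply: ltnW; apply: hd.
(* The coefficient of the last player's [u]-th coordinate in the form of player [i] and strategy
   [m]. *)
pose A (i : 'I_q) (m : nat) (u : 'I_(d q)) :=
  \sum_(s : profile q.+1 d | (sv s (wd i) == m) && (sv s lst == u))
    X (wd i, s) * \prod_(i' | i' != i) y (i', inord (sv s (wd i'))).
(* One equation for each of these players and each strategy but the first; [hc] leaves fewer
   equations than the [d q] unknowns. *)
pose L : seq ('I_q * nat) := [seq (i, m) | i : 'I_q <- enum 'I_q, m : nat <- iota 1 (d i).-1].
have sL : (size L < d q)%N.
  rewrite size_allpairs_dep sumnE big_map big_enum /=.
  under eq_bigr do rewrite size_iota.
  by apply: leq_trans hc _; apply: leq_pred.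
have [v [[u0 vu0] hv]] := ker_list (fun u r => A r.1 0%N u - A r.1 r.2 u) sL.
pose pi (l : 'I_q.+1) (k : 'I_(d l)) : K :=
  if insub (l : nat) : option 'I_q is Some i then y (i, inord k) else v (insubd u0 (k : nat)).
have pi_wd i (k : 'I_(d (wd i))) : pi (wd i) k = y (i, inord k).
  by rewrite /pi; case: insubP => [i' _ /val_inj -> //|]; rewrite /= ltn_ord.
have pi_lst (k : 'I_(d lst)) : pi lst k = v (insubd u0 (k : nat)).
  by rewrite /pi; case: insubP => //= i; rewrite ltnn.
have nashE i (k : 'I_(d (wd i))) : nash_f X pi (wd i) k = \sum_u v u * A i k u.
  have -> : nash_f X pi (wd i) k = \sum_(s : profile q.+1 d | sv s (wd i) == k)
      v (insubd u0 (sv s lst)) * (X (wd i, s) * \prod_(i' | i' != i) y (i', inord (sv s (wd i')))).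
    apply: eq_bigr => s _; rewrite mulrCA; congr (_ * _).
    rewrite big_mkcond big_ord_recr /= eq_sym wd_lst pi_lst mulrC; congr (_ * _).
    rewrite [RHS]big_mkcond; apply: eq_bigr => i' _.
    rewrite -[X in _ = X]/(if i' != i then _ else _) -pi_wd.
    by rewrite -(inj_eq val_inj) -[in RHS](inj_eq val_inj).
  rewrite (partition_big (fun s : profile q.+1 d => s lst : 'I_(d q)) xpredT) //=.
  apply: eq_bigr => u _; rewrite /A big_distrr; apply: eq_bigr => s /andP[_ /eqP su] /=.
  by congr (v _ * _); apply: val_inj; rewrite -su /sv insubdK //; exact: (ltn_ord (s lst)).
exists pi; split.
  move=> l; have [->|[i ->]] := lst_or_wd l.
    exists u0; rewrite pi_lst (_ : insubd u0 _ = u0) //.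
    by apply: val_inj; rewrite insubdK //; exact: (ltn_ord u0).
  have [k hk] := y1 i; have kd : (k < d (wd i))%N.
    by rewrite ltnNge; apply: contra hk => /(y2 (i, k)) ->.
  by exists (Ordinal kd); rewrite pi_wd /= inord_val.
move=> l k k0; set z := Ordinal _; have [e|[i e]] := lst_or_wd l; subst l.
  have := @roweqn_nash X y pi k z k0 erefl (fun s i => pi_wd i (s (wd i))).
  rewrite y3; last by rewrite mem_lastrows k0 /=; exact: (ltn_ord k).
  by move/esym/eqP; rewrite subr_eq0 => /eqP ->.
rewrite !nashE; apply/eqP; rewrite -subr_eq0 -sumrB; apply/eqP.
rewrite -[RHS](hv (i, k : nat)); first by apply: eq_bigr => u _; rewrite mulrBr.
apply/allpairsPdep; exists i, (k : nat); split; rewrite ?mem_enum //.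
rewrite mem_iota k0 add1n prednK; first exact: (ltn_ord k).
exact: leq_ltn_trans (ltn_ord k).
Qed.

Lemma nash_locus X : nash_resultant X <-> locus nrow nix lastrows ndm (diffc X).
Proof.
have nz := nonzero_linear diffc_form undiffc_form diffcK X.
split=> [[nX nn]|[nX [y I]]]; split; try exact/nz.
  exact: nash_Inc.
exact: Inc_nash I.
Qed.

End NashCoordinates.

(** Coordinates of [y] are forbidden one at a time until a single one is left to each player. *)
Lemma mu_filtration p (dm : 'I_p -> nat) n kap : valid dm kap -> mu kap = n ->
  exists F : nat -> 'I_p -> nat, [/\ F n = kap,
    forall t, (t <= n)%N -> valid dm (F t) /\ mu (F t) = t &
    forall t i, (t < n)%N -> (F t i <= F t.+1 i)%N].
Proof.
elim: n kap => [|n IH] kap vk mk.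
  by exists (fun=> kap); split => // t; rewrite leqn0 => /eqP ->.
have [i ki] : exists i, (1 < kap i)%N.
  apply: contrapT => h; suff m0 : mu kap = 0%N by rewrite m0 in mk.
  rewrite /mu big1 // => i _.
  have := vk i; case: (ltnP 1 (kap i)) => [ki|]; first by case: h; exists i.
  by case: (kap i) => // -[].
have [|F [Fn Fv Fm]] := IH _ (valid_dec vk ki).
  by have := mu_dec ki; rewrite mk => -[].
exists (fun t => if (t <= n)%N then F t else kap); split.
- by rewrite ltnn.
- move=> t tn; case: (leqP t n) => [/Fv //|nt]; split => //.
  by rewrite mk; apply/eqP; rewrite eqn_leq tn nt.
- move=> t i'; rewrite ltnS => tn; rewrite tn; case: (leqP t.+1 n) => [|nt]; first exact: Fm.
  have -> : t = n by apply/eqP; rewrite eqn_leq tn -ltnS nt.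
  by rewrite Fn leq_subr.
Qed.

(** * Chain of maximal length, dimension and degree of the resultant variety *)

Section NashResultant.
Variables (K : fieldType) (q : nat) (d : nat -> nat).
Hypothesis K0 : forall n, (n.+1%:R : K) != 0.
Hypothesis hd : forall i, (i < q.+1)%N -> (2 <= d i)%N.
Hypothesis hc : (\sum_(i < q) (d i).-1 < (d q).-1)%N.
Notation C := (gcoord q.+1 d).
Notation lst := (@ord_max q).
Notation js := (lastrows q d).
Notation cell := (ncell hd).
Notation row := (@nrow q d).
Notation ix := (@nix q d).
Notation dm := (@ndm q d).
Notation N := #|{: C}|.
Notation locus := (@locus K C q (dbd q d) row ix js).
Local Notation diffc := (@diffc K q d hd).

Lemma size_lastrows : size js = (d q).-1.
Proof. by rewrite size_iota. Qed.

Lemma lastrows_ok : uniq js /\ all (nrows q d) js.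
Proof.
split; first exact: iota_uniq.
by apply/allP => j; rewrite mem_lastrows.
Qed.

Lemma valid_ndm : valid dm dm.
Proof. by move=> i; rewrite leqnn andbT; apply/ltnW/hd/ltnW/ltn_ord. Qed.

Definition c00 : C := (lst, mkp hd (fun=> 0%N)).
Lemma row_c00 : row c00 = None.
Proof. by rewrite /nrow /= sv_mkp ?andbF //; apply/ltnW/hd. Qed.

Definition k00 : {ffun 'I_q -> 'I_(dbd q d).+1} := [ffun=> ord0].
Definition cells := [seq cell j k00 | j <- js].

Lemma cell00 j : j \in js -> row (cell j k00) = Some j /\ ix (cell j k00) = k00.
Proof.
move=> jjs; apply: ncellP; first by have := jjs; rewrite mem_lastrows.
by move=> i; rewrite ffunE; apply/ltnW/hd/ltnW/ltn_ord.
Qed.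

Lemma cells_uniq : uniq cells.
Proof.
rewrite map_inj_in_uniq ?iota_uniq // => j j' jjs j'js e.
have [r1 _] := cell00 jjs; have [r2 _] := cell00 j'js.
by move: r1; rewrite e r2 => -[].
Qed.

Lemma lt_rows : ((d q).-1 < N)%N.
Proof.
rewrite -size_lastrows -(size_map (cell^~ k00)).
have u : uniq (c00 :: cells).
  rewrite /= cells_uniq andbT; apply/mapP => -[j jjs e].
  by have [r _] := cell00 jjs; move: r; rewrite -e row_c00.
by have := max_card (mem (c00 :: cells)); rewrite (card_uniqP u).
Qed.

Definition others : seq C := enum [pred c : C | c \notin cells].

Lemma size_others : size others = (N - (d q).-1)%N.
Proof.
rewrite -cardE -size_lastrows -(size_map (cell^~ k00)) -/cells -(card_uniqP cells_uniq).
rewrite -(cardC (mem cells)) addKn.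
by apply: eq_card => c; rewrite !inE.
Qed.

(** When [y] is the first basis vector for every player, the equations say that the coordinates in
    [cells] vanish. These sets are a complete flag in that linear space; [j.+1] coordinates give
    projective dimension [j]. *)
Definition lin (j : nat) : pset K C :=
  fun x => nonzero x /\ forall c, ~~ (c \in take j.+1 others) -> x c = 0.

Lemma lin_locus j kap : valid dm kap -> psubset (lin j) (locus kap).
Proof.
move=> vk x [nx hx]; split => //; pose k1 : 'I_q -> nat := fun=> 1%N.
have v1 : valid dm k1 by move=> i /=; apply/ltnW/hd/ltnW/ltn_ord.
exists (yall K k1); apply: (@Inc_sub _ _ _ _ _ _ _ k1).
  by move=> i; have /andP[] := vk i.
split.
- by move=> i; exists ord0; rewrite /yall oner_neq0.
- by move=> r hr; rewrite /yall ltnNge hr.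
- move=> j' j'js; rewrite /roweqn big1 // => c /eqP rc.
  have [[r1 i1]] := cell00 j'js; have [e|ne] := eqVneq (ix c) k00.
    have -> : c = cell j' k00 by apply: (nrow_inj rc r1); rewrite e i1.
    rewrite hx ?mul0r //; apply/negP => /mem_take; rewrite mem_enum inE.
    by move/negP; apply; apply/mapP; exists j'.
  suff [i hi] : exists i, ix c i != ord0.
    rewrite (@mon_eq0 _ _ _ _ (i, ix c i)) ?mulr0 //; first by rewrite ffunE eqxx.
    by rewrite /yall /= ltnS leqn0 (negbTE (hi : (ix c i : nat) != 0%N)).
  apply: contrapT => h; case/eqP: ne; apply/ffunP => i; rewrite [RHS]ffunE.
  by apply/eqP; apply: contraT => hi; case: h; exists i.
Qed.

Lemma locus_mono kap kap' : (forall i, kap i <= kap' i)%N -> psubset (locus kap) (locus kap').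
Proof. by move=> le x [nx [y I]]; split => //; exists y; apply: Inc_sub I. Qed.

Lemma locus_forms kap : valid dm kap -> (exists x, locus kap x) /\ form_irr (locus kap).
Proof.
move=> vk; have [u r] := lastrows_ok; split.
  exact: (locus_neq0 K _ row_c00 js vk).
move=> t s f g ff fg.
exact: (locus_irr K0 (ncellP hd) (c0 := c00) row_c00 r vk ff fg).
Qed.

Lemma locus_hilb kap : valid dm kap -> (mu kap < (d q).-1)%N ->
  exists (P : {poly rat}) t0 (e : nat),
  [/\ forall t, (t0 <= t)%N -> (hf (locus kap) t)%:R = P.[t%:R],
      size P = (N.-1 - ((d q).-1 - mu kap)).+1,
      lead_coef P * ((N.-1 - ((d q).-1 - mu kap))`!)%:R = e%:R &
     (e * (\prod_i (kap i).-1`! * ((d q).-1 - mu kap)`!) = ((d q).-1)`!)%N].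
Proof.
move=> vk lm; have [u r] := lastrows_ok.
have := locus_hilbert K0 (@ndm_b q d) (ncellP hd) row_c00 vk u r.
by rewrite size_lastrows lm lt_rows; apply.
Qed.

(** The Hilbert polynomials have consecutive degrees, so the second function exceeds the first at
    some [t]. *)
Lemma locus_step kap kap' : valid dm kap -> valid dm kap' -> mu kap' = (mu kap).+1 ->
  (mu kap' < (d q).-1)%N ->
  exists t, (hf (locus kap) t < hf (locus kap') t)%N.
Proof.
move=> vk vk' e lm.
have [|P [t0 [_ [h1 s1 _ _]]]] := locus_hilb vk; first by apply: ltnW; rewrite -e.
have [P' [t1 [_ [h2 s2 _ _]]]] := locus_hilb vk' lm.
apply: contrapT => h; have : (size P' <= size P)%N.
  apply: (@poly_ev_le _ _ (maxn t0 t1)) => t; rewrite geq_max => /andP[ht0 ht1].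
  rewrite -h1 // -h2 // ler0n ler_nat leqNgt; apply/negP => lt; apply: h; by exists t.
rewrite s1 s2 e; have := lt_rows; move: lm; rewrite e; clear.
move: (d q).-1 N (mu kap) => *; lia.
Qed.

Lemma nash_chain : exists Z : nat -> pset K C,
  pchain (@nash_resultant K q.+1 d) (N.-1 - ((d q).-1 - mu dm)) Z.
Proof.
have [F [Fn Fv Fm]] := mu_filtration valid_ndm erefl.
have lm : (mu dm < (d q).-1)%N by exact: hc.
(* The projective dimension of the linear space that ends the flag [lin]. *)
pose q0 := (N.-1 - (d q).-1)%N.
have rE : (N.-1 - ((d q).-1 - mu dm) = q0 + mu dm)%N.
  rewrite /q0; have := lt_rows; move: lm; clear; move: (d q).-1 N (mu dm) => *; lia.
pose W j : pset K C := fun X =>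
  if (j <= q0)%N then lin j (diffc X) else locus (F (j - q0)%N) (diffc X).
have monoF t : (t <= mu dm)%N -> psubset (locus (F t)) (locus dm).
  move=> tm; have {1}-> : t = (mu dm - (mu dm - t))%N by rewrite subKn.
  elim: (mu dm - t)%N => [|k IH]; first by rewrite subn0 Fn.
  case: (ltnP k (mu dm)) => hk; last first.
    by have -> : (mu dm - k.+1 = mu dm - k)%N by move: hk; clear; lia.
  move=> x Lx; apply: IH; apply: locus_mono Lx => i.
  have -> : (mu dm - k = (mu dm - k.+1).+1)%N by move: hk; clear; lia.
  by apply: Fm; move: hk; clear; lia.
have [v0 m0] := Fv 0%N (leq0n _).
rewrite rE; apply: (@chain_exists _ _ _ _ W) => [X []//| j jr | j jr].
- rewrite /W; case: (leqP j q0) => hj; split.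
  + move=> X /(lin_locus v0)/(monoF _ (leq0n _)) LX; exact/(nash_locus hd hc).
  + have js0 : (0 < size others)%N.
      by rewrite size_others subn_gt0 lt_rows.
    pose c := nth c00 others 0; exists (undiffc hd (fun c' => (c' == c)%:R)).
    rewrite undiffcK; split; first by exists c; rewrite eqxx oner_neq0.
    move=> c' hc'; case: eqP => // e; case/negP: hc'; rewrite e /c.
    by case: (others) js0 => // *; rewrite mem_head.
  + have irr : form_irr (lin j).
      exact: (@coord_subspace_irr K _ (fun c => c \in take j.+1 others) K0).
    exact: (form_irr_linear (@undiffc_form K _ _ hd) (diffcK hd) (undiffcK hd) irr).
  + have [v _] := Fv (j - q0)%N (leq_trans (leq_sub2r q0 jr) (eq_leq (addKn _ _))).
    move=> X /monoF LX; apply/(nash_locus hd hc); apply: LX.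
    by rewrite leq_subLR.
  + have [v _] := Fv (j - q0)%N (leq_trans (leq_sub2r q0 jr) (eq_leq (addKn _ _))).
    have [[x Lx] _] := locus_forms v; exists (undiffc hd x); by rewrite undiffcK.
  + have [v _] := Fv (j - q0)%N (leq_trans (leq_sub2r q0 jr) (eq_leq (addKn _ _))).
    have [_ irr] := locus_forms v.
    exact: (form_irr_linear (@undiffc_form K _ _ hd) (diffcK hd) (undiffcK hd) irr).
- have [hj|hj] := ltnP j q0.
    rewrite /W (ltnW hj) hj; split.
      move=> X [nX hX]; split => // c hc'; apply: hX; apply: contra hc'.
      have -> : take j.+1 others = take j.+1 (take j.+2 others) by rewrite take_takel.
      exact: mem_take.
    have js1 : (j.+1 < size others)%N.
      rewrite size_others; move: hj; rewrite /q0; have := lt_rows; clear.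
      move: (d q).-1 N => *; lia.
    pose c := nth c00 others j.+1.
    exists 1%N, (fun X => diffc X c); split; first exact: diffc_form.
      move=> X [_ hX]; apply: hX; apply/negP => h.
      have := nth_uniq c00 js1 _ (enum_uniq [pred c : C | c \notin cells]).
      move=> /(_ (index c (take j.+1 others))).
      have it : (index c (take j.+1 others) < j.+1)%N.
        by have := h; rewrite -index_mem size_take js1.
      rewrite (ltn_trans it js1) => /(_ isT).
      rewrite -/others -/c -(nth_take c00 it) nth_index // eqxx => /esym/eqP e.
      by move: it; rewrite -e ltnn.
    exists (undiffc hd (fun c' => (c' == c)%:R)); rewrite undiffcK ?eqxx ?oner_neq0 //.
    split; first by exists c; rewrite eqxx oner_neq0.
    move=> c' hc'; case: eqP => // e; case/negP: hc'; rewrite e /c.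
    by rewrite -(nth_take c00 (ltnSn j.+1)) mem_nth // size_take; case: ifP.
pose t := (j - q0)%N.
have tm : (t < mu dm)%N by move: jr hj; rewrite /t; clear; move: (mu dm) => *; lia.
have tS : (j.+1 - q0 = t.+1)%N by rewrite subSn.
have [vt mt] := Fv t (ltnW tm); have [vt1 mt1] := Fv t.+1 tm.
(* At [j = q0] the member is still the linear space [lin q0], for which containment in [locus (F 0)]
   suffices. *)
have sub : psubset (W j) (fun X => locus (F t) (diffc X)).
  move=> X; rewrite /W; case: leqP => // _; exact: lin_locus.
have [||t' lt] := locus_step vt vt1.
- by rewrite mt1 mt.
- by rewrite mt1; apply: leq_ltn_trans lm.
have [f [ff f0 [x Lx fx]]] := separating_form lt.
have WS : W j.+1 = fun X => locus (F t.+1) (diffc X) by rewrite /W leqNgt ltnS hj /= tS.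
rewrite WS; split.
  move=> X /sub; apply: locus_mono => i; exact: Fm.
exists t', (fun X => f (diffc X)); split.
- exact: (isform_comp (@diffc_form K _ _ hd) ff).
- by move=> X /sub; apply: f0.
- by exists (undiffc hd x); rewrite undiffcK.
Qed.

Lemma nash_main :
  let c := ((d q).-1 - \sum_(i < q) (d i).-1)%N in
  let Y := @nash_resultant K q.+1 d in
  pirreducible Y /\ pdim Y (N.-1 - c)%N /\
  exists e : nat, pdegree Y e /\
    (e%:R : rat) = ((d q).-1)`!%:R / ((\prod_(i < q) ((d i).-1)`!) * c`!)%:R.
Proof.
move=> c Y.
have YE : Y = fun X => locus dm (diffc X).
  by apply: funext => X; apply: propext; apply: nash_locus.
have [u r] := lastrows_ok; have [[x Lx] irr] := locus_forms valid_ndm.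
have [P [t0 [e [hP sP lP eE]]]] := locus_hilb valid_ndm hc.
rewrite -/c in sP lP eE.
have hY t : hf Y t = hf (locus dm) t.
  rewrite YE; exact: (hf_linear (@diffc_form K _ _ hd) (@undiffc_form K _ _ hd) (diffcK hd) (undiffcK hd)).
have dimY : pdim Y (N.-1 - c)%N.
  split; first exact: nash_chain.
  move=> r' Z /chain_bound hb; rewrite -ltnS -sP; apply: (hb _ t0) => t ht.
  by rewrite hY hP.
split; last split => //.
  apply: pirreducible_forms.
    by exists (undiffc hd x); rewrite YE undiffcK.
  rewrite YE.
  exact: (form_irr_linear (@undiffc_form K _ _ hd) (diffcK hd) (undiffcK hd) irr).
exists e; split.
  exists (N.-1 - c)%N; split => //; exists P, t0; split => //; split => // t ht.
  by exists (hf Y t); split; [exact: hilb_hf|rewrite hY hP].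
rewrite -eE natrM mulfK // pnatr_eq0 -lt0n muln_gt0 fact_gt0 andbT.
by apply: prodn_gt0 => i; apply: fact_gt0.
Qed.

End NashResultant.

Theorem theorem3p31 (R : realType) (n : nat) (d : nat -> nat)
  (hn : (2 <= n)%N) (hd : forall i, (i < n)%N -> (2 <= d i)%N)
  (hc : (\sum_(i < n.-1) (d i).-1 < (d n.-1).-1)%N) :
  let c := ((d n.-1).-1 - \sum_(i < n.-1) (d i).-1)%N in
  let Y := @nash_resultant R[i] n d in
  pirreducible Y /\
  pdim Y (#|{: gcoord n d}|.-1 - c)%N /\
  exists e : nat, pdegree Y e /\
    (e%:R : rat) = ((d n.-1).-1)`!%:R /
                   ((\prod_(i < n.-1) ((d i).-1)`!) * c`!)%:R.
Proof.
case: n hn hd hc => // q _ hd hc.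
by apply: nash_main => // k; rewrite pnatr_eq0.
Qed.
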